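(* Let $(M,\omega)$ be a compact balanced Hermitian manifold of complex dimension $n$, let $\lambda_1>0$ be the first positive eigenvalue of the Laplace--de Rham operator $\Delta_d$ on functions, let $u\in C^\infty(M,\mathbb R)$ be a corresponding eigenfunction ($u\not\equiv0$, $\Delta_du=\lambda_1u$), and let $U=h^{i\bar k}\frac{\partial u}{\partial\bar z^k}\frac{\partial}{\partial z^i}$. If there is a constant $K>0$ such that the holomorphic Ricci curvature of the Strominger--Bismut connection satisfies $$\mathcal{R}ic^{SB,\mathbb{C}}(U,\overline{U})\geq(2n-1)K|U|^2$$ on $M$, then $$\lambda_1\geq 2nK.$$
   Context: $(M,\omega)$ is a Hermitian manifold with complex structure $J$, Hermitian metric $h$ and fundamental form $\omega=\sqrt{-1}\,h_{i\bar j}\,dz^i\wedge d\bar z^j$ (summation convention; $(h^{i\bar j})$ is the inverse matrix of $(h_{i\bar j})$). It is balanced if $d\omega^{n-1}=0$. The background Riemannian metric $g$ satisfies $g(JX,JY)=g(X,Y)$, $\omega(X,Y)=g(JX,Y)$, and its $\mathbb{C}$-bilinear extension satisfies $g(\partial_{z^i},\partial_{\bar z^j})=h_{i\bar j}$, $g(\partial_{z^i},\partial_{z^j})=0$. For $W=W^i\partial_{z^i}$, $|W|^2=h_{i\bar j}W^i\overline{W^j}$. $\Delta_d=d^*d+dd^*$. The Strominger--Bismut connection ${}^{SB}\nabla$ is the unique connection on $T_{\mathbb R}M$ with ${}^{SB}\nabla g=0$, ${}^{SB}\nabla J=0$, and torsion $g({}^{SB}\nabla_XY-{}^{SB}\nabla_YX-[X,Y],Z)$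 totally skew-symmetric. Its curvature is $R^{SB,\mathbb R}(X,Y,Z,W)=g({}^{SB}\nabla_X{}^{SB}\nabla_YZ-{}^{SB}\nabla_Y{}^{SB}\nabla_XZ-{}^{SB}\nabla_{[X,Y]}Z,W)$, and $R^{SB,\mathbb C}$ is its $\mathbb C$-multilinear extension. The holomorphic Ricci curvature is $$\mathcal{R}ic^{SB,\mathbb C}(W,\overline W)=h^{i\bar l}R^{SB,\mathbb C}\big(\partial_{z^i},\overline W,W,\partial_{\bar z^l}\big),\qquad W\in\Gamma(M,T^{1,0}M).$$ *)

(* Defs.v *)
From HB Require Import structures.
From mathcomp Require Import all_boot all_order all_algebra.
From mathcomp Require Import all_classical all_reals all_analysis.
From mathcomp Require Import complex.
Set Implicit Arguments.
Unset Strict Implicit.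
Unset Printing Implicit Defensive.
Import Order.TTheory GRing.Theory Num.Theory.
Import numFieldNormedType.Exports.

Local Open Scope classical_set_scope.
Local Open Scope ring_scope.

Section Coordinates.
Context {R : realType} {m : nat}.
Implicit Types (D : set 'rV[R]_m) (x v : 'rV[R]_m) (X Y : 'rV[R]_m -> 'rV[R]_m).

Definition partial (i : 'I_m) (f : 'rV[R]_m -> R) : 'rV[R]_m -> R :=
  fun x => 'D_(delta_mx 0 i) f x.

(* The domains D are always open, so the values of f outside D are irrelevant. *)
Fixpoint Ck_on (k : nat) D (f : 'rV[R]_m -> R) : Prop :=
  (forall x, D x -> {for x, continuous f}) /\
  match k with
  | 0 => True
  | k'.+1 => forall i, (forall x, D x -> derivable f x (delta_mx 0 i)) /\
                       Ck_on k' D (partial i f)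
  end.

Definition smooth_on D f := forall k, Ck_on k D f.

Definition smooth_map_on p D (F : 'rV[R]_m -> 'rV[R]_p) :=
  forall j, smooth_on D (fun x => F x 0 j).

Definition lie_bracket X Y : 'rV[R]_m -> 'rV[R]_m :=
  fun x => 'D_(X x) Y x - 'D_(Y x) X x.

(* [Gamma x i j] is the tangent vector (nabla_{d_i} d_j)(x). *)
Definition christoffel := 'rV[R]_m -> 'I_m -> 'I_m -> 'rV[R]_m.

Definition covariant (Gamma : christoffel) X Y : 'rV[R]_m -> 'rV[R]_m :=
  fun x => 'D_(X x) Y x + \sum_i \sum_j (X x 0 i * Y x 0 j) *: Gamma x i j.

Definition curvature (Gamma : christoffel) X Y Z : 'rV[R]_m -> 'rV[R]_m :=
  fun x => covariant Gamma X (covariant Gamma Y Z) x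
           - covariant Gamma Y (covariant Gamma X Z) x
           - covariant Gamma (lie_bracket X Y) Z x.

(* A differential form is given by its components in the frame (d_0, .., d_(m-1)):
   [al x [:: i_1; ..; i_p]] is al_x (d_{i_1}, .., d_{i_p}).  All degrees are kept
   together: a p-form is supported on the sequences of length p. *)
Definition form := 'rV[R]_m -> seq 'I_m -> R.

Definition form0 (f : 'rV[R]_m -> R) : form :=
  fun x s => if s is [::] then f x else 0.

Definition ext_d (al : form) : form := fun x s =>
  \sum_(k < size s)
    (-1) ^+ k *
    (if onth s k is Some i
     then partial i (fun y => al y (take k s ++ drop k.+1 s)) x else 0).

(* Sum over (p, q)-shuffles: the positions where b is true go to al, the others
   to be; the sign is given by the number of inversions of the shuffle. *)
Definition wedge (al be : form) : form := fun x s =>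
  \sum_(b : (size s).-tuple bool)
    (-1) ^+ (\sum_(i < size s) \sum_(j < size s | i < j)
                (~~ tnth b i && tnth b j))%N *
    al x (mask b s) * be x (mask (map negb b) s).

Definition wedge_pow (al : form) (k : nat) : form :=
  iter k (wedge al) (form0 (fun=> 1)).

(* For [size s = m], the Levi-Civita symbol of s. *)
Definition levi_civita (s : seq 'I_m) : R :=
  \det (\matrix_(i < m, j < m) (onth s i == Some j)%:R).

(* star(al)_{j_1..j_q} =
     sqrt(det g) / p! * al^{i_1..i_p} eps_{i_1..i_p j_1..j_q},  p + q = m. *)
Definition hodge_star (g : 'rV[R]_m -> 'M[R]_m) (al : form) : form := fun x s =>
  if (size s <= m)%N then
    Num.sqrt (\det (g x)) / ((m - size s)`!)%:R *
    \sum_(t : (m - size s).-tuple 'I_m)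
      levi_civita (t ++ s) *
      \sum_(r : (m - size s).-tuple 'I_m)
        (\prod_(k < m - size s) invmx (g x) (tnth t k) (tnth r k)) * al x r
  else 0.

(* The sign is the one of even dimension, which is the only case used below. *)
Definition codiff (g : 'rV[R]_m -> 'M[R]_m) (al : form) : form :=
  fun x s => - hodge_star g (ext_d (hodge_star g al)) x s.

Definition laplace_de_rham (g : 'rV[R]_m -> 'M[R]_m) (al : form) : form :=
  fun x s => codiff g (ext_d al) x s + ext_d (codiff g al) x s.

End Coordinates.

(* The bilinear form with Gram matrix G. *)
Definition bil (K : pzRingType) (m : nat) (G : 'M[K]_m) (v w : 'rV[K]_m) : K :=
  (v *m G *m w^T) 0 0.

(* C^n is R^(n + n) with coordinates (x^1, .., x^n, y^1, .., y^n),
   z^i = x^i + sqrt(-1) y^i.  Tangent vectors are row vectors, and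
   J v is [v *m Jstd], that is J d/dx^i = d/dy^i and J d/dy^i = - d/dx^i. *)
Definition Jstd {R : realType} {n : nat} : 'M[R]_(n + n) :=
  block_mx 0 1%:M (- 1%:M) 0.

(* The Cauchy-Riemann equations say that the differential commutes with J. *)
Definition holomorphic_on (R : realType) (n : nat) (D : set 'rV[R]_(n + n))
    (F : 'rV[R]_(n + n) -> 'rV[R]_(n + n)) : Prop :=
  smooth_map_on D F /\ forall x, D x -> Jstd *m 'J F x = 'J F x *m Jstd.

(* [coord a] is a homeomorphism from the open set [chart_dom a] to an open subset
   of C^n, with inverse [param a]. *)
Record complexManifold (R : realType) (n : nat) := ComplexManifold {
  carrier :> topologicalType;
  carrier_hausdorff : hausdorff_space carrier;
  carrier_second_countable : @second_countable carrier;
  chart : Type;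
  chart_dom : chart -> set carrier;
  coord : chart -> carrier -> 'rV[R]_(n + n);
  param : chart -> 'rV[R]_(n + n) -> carrier;
  chart_dom_open : forall a, open (chart_dom a);
  chart_img_open : forall a, open (coord a @` chart_dom a);
  coordK : forall a p, chart_dom a p -> param a (coord a p) = p;
  coord_continuous : forall a p, chart_dom a p -> {for p, continuous (coord a)};
  param_continuous : forall a x, (coord a @` chart_dom a) x ->
    {for x, continuous (param a)};
  chart_cover : forall p, exists a, chart_dom a p;
  transition_holomorphic : forall a b,
    holomorphic_on (coord a @` (chart_dom a `&` chart_dom b))
                   (coord b \o param a)
}.

Section Manifold.
Context {R : realType} {n : nat} {M : complexManifold R n}.
Implicit Types (a b : chart M).

Definition chart_img a : set 'rV[R]_(n + n) := coord a @` chart_dom a.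

Definition overlap a b : set 'rV[R]_(n + n) :=
  coord a @` (chart_dom a `&` chart_dom b).

Definition transition a b : 'rV[R]_(n + n) -> 'rV[R]_(n + n) :=
  coord b \o param a.

Definition smooth_fun (u : M -> R) : Prop :=
  forall a, smooth_on (chart_img a) (u \o param a).

Definition pushforward a b (X : 'rV[R]_(n + n) -> 'rV[R]_(n + n)) :
    'rV[R]_(n + n) -> 'rV[R]_(n + n) :=
  fun y => X (transition b a y) *m 'J (transition a b) (transition b a y).

(* A Hermitian metric, given by its background Riemannian metric g:
   [metric a x] is the Gram matrix of g in the frame (d/dx^i, d/dy^i) of chart a. *)
Record hermitianMetric := HermitianMetric {
  metric :> chart M -> 'rV[R]_(n + n) -> 'M[R]_(n + n);
  metric_smooth : forall a i j,
    smooth_on (chart_img a) (fun x => metric a x i j);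
  metric_sym : forall a x, chart_img a x ->
    forall v w, bil (metric a x) v w = bil (metric a x) w v;
  metric_pos : forall a x, chart_img a x ->
    forall v, v != 0 -> 0 < bil (metric a x) v v;
  metric_J : forall a x, chart_img a x ->
    forall v w, bil (metric a x) (v *m Jstd) (w *m Jstd) = bil (metric a x) v w;
  metric_transition : forall a b x, overlap a b x -> forall v w,
    bil (metric a x) v w =
    bil (metric b (transition a b x))
        (v *m 'J (transition a b) x) (w *m 'J (transition a b) x)
}.

(* omega(X, Y) = g(JX, Y) *)
Definition fundamental_form (g : hermitianMetric) a : form := fun x s =>
  match s with
  | [:: i; j] => bil (g a x) (delta_mx 0 i *m Jstd) (delta_mx 0 j)
  | _ => 0
  end.

Definition balanced (g : hermitianMetric) : Prop :=
  forall a x s, chart_img a x ->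
    ext_d (wedge_pow (fundamental_form g a) n.-1) x s = 0.

(* An affine connection on the real tangent bundle, given in every chart by its
   Christoffel symbols. *)
Record affineConnection := AffineConnection {
  connection :> chart M -> @christoffel R (n + n);
  connection_smooth : forall a i j,
    smooth_map_on (chart_img a) (fun x => connection a x i j);
  connection_transition : forall a b X Y,
    smooth_map_on (overlap a b) X -> smooth_map_on (overlap a b) Y ->
    forall y, overlap b a y ->
      pushforward a b (covariant (connection a) X Y) y =
      covariant (connection b) (pushforward a b X) (pushforward a b Y) y
}.

Definition metric_compatible (g : hermitianMetric) (nabla : affineConnection) :=
  forall a X Y Z, smooth_map_on (chart_img a) X ->
    smooth_map_on (chart_img a) Y -> smooth_map_on (chart_img a) Z ->
    forall x, chart_img a x ->
      'D_(X x) (fun y => bil (g a y) (Y y) (Z y)) x =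
      bil (g a x) (covariant (nabla a) X Y x) (Z x) +
      bil (g a x) (Y x) (covariant (nabla a) X Z x).

Definition J_compatible (nabla : affineConnection) :=
  forall a X Y, smooth_map_on (chart_img a) X ->
    smooth_map_on (chart_img a) Y ->
    forall x, chart_img a x ->
      covariant (nabla a) X (fun y => Y y *m Jstd) x =
      covariant (nabla a) X Y x *m Jstd.

Definition torsion3 (g : hermitianMetric) (nabla : affineConnection) a X Y Z x :=
  bil (g a x)
      (covariant (nabla a) X Y x - covariant (nabla a) Y X x - lie_bracket X Y x)
      (Z x).

Definition skew_torsion (g : hermitianMetric) (nabla : affineConnection) :=
  forall a X Y Z, smooth_map_on (chart_img a) X ->
    smooth_map_on (chart_img a) Y -> smooth_map_on (chart_img a) Z ->
    forall x, chart_img a x ->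
      torsion3 g nabla a X Y Z x = - torsion3 g nabla a Y X Z x /\
      torsion3 g nabla a X Y Z x = - torsion3 g nabla a X Z Y x.

Definition strominger_bismut (g : hermitianMetric) (nabla : affineConnection) :=
  [/\ metric_compatible g nabla, J_compatible nabla & skew_torsion g nabla].

(* R(d_i, d_j, d_k, d_l) for the real coordinate fields of chart a. *)
Definition curv_real (g : hermitianMetric) (nabla : affineConnection) a x
    (i j k l : 'I_(n + n)) : R :=
  bil (g a x)
      (curvature (nabla a) (cst (delta_mx 0 i)) (cst (delta_mx 0 j))
                 (cst (delta_mx 0 k)) x)
      (delta_mx 0 l).

Definition curv_complex (g : hermitianMetric) (nabla : affineConnection) a x
    (v1 v2 v3 v4 : 'rV[R[i]]_(n + n)) : R[i] :=
  \sum_i \sum_j \sum_k \sum_l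
    v1 0 i * v2 0 j * v3 0 k * v4 0 l * (curv_real g nabla a x i j k l)%:C%C.

(* d/dz^i = (d/dx^i - sqrt(-1) d/dy^i) / 2 *)
Definition dz (i : 'I_n) : 'rV[R[i]]_(n + n) :=
  2^-1 *: row_mx (delta_mx 0 i) (- 'i%C *: delta_mx 0 i).

Definition conj_vec p (v : 'rV[R[i]]_p) : 'rV[R[i]]_p :=
  map_mx (fun z : R[i] => z^*%C) v.

Definition dzbar (i : 'I_n) : 'rV[R[i]]_(n + n) := conj_vec (dz i).

(* h_{i jbar} = g(d/dz^i, d/dzbar^j) *)
Definition herm (g : hermitianMetric) a x : 'M[R[i]]_n :=
  \matrix_(i, j) bil (map_mx (fun r : R => r%:C%C) (g a x)) (dz i) (dzbar j).

(* h^{i jbar}, normalized by h^{i lbar} h_{j lbar} = delta^i_j; hence the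
   transpose. *)
Definition herm_inv (g : hermitianMetric) a x : 'M[R[i]]_n :=
  (invmx (herm g a x))^T.

(* Vectors of type (1,0) are given by their components W^i: W = W^i d/dz^i. *)
Definition vec10 (W : 'rV[R[i]]_n) : 'rV[R[i]]_(n + n) :=
  \sum_i W 0 i *: dz i.

Definition norm2 (g : hermitianMetric) a x (W : 'rV[R[i]]_n) : R[i] :=
  \sum_i \sum_j herm g a x i j * W 0 i * (W 0 j)^*%C.

Definition holomorphic_ricci (g : hermitianMetric) (nabla : affineConnection) a x
    (W : 'rV[R[i]]_n) : R[i] :=
  \sum_i \sum_l herm_inv g a x i l *
    curv_complex g nabla a x (dz i) (conj_vec (vec10 W)) (vec10 W) (dzbar l).

(* du/dzbar^k = (du/dx^k + sqrt(-1) du/dy^k) / 2 *)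
Definition partial_zbar (u : M -> R) a x (k : 'I_n) : R[i] :=
  2^-1 * ((partial (lshift n k) (u \o param a) x)%:C%C +
          'i%C * (partial (rshift n k) (u \o param a) x)%:C%C).

(* U^i = h^{i kbar} du/dzbar^k *)
Definition grad10 (g : hermitianMetric) (u : M -> R) a x : 'rV[R[i]]_n :=
  \row_i \sum_k herm_inv g a x i k * partial_zbar u a x k.

Definition eigenfunction (g : hermitianMetric) (lambda : R) (u : M -> R) : Prop :=
  [/\ smooth_fun u, exists p, u p != 0 &
      forall a x, chart_img a x ->
        laplace_de_rham (g a) (form0 (u \o param a)) x [::] =
        lambda * u (param a x)].

Definition first_positive_eigenvalue (g : hermitianMetric) (lambda : R) : Prop :=
  [/\ 0 < lambda, exists u, eigenfunction g lambda u &
      forall mu, 0 < mu -> (exists u, eigenfunction g mu u) -> lambda <= mu].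

End Manifold.

Arguments hermitianMetric {R n} M.
Arguments affineConnection {R n} M.

(* Main.v *)
Require Import Defs.
From HB Require Import structures.
From mathcomp Require Import all_boot all_order all_algebra perm.
From mathcomp Require Import all_classical all_reals all_analysis.
From mathcomp Require Import complex ring lra zify.
Import Order.TTheory GRing.Theory Num.Theory.
Import numFieldNormedType.Exports.

(** The bound is a pointwise consequence of the maximum principle. Let X be the
    Riemannian gradient of the eigenfunction u and write nabla for the
    Strominger-Bismut connection, R for its curvature, T for its torsion, lambda
    for the eigenvalue and m = 2n for the real dimension. Set
    rho(v, w) = tr (z |-> R(z, v) w).

    Reduction to a real Ricci bound. The vector U is (X - i J X) / 2, so
    |U|^2 = |X|^2 / 2, and since nabla J = 0 the real part of the holomorphic
    Ricci curvature at U is (rho(X, X) + rho(J X, J X)) / 4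
    ([Re_holomorphic_ricci_grad10], [curv_J]). For a balanced metric rho is J-invariant on
    the diagonal ([ricci_J]): the failure of the pair symmetry of R is a sum of
    covariant derivatives of T ([curv_pair_exchange], from the Bianchi identity),
    and contracted with J it becomes a derivative of the trace
    tr (v |-> J T(v, b)). This trace is zero for a balanced metric
    ([torsion_balanced]): d omega is expressed by T, the condition
    d omega^(n-1) = 0 reads omega^(n-2) d omega = 0, and the commutation of the
    Lefschetz operator with its adjoint shows that such a 3-form is primitive
    ([contraction_eq0]). Hence rho(X, X) >= (m - 1) K |X|^2.

    Maximum principle. The torsion is totally skew, so it has no trace, and the
    Laplace-de Rham operator on functions is minus the divergence of nabla
    applied to the gradient ([laplace_gradient]). The Bochner identity
    ([divergence_covariant_self]) reads
      div (nabla_X X) = X (div X) + rho(X, X) + |nabla X|^2,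
    where skewness turns the last trace into a square, at least (div X)^2 / m
    ([hessian_trace_ge]). For c > 0 the function |X|^2 + c u^2 has gradient 2 Z
    with Z = nabla_X X + c u X. At a maximum Z = 0 and div Z <= 0, which gives
      (lambda / m - c) lambda u^2 + ((m - 1) K - lambda + c) |X|^2 <= 0
    ([maximum_estimate]). If lambda < m K, some c > 0 makes both coefficients
    positive ([coupling_constant]); then u and X vanish at the maximum, hence
    the function is nonpositive everywhere and u = 0, a contradiction. The
    maximum exists by compactness, the function being independent of the chart
    ([energy_transition]). *)

Set Implicit Arguments.
Unset Strict Implicit.
Unset Printing Implicit Defensive.

Local Open Scope classical_set_scope.
Local Open Scope ring_scope.

(** * Mean value theorem and differentiability *)

Section RowNorm.
Context {R : realType} {m : nat}.
Implicit Types v : 'rV[R]_m.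

Lemma rv_norm_coord v j : `|v 0 j| <= `|v|.
Proof.
rewrite [leRHS]/Num.Def.normr/= mx_normrE.
exact: (le_bigmax _ (fun i : 'I_1 * 'I_m => `|v i.1 i.2|) (0, j)).
Qed.

Lemma rv_norm_le v e : 0 <= e -> (forall j, `|v 0 j| <= e) -> `|v| <= e.
Proof.
move=> e0 h; rewrite [leLHS]/Num.Def.normr/= mx_normrE.
by apply: bigmax_le => // -[i j] _ /=; rewrite ord1.
Qed.

End RowNorm.

Section Lines.
Context {R : realType} {m : nat}.
Implicit Types (f : 'rV[R]_m -> R) (x v : 'rV[R]_m).

Lemma is_derive_line f x v (t : R) : derivable f (t *: v + x) v ->
  is_derive t 1 (fun s => f (s *: v + x)) ('D_v f (t *: v + x)).
Proof.
move=> df.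
have E : (fun h : R => h^-1 *: (((fun s => f (s *: v + x)) \o shift t) (h *: 1) -
      f (t *: v + x))) =
    (fun h => h^-1 *: ((f \o shift (t *: v + x)) (h *: v) - f (t *: v + x))).
  by apply/funext => h /=; rewrite [h *: 1]mulr1 scalerDl addrA.
by apply: DeriveDef; rewrite ?/derivable ?/derive E.
Qed.

Lemma mean_value_segment f x v (a b : R) : a < b ->
  (forall t : R, a <= t <= b -> derivable f (t *: v + x) v) ->
  exists2 c : R, a < c < b &
    f (b *: v + x) - f (a *: v + x) = 'D_v f (c *: v + x) * (b - a).
Proof.
move=> ab df; pose g (s : R) := f (s *: v + x).
have dg (t : R) : t \in `[a, b]%R -> is_derive t 1 g ('D_v f (t *: v + x)).
  by rewrite in_itv /= => tab; apply: is_derive_line; exact: df.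
have cg : {within `[a, b], continuous g}.
  by apply: derivable_within_continuous => t tab; case: (dg t tab).
have [c cab E] := MVT ab (fun t th => dg t (subset_itv_oo_cc th)) cg.
by exists c.
Qed.

Lemma mean_value_line f x v (h : R) :
  (forall t : R, `|t| <= `|h| -> derivable f (t *: v + x) v) ->
  exists2 c : R, `|c| <= `|h| &
    f (h *: v + x) - f x = 'D_v f (c *: v + x) * h.
Proof.
move=> df; have [h0|h0|->] := ltgtP h 0; last first.
- by exists 0; rewrite ?normr0// scale0r add0r subrr mulr0.
- have [|c /andP[c0 ch]] := @mean_value_segment f x v 0 h h0.
    by move=> t /andP[t0 th]; apply: df; rewrite (gtr0_norm h0) ger0_norm.
  rewrite subr0 scale0r add0r => E; exists c => //.
  by rewrite (gtr0_norm h0) gtr0_norm // ltW.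
- have [|c /andP[hc c0]] := @mean_value_segment f x v h 0 h0.
    by move=> t /andP[th t0]; apply: df; rewrite (ltr0_norm h0) ler0_norm // lerN2.
  rewrite sub0r scale0r add0r => E; exists c.
    by rewrite (ltr0_norm h0) ltr0_norm // lerN2 ltW.
  by rewrite -opprB E mulrN opprK.
Qed.

End Lines.

Lemma near_continuous {R : realType} {m : nat} (f : 'rV[R]_m -> R) x (e : R) :
  0 < e -> {for x, continuous f} -> \forall y \near x, `|f x - f y| <= e.
Proof. by move=> e0 /cvgrPdist_le; exact. Qed.

Section Differentiability.
Context {R : realType} {m : nat}.
Implicit Types (f : 'rV[R]_m -> R) (x v : 'rV[R]_m) (D : set 'rV[R]_m).

Let trunc k v : 'rV[R]_m := \row_j (if (j < k)%N then v 0 j else 0).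

Let trunc0 v : trunc 0 v = 0.
Proof. by apply/rowP => j; rewrite !mxE. Qed.

Let truncm v : trunc m v = v.
Proof. by apply/rowP => j; rewrite !mxE ltn_ord. Qed.

Let truncS v (k : 'I_m) :
  trunc k.+1 v = v 0 k *: delta_mx 0 k + trunc k v.
Proof.
apply/rowP => j; rewrite !mxE /= ltnS leq_eqVlt -val_eqE /=.
have [jk|jk] := eqVneq (val j) (val k).
  by rewrite (val_inj jk) /= ltnn mulr1 addr0.
by rewrite /= mulr0 add0r.
Qed.

Let step_norm v (k : 'I_m) (c : R) : `|c| <= `|v 0 k| ->
  `|c *: delta_mx 0 k + trunc k v| <= `|v|.
Proof.
move=> cv; apply: rv_norm_le => // j; rewrite !mxE eqxx /=.
have [->|jk] := eqVneq j k.
  by rewrite ltnn mulr1 addr0 (le_trans cv) // rv_norm_coord.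
rewrite mulr0 add0r; case: ifP => _; first exact: rv_norm_coord.
by rewrite normr0.
Qed.

(** Walking from [x] to [x + v] one coordinate at a time, the mean value theorem
    bounds each increment by a partial derivative at a nearby point. *)
Lemma partial_increment f x (e : R) : 0 < e ->
  (\forall y \near x, forall k, derivable f y (delta_mx 0 k) /\
      `|partial k f y - partial k f x| <= e) ->
  \forall v \near (0 : 'rV[R]_m),
    `|f (v + x) - f x - \sum_k v 0 k * partial k f x| <= m%:R * e * `|v|.
Proof.
move=> e0 /nbhs_ballP[d /= d0 near_x]; apply/nbhs_ballP; exists d => //= v.
rewrite -ball_normE /= sub0r normrN => vd.
have near_x' w : `|w| <= `|v| -> forall k, derivable f (w + x) (delta_mx 0 k) /\
      `|partial k f (w + x) - partial k f x| <= e.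
  move=> wv; apply: near_x; rewrite -ball_normE /= opprD addrCA subrr addr0.
  by rewrite normrN (le_lt_trans wv).
have inc (k : 'I_m) : `|f (trunc k.+1 v + x) - f (trunc k v + x) -
    v 0 k * partial k f x| <= e * `|v|.
  have [|c cv] := @mean_value_line R m f (trunc k v + x) (delta_mx 0 k) (v 0 k).
    move=> t tv; rewrite addrA.
    by case: (near_x' _ (step_norm tv) k).
  rewrite [v 0 k *: _ + _]addrA -truncS => ->; rewrite mulrC -mulrBr normrM.
  rewrite mulrC ler_pM // ?rv_norm_coord // addrA.
  by case: (near_x' _ (step_norm cv) k).
have -> : f (v + x) - f x =
    \sum_(k < m) (f (trunc k.+1 v + x) - f (trunc k v + x)).
  rewrite -(big_mkord xpredT (fun k => f (trunc k.+1 v + x) - f (trunc k v + x))).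
  by rewrite telescope_sumr // truncm trunc0 add0r.
rewrite -sumrB (le_trans (ler_norm_sum _ _ _)) //.
apply: (le_trans (ler_sum _ (fun k _ => inc k))).
by rewrite sumr_const card_ord -mulrA -[leLHS]mulr_natl.
Qed.

Definition differential_of_partials f x (v : 'rV[R]_m) : R :=
  \sum_k v 0 k * partial k f x.

Let differential_is_linear f x : linear (differential_of_partials f x).
Proof.
move=> a u v; rewrite /differential_of_partials scaler_sumr -big_split /=.
by apply: eq_bigr => k _; rewrite !mxE mulrDl -mulrA.
Qed.

HB.instance Definition _ f x := GRing.isLinear.Build R 'rV[R]_m R _
  (differential_of_partials f x) (differential_is_linear f x).

Lemma continuous_differential_of_partials f x :
  continuous (differential_of_partials f x : 'rV[R]_m -> R).
Proof.
move=> v; rewrite /differential_of_partials.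
apply: (@cvg_big _ _ _ _ xpredT (@add_continuous R) _ (nbhs v)) => k _.
by apply: cvgM; [exact: matrix_normedtype.coord_continuous|exact: cvg_cst].
Qed.

Lemma differential_expansion f x :
  (\forall y \near x, forall k, derivable f y (delta_mx 0 k)) ->
  (forall k, {for x, continuous (partial k f)}) ->
  forall e : R, 0 < e -> \forall v \near (0 : 'rV[R]_m),
    `|f (v + x) - (f x + differential_of_partials f x v)| <= e * `|v|.
Proof.
move=> df cf _/posnumP[e].
have e0 : 0 < e%:num / m.+1%:R by rewrite divr_gt0.
have cfk k : \forall y \near x, `|partial k f y - partial k f x| <= e%:num / m.+1%:R.
  have h := near_continuous e0 (cf k).
  by near=> y; rewrite distrC; near: y.
have cf' := @filter_forall _ _ _ (nbhs x) (nbhs_filter x) cfk.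
have dcf : \forall y \near x, forall k, derivable f y (delta_mx 0 k) /\
    `|partial k f y - partial k f x| <= e%:num / m.+1%:R.
  apply: (@filterS2 _ (nbhs x) _ _ _ _ _ df cf') => y h1 h2 k.
  by split; [exact: h1|exact: h2].
apply: filterS (partial_increment e0 dcf) => v; rewrite /= => h.
rewrite opprD addrA (le_trans h) // ler_wpM2r // mulrCA ler_piMr //.
by rewrite ler_pdivrMr // mul1r ler_nat.
Unshelve. all: by end_near. Qed.

(** Smoothness is defined by partial derivatives along the coordinates, whereas
    the chain rule needs a differential: continuous partial derivatives give one. *)
Lemma differentiable_of_partials f x :
  (\forall y \near x, forall k, derivable f y (delta_mx 0 k)) ->
  (forall k, {for x, continuous (partial k f)}) ->
  differentiable f x.
Proof.
move=> df cf.
have E : f \o shift x = cst (f x) + differential_of_partials f x +o_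
    (0 : 'rV[R]_m) id.
  by apply/eqaddoP; exact: differential_expansion.
have dE := @diff_unique R 'rV[R]_m R f (differential_of_partials f x) x
  (@continuous_differential_of_partials f x) E.
apply/diff_locallyP; rewrite dE; split => //.
exact: continuous_differential_of_partials.
Qed.

Lemma derive_sum_partials f x v : differentiable f x ->
  'D_v f x = \sum_k v 0 k * partial k f x.
Proof.
move=> df; rewrite deriveE // {1}(row_sum_delta v) linear_sum.
by apply: eq_bigr => k _; rewrite linearZ /partial deriveE.
Qed.

End Differentiability.

(** * Smooth functions *)

Section Smoothness.
Context {R : realType} {m : nat}.
Implicit Types (f g : 'rV[R]_m -> R) (x v w : 'rV[R]_m) (D : set 'rV[R]_m).
Implicit Types (i j : 'I_m) (k : nat).

Lemma Ck_on_continuous k D f x : Ck_on k D f -> D x -> {for x, continuous f}.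
Proof. by case: k => [|k] [cf _]; exact: cf. Qed.

Lemma Ck_on_derivable k D f x i : Ck_on k.+1 D f -> D x ->
  derivable f x (delta_mx 0 i).
Proof. by move=> [_ /(_ i)[h _]]; exact: h. Qed.

Lemma Ck_on_partial k D f i : Ck_on k.+1 D f -> Ck_on k D (partial i f).
Proof. by move=> [_ /(_ i)[]]. Qed.

Lemma Ck_onW k D f : Ck_on k.+1 D f -> Ck_on k D f.
Proof.
elim: k f => [|k IH] f [cf df]; split=> // i.
by have [di /IH] := df i.
Qed.

Lemma smooth_on_partial D f i : smooth_on D f -> smooth_on D (partial i f).
Proof. by move=> sf k; apply: Ck_on_partial (sf k.+1). Qed.

Lemma eq_near_open D f g x : open D -> D x -> (forall y, D y -> f y = g y) ->
  \forall y \near x, f y = g y.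
Proof.
by move=> oD Dx fg; apply: filterS (open_nbhs_nbhs (conj oD Dx)) => y /fg.
Qed.

Lemma Ck_on_ext k D f g : open D -> (forall y, D y -> f y = g y) ->
  Ck_on k D f -> Ck_on k D g.
Proof.
move=> oD; elim: k f g => [|k IH] f g fg [cf df]; split => //.
- move=> x Dx; have := near_eq_cvg (eq_near_open oD Dx fg).
  by move=> h; apply: cvg_trans; first exact: h; rewrite -fg //; exact: cf.
- move=> x Dx; have := near_eq_cvg (eq_near_open oD Dx fg).
  by move=> h; apply: cvg_trans; first exact: h; rewrite -fg //; exact: cf.
- move=> i; have [di ki] := df i; split.
    move=> x Dx; apply: near_eq_derivable (di _ Dx).
    exact: eq_near_open Dx fg.
  apply: IH ki => y Dy; apply: near_eq_derive.
  exact: eq_near_open Dy fg.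
Qed.

Lemma Ck_on_differentiable k D f x : open D -> Ck_on k.+1 D f -> D x ->
  differentiable f x.
Proof.
move=> oD kf Dx; apply: differentiable_of_partials => [|i].
  apply: filterS (open_nbhs_nbhs (conj oD Dx)) => y Dy i.
  exact: Ck_on_derivable kf Dy.
exact: Ck_on_continuous (Ck_on_partial i kf) Dx.
Qed.

Lemma Ck_on_derivable_dir k D f x v : open D -> Ck_on k.+1 D f -> D x ->
  derivable f x v.
Proof.
by move=> oD kf Dx; apply: diff_derivable; exact: Ck_on_differentiable kf Dx.
Qed.

Lemma Ck_on_cst k D (c : R) : Ck_on k D (fun=> c).
Proof.
elim: k c => [|k IH] c; split=> //; try by move=> x _; exact: cst_continuous.
move=> i; split=> [x _|]; first exact: derivable_cst.
have -> : partial i (fun=> c) = (fun=> 0 : R).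
  by apply/funext => x; rewrite /partial derive_cst.
exact: IH.
Qed.

Lemma Ck_on_add k D f g : open D -> Ck_on k D f -> Ck_on k D g ->
  Ck_on k D (fun x => f x + g x).
Proof.
move=> oD; elim: k f g => [|k IH] f g kf kg;
  (split=> [x Dx|];
   first exact: (cvgD (Ck_on_continuous kf Dx) (Ck_on_continuous kg Dx))) => // i.
split=> [x Dx|].
    by apply: derivableD; [exact: Ck_on_derivable kf Dx|
                           exact: Ck_on_derivable kg Dx].
  apply: (@Ck_on_ext _ _ (fun x => partial i f x + partial i g x)) => //.
    move=> x Dx; rewrite /partial deriveD //.
      exact: Ck_on_derivable kf Dx.
    exact: Ck_on_derivable kg Dx.
  by apply: IH; exact: Ck_on_partial.
Qed.

Lemma Ck_on_mul k D f g : open D -> Ck_on k D f -> Ck_on k D g ->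
  Ck_on k D (fun x => f x * g x).
Proof.
move=> oD; elim: k f g => [|k IH] f g kf kg;
  (split=> [x Dx|];
   first exact: (cvgM (Ck_on_continuous kf Dx) (Ck_on_continuous kg Dx))) => // i.
split=> [x Dx|].
    by apply: derivableM; [exact: Ck_on_derivable kf Dx|
                           exact: Ck_on_derivable kg Dx].
  apply: (@Ck_on_ext _ _ (fun x => f x * partial i g x + g x * partial i f x)) => //.
    move=> x Dx; rewrite /partial deriveM //.
      exact: Ck_on_derivable kf Dx.
    exact: Ck_on_derivable kg Dx.
  by apply: Ck_on_add => //; apply: IH; (exact: Ck_onW || exact: Ck_on_partial).
Qed.

Lemma Ck_on_opp k D f : open D -> Ck_on k D f -> Ck_on k D (fun x => - f x).
Proof.
move=> oD kf; apply: (@Ck_on_ext _ _ (fun x => -1 * f x)) => //.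
  by move=> y _; rewrite mulN1r.
by apply: Ck_on_mul => //; exact: Ck_on_cst.
Qed.

Lemma Ck_on_sum (I : Type) (r : seq I) (P : pred I) k D (F : I -> 'rV[R]_m -> R) :
  open D -> (forall l : I, P l -> Ck_on k D (F l)) ->
  Ck_on k D (fun x => \sum_(l <- r | P l) F l x).
Proof.
move=> oD kF; elim: r => [|l r IH].
  apply: (@Ck_on_ext _ _ (fun=> 0)) (Ck_on_cst _ _ _) => // y _.
  by rewrite big_nil.
apply: (@Ck_on_ext _ _ (fun x => (if P l then F l x else 0) +
    \sum_(l <- r | P l) F l x)) => //.
  by move=> y _; rewrite big_cons; case: (P l); rewrite ?add0r.
apply: Ck_on_add => //; case: (boolP (P l)) => Pl; [exact: kF|exact: Ck_on_cst].
Qed.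

Lemma Ck_on_prod (I : Type) (r : seq I) k D (F : I -> 'rV[R]_m -> R) :
  open D -> (forall l : I, Ck_on k D (F l)) ->
  Ck_on k D (fun x => \prod_(l <- r) F l x).
Proof.
move=> oD kF; elim: r => [|l r IH].
  apply: (@Ck_on_ext _ _ (fun=> 1)) (Ck_on_cst _ _ _) => // y _.
  by rewrite big_nil.
apply: (@Ck_on_ext _ _ (fun x => F l x * \prod_(l <- r) F l x)) => //.
  by move=> y _; rewrite big_cons.
exact: Ck_on_mul.
Qed.

Lemma Ck_on_inv k D f : open D -> (forall x, D x -> f x != 0) ->
  Ck_on k D f -> Ck_on k D (fun x => (f x)^-1).
Proof.
move=> oD f0; elim: k => [|k IH] kf;
  (split=> [x Dx|]; first exact: (cvgV (f0 _ Dx) (Ck_on_continuous kf Dx))) => // i.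
split=> [x Dx|].
    by apply: derivableV; [exact: f0|exact: Ck_on_derivable kf Dx].
  apply: (@Ck_on_ext _ _ (fun x => - ((f x)^-1 * (f x)^-1 * partial i f x))) => //.
    move=> x Dx; rewrite /partial deriveV ?f0 //; last exact: Ck_on_derivable kf Dx.
    by rewrite -[RHS]/(- (f x) ^- 2 * 'D_(delta_mx 0 i) f x) mulNr expr2 invfM.
  apply: Ck_on_opp => //; apply: Ck_on_mul => //; last exact: Ck_on_partial.
  by apply: Ck_on_mul => //; apply: IH; exact: Ck_onW.
Qed.

Lemma smooth_on_derive D f v : open D -> smooth_on D f ->
  smooth_on D (fun y => 'D_v f y).
Proof.
move=> oD sf k.
apply: (@Ck_on_ext _ _ (fun y => \sum_i v 0 i * partial i f y)) => //.
  move=> y Dy; rewrite derive_sum_partials //.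
  exact: Ck_on_differentiable (sf 1) Dy.
apply: Ck_on_sum => // i _; apply: Ck_on_mul => //; first exact: Ck_on_cst.
exact: smooth_on_partial.
Qed.

(** The double increment of [f] on a small square, read in two ways by the mean
    value theorem, approximates both mixed derivatives. *)
Lemma double_increment f x i j (s : R) :
  (forall y, `|y - x| <= 2 * `|s| ->
     derivable f y (delta_mx 0 i) /\ derivable (partial i f) y (delta_mx 0 j)) ->
  exists2 y, `|y - x| <= 2 * `|s| &
    f (s *: delta_mx 0 j + (s *: delta_mx 0 i + x)) - f (s *: delta_mx 0 i + x) -
      (f (s *: delta_mx 0 j + x) - f x) = partial j (partial i f) y * s * s.
Proof.
move=> df; pose e (l : 'I_m) : 'rV[R]_m := delta_mx 0 l.
have ne l (c : R) : `|c *: e l| <= `|c|.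
  rewrite normrZ ler_piMr //; apply: rv_norm_le => // l'.
  by rewrite !mxE; case: (_ && _); rewrite ?normr1 ?normr0.
have close (c d : R) : `|c| <= `|s| -> `|d| <= `|s| ->
    `|d *: e j + (c *: e i + x) - x| <= 2 * `|s|.
  move=> cs ds; rewrite addrA addrK (le_trans (ler_normD _ _)) //.
  rewrite mulr_natl mulr2n lerD //.
    exact: le_trans (ne _ _) ds.
  exact: le_trans (ne _ _) cs.
have close1 (c : R) : `|c| <= `|s| -> `|c *: e i + x - x| <= 2 * `|s|.
  move=> cs; have := close c 0 cs; rewrite scale0r add0r normr0; exact.
(* the increment of [f] in the direction [e j], to be differentiated along [e i] *)
pose h := fun y => f (s *: e j + y) - f y.
have dsh (c : R) : `|c| <= `|s| ->
    is_derive (c *: e i + x) (e i) (fun y => f (s *: e j + y))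
      (partial i f (s *: e j + (c *: e i + x))).
  move=> cs; have [dfi _] := df _ (close c s cs (lexx _)).
  have E : (fun t : R => t^-1 *: (((fun y => f (s *: e j + y)) \o
      shift (c *: e i + x)) (t *: e i) - f (s *: e j + (c *: e i + x)))) =
    (fun t => t^-1 *: ((f \o shift (s *: e j + (c *: e i + x))) (t *: e i) -
      f (s *: e j + (c *: e i + x)))).
    by apply/funext => t /=; rewrite addrCA.
  by apply: DeriveDef; rewrite ?/derivable ?/derive /partial /derive E.
have dh (c : R) : `|c| <= `|s| -> is_derive (c *: e i + x) (e i) h
    (partial i f (s *: e j + (c *: e i + x)) - partial i f (c *: e i + x)).
  move=> cs; apply: is_deriveB; first exact: dsh.
  by have [dfi _] := df _ (close1 c cs); exact: derivableP.
have [|c cs E] := @mean_value_line R m h x (e i) s.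
  by move=> t ts; case: (dh t ts).
have [|d ds E'] := @mean_value_line R m (partial i f) (c *: e i + x) (e j) s.
  by move=> t ts; case: (df _ (close c t cs ts)).
exists (d *: e j + (c *: e i + x)); first exact: close.
have -> : f (s *: e j + (s *: e i + x)) - f (s *: e i + x) -
    (f (s *: e j + x) - f x) = h (s *: e i + x) - h x by [].
rewrite E; congr (_ * _); case: (dh c cs) => _ ->.
by rewrite E'.
Qed.

Let near_continuous2 D f g x (e : R) : 0 < e -> open D -> D x ->
  {for x, continuous f} -> {for x, continuous g} ->
  exists2 d : R, 0 < d & forall y, ball x d y ->
    [/\ D y, `|f x - f y| <= e & `|g x - g y| <= e].
Proof.
move=> e0 oD Dx cf cg.
have h : \forall y \near x, [/\ D y, `|f x - f y| <= e & `|g x - g y| <= e].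
  apply: filterS3 (open_nbhs_nbhs (conj oD Dx)) (near_continuous e0 cf)
    (near_continuous e0 cg) => y; exact: And3.
by have [d /= d0 dP] := (nbhs_ballP _ _).1 h; exists d.
Qed.

(** Schwarz's theorem: both mixed derivatives are approximated by the double
    increment divided by the area of the square. *)
Lemma partialC D f i j x : open D -> Ck_on 2 D f -> D x ->
  partial i (partial j f) x = partial j (partial i f) x.
Proof.
move=> oD kf Dx; apply/eqP; rewrite -subr_eq0 -normr_le0; apply/ler_addgt0Pl.
move=> e e0; rewrite addr0.
have cij (k l : 'I_m) : {for x, continuous (partial k (partial l f))}.
  exact: Ck_on_continuous (Ck_on_partial k (Ck_on_partial l kf)) Dx.
have e2 : 0 < e / 2 by rewrite divr_gt0.
have [d d0 dP] := near_continuous2 e2 oD Dx (cij i j) (cij j i).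
have swap (a b p p' c : R) : p' = p -> p' - b - (a - c) = p - a - (b - c).
  by move=> ->; ring.
have fswap (a b : 'rV[R]_m) : f (a + (b + x)) = f (b + (a + x)) by rewrite addrCA.
have close (a b c : R) : `|a - c| <= e / 2 -> `|b - c| <= e / 2 -> `|a - b| <= e.
  by rewrite !ler_norml => /andP[? ?] /andP[? ?]; apply/andP; split; lra.
(* the points of [double_increment] are within [2 * s], hence inside the ball *)
pose s : R := d / 4.
have s0 : 0 < s by apply: divr_gt0.
have in_ball y : `|y - x| <= 2 * `|s| -> ball x d y.
  rewrite -ball_normE /= distrC => h; apply: le_lt_trans h _.
  by rewrite (gtr0_norm s0) /s; lra.
have d12 (k l : 'I_m) y : `|y - x| <= 2 * `|s| ->
    derivable f y (delta_mx 0 k) /\ derivable (partial k f) y (delta_mx 0 l).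
  move=> /in_ball/dP[Dy _ _]; split; first exact: Ck_on_derivable kf Dy.
  exact: Ck_on_derivable (Ck_on_partial k kf) Dy.
have [y ys Ey] := double_increment (d12 j i).
have [z zs Ez] := double_increment (d12 i j).
have {Ey Ez} E : partial i (partial j f) y = partial j (partial i f) z.
  apply: (@mulIf _ s); first exact: lt0r_neq0.
  apply: (@mulIf _ s); first exact: lt0r_neq0.
  exact: etrans (esym Ey) (etrans (swap _ _ _ _ _ (fswap _ _)) Ez).
have [_ h1 _] := dP _ (in_ball _ ys); have [_ _ h2] := dP _ (in_ball _ zs).
by apply: close h1 _; rewrite E.
Qed.

Lemma deriveC D f x v w : open D -> smooth_on D f -> D x ->
  'D_v (fun y => 'D_w f y) x = 'D_w (fun y => 'D_v f y) x.
Proof.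
move=> oD sf Dx.
have expand (a b : 'rV[R]_m) : 'D_a (fun y => 'D_b f y) x =
    \sum_i \sum_j a 0 i * (b 0 j * partial i (partial j f) x).
  have sb := smooth_on_derive b oD sf.
  rewrite derive_sum_partials; last exact: Ck_on_differentiable (sb 1) Dx.
  apply: eq_bigr => i _; rewrite -mulr_sumr; congr (_ * _).
  rewrite /partial.
  rewrite (@near_eq_derive _ _ _ _ (\sum_j (fun y => b 0 j * partial j f y))).
    rewrite derive_sum => [|j].
      apply: eq_bigr => j _; rewrite deriveMl //.
      exact: Ck_on_derivable (smooth_on_partial j sf 1) Dx.
    apply: derivableM; first exact: derivable_cst.
    exact: Ck_on_derivable (smooth_on_partial j sf 1) Dx.
  apply: eq_near_open Dx _ => // y Dy; rewrite derive_sum_partials ?fct_sumE //.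
  exact: Ck_on_differentiable (sf 1) Dy.
rewrite !expand exchange_big /=; apply: eq_bigr => i _; apply: eq_bigr => j _.
by rewrite (partialC _ _ oD (sf 2) Dx) mulrCA.
Qed.

Lemma derive_at_max D f x v : open D -> smooth_on D f -> D x ->
  (forall y, D y -> f y <= f x) -> 'D_v f x = 0.
Proof.
move=> oD sf Dx fmax.
have line : \forall t \near (0 : R), D (t *: v + x).
  have c : (t *: v + x) @[t --> (0 : R)] --> 0 *: v + x.
    by apply: cvgD; [apply: cvgZr_tmp; exact: cvg_id|exact: cvg_cst].
  by apply: c; rewrite scale0r add0r; exact: open_nbhs_nbhs.
have [d /= d0 dP] := (nbhs_ballP _ _).1 line.
have dD t : t \in `]-d, d[%R -> D (t *: v + x).
  rewrite in_itv /= => /andP[td dt]; apply: dP.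
  by rewrite -ball_normE /= sub0r normrN ltr_norml td dt.
have dt (t : R) : t \in `]-d, d[%R ->
    is_derive t 1 (fun s : R => f (s *: v + x)) ('D_v f (t *: v + x)).
  move=> /dD Dt; apply: is_derive_line.
  exact: Ck_on_derivable_dir (sf 1) Dt.
have d0' : 0 \in `]-d, d[%R by rewrite in_itv /= d0 oppr_lt0 d0.
have H := @derive1_at_max R (fun s => f (s *: v + x)) (-d) d 0.
have [] := H.
- by rewrite ge0_cp // ltW.
- by move=> t /dt[].
- exact: d0'.
- by move=> t /dD Dt; rewrite scale0r add0r; exact: fmax.
move=> _; case: (dt 0 d0') => _ ->; by rewrite scale0r add0r.
Qed.

(** Were the second derivative positive, the mean value theorem would produce a
    larger value nearby on the line, the first derivative being positive there. *)
Lemma derive2_at_max D f x v : open D -> smooth_on D f -> D x ->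
  (forall y, D y -> f y <= f x) -> 'D_v (fun y => 'D_v f y) x <= 0.
Proof.
move=> oD sf Dx fmax; rewrite leNgt; apply/negP => a0.
have f'0 := derive_at_max v oD sf Dx fmax.
have sv := smooth_on_derive v oD sf.
have line : \forall t \near (0 : R), D (t *: v + x).
  have c : (t *: v + x) @[t --> (0 : R)] --> 0 *: v + x.
    by apply: cvgD; [apply: cvgZr_tmp; exact: cvg_id|exact: cvg_cst].
  by apply: c; rewrite scale0r add0r; exact: open_nbhs_nbhs.
have dv : derivable (fun y => 'D_v f y) x v.
  exact: Ck_on_derivable_dir (sv 1) Dx.
have pos : \forall t \near 0^', 0 < t^-1 * 'D_v f (t *: v + x).
  have : t^-1 *: ('D_v f (t *: v + x) - 'D_v f x) @[t --> 0^'] -->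
      'D_v (fun y => 'D_v f y) x by exact: dv.
  move=> /cvgr_gt/(_ _ a0); apply: filterS => t.
  by rewrite f'0 subr0.
have [d1 /= d10 h1] := (nbhs_ballP _ _).1 line.
have [d2 /= d20 h2] := (nbhs_ballP _ _).1 pos.
pose d := Num.min d1 d2 / 2.
have d0 : 0 < d by rewrite divr_gt0 // lt_min d10.
have dd1 : d < d1 /\ d < d2.
  have : Num.min d1 d2 <= d1 /\ Num.min d1 d2 <= d2 by rewrite !ge_min !lexx orbT.
  by rewrite /d; lra.
have [|c /andP[c0 cd]] := @mean_value_segment R m f x v 0 d d0.
  move=> t /andP[t0 td]; apply: Ck_on_derivable_dir (sf 1) _ => //; apply: h1.
  by rewrite -ball_normE /= sub0r normrN ger0_norm //; lra.
rewrite scale0r add0r subr0 => E.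
have cpos : 0 < 'D_v f (c *: v + x).
  have := h2 c; rewrite -ball_normE /= sub0r normrN gtr0_norm //.
  rewrite pmulr_rgt0 ?invr_gt0 //; apply; [lra|exact: lt0r_neq0].
have := fmax (d *: v + x); rewrite -subr_le0 E leNgt mulr_gt0 // => h.
suff : false by []. apply: h; apply: h1.
by rewrite -ball_normE /= sub0r normrN ger0_norm ?ltW //; lra.
Qed.

End Smoothness.

(** * Smooth maps *)

Section SmoothMaps.
Context {R : realType} {m : nat}.
Variables (D : set 'rV[R]_m) (oD : open D).
Implicit Types (f : 'rV[R]_m -> R) (x v w : 'rV[R]_m) (p : nat).

Lemma smooth_on_ext f g : (forall y, D y -> f y = g y) ->
  smooth_on D f -> smooth_on D g.
Proof. by move=> fg sf k; apply: Ck_on_ext (sf k). Qed.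

Lemma smooth_on_derivable f x v : smooth_on D f -> D x -> derivable f x v.
Proof. by move=> sf; exact: Ck_on_derivable_dir (sf 1%N). Qed.

Lemma smooth_on_differentiable f x : smooth_on D f -> D x -> differentiable f x.
Proof. by move=> sf; exact: Ck_on_differentiable (sf 1%N). Qed.

Lemma smooth_on_cst (c : R) : smooth_on D (fun=> c).
Proof. by move=> k; exact: Ck_on_cst. Qed.

Lemma smooth_on_add f g : smooth_on D f -> smooth_on D g ->
  smooth_on D (fun x => f x + g x).
Proof. by move=> sf sg k; exact: Ck_on_add. Qed.

Lemma smooth_on_mul f g : smooth_on D f -> smooth_on D g ->
  smooth_on D (fun x => f x * g x).
Proof. by move=> sf sg k; exact: Ck_on_mul. Qed.

Lemma smooth_on_sum (I : Type) (r : seq I) (P : pred I)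
    (F : I -> 'rV[R]_m -> R) : (forall l, P l -> smooth_on D (F l)) ->
  smooth_on D (fun x => \sum_(l <- r | P l) F l x).
Proof. by move=> sF k; apply: Ck_on_sum => // l /sF; exact. Qed.

Lemma smooth_on_prod (I : Type) (r : seq I)
    (F : I -> 'rV[R]_m -> R) : (forall l, smooth_on D (F l)) ->
  smooth_on D (fun x => \prod_(l <- r) F l x).
Proof. by move=> sF k; apply: Ck_on_prod => // l; exact: sF. Qed.

Lemma smooth_on_inv f : (forall x, D x -> f x != 0) -> smooth_on D f ->
  smooth_on D (fun x => (f x)^-1).
Proof. by move=> f0 sf k; apply: Ck_on_inv. Qed.

Lemma smooth_on_det p (A : 'rV[R]_m -> 'M[R]_p) :
  (forall i j, smooth_on D (fun x => A x i j)) ->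
  smooth_on D (fun x => \det (A x)).
Proof.
move=> sA; apply: smooth_on_sum => s _; apply: smooth_on_mul.
  exact: smooth_on_cst.
exact: smooth_on_prod.
Qed.

(** By Cramer's rule the inverse is polynomial in the entries and the inverse of
    the determinant. *)
Lemma smooth_on_invmx p (A : 'rV[R]_m -> 'M[R]_p) i j :
  (forall i j, smooth_on D (fun x => A x i j)) ->
  (forall x, D x -> A x \in unitmx) ->
  smooth_on D (fun x => invmx (A x) i j).
Proof.
move=> sA uA.
apply: (@smooth_on_ext (fun x => (\det (A x))^-1 * cofactor (A x) j i)).
  by move=> y Dy; rewrite /invmx uA // !mxE.
apply: smooth_on_mul.
  apply: smooth_on_inv; last exact: smooth_on_det.
  by move=> x Dx; rewrite -unitfE -unitmxE uA.
apply: smooth_on_mul; first exact: smooth_on_cst.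
apply: smooth_on_det => k l; apply: smooth_on_ext (sA (lift j k) (lift i l)) => y _.
by rewrite !mxE.
Qed.

Lemma eq_derive_on (V : normedModType R) (f g : 'rV[R]_m -> V) x v : D x ->
  (forall y, D y -> f y = g y) -> 'D_v f x = 'D_v g x.
Proof.
move=> Dx fg; apply: near_eq_derive.
by apply: filterS (open_nbhs_nbhs (conj oD Dx)) => y /fg.
Qed.

Section OneMap.
Variables (p : nat).
Implicit Types (Y Z : 'rV[R]_m -> 'rV[R]_p).

Lemma smooth_map_ext Y Z : (forall y, D y -> Y y = Z y) ->
  smooth_map_on D Y -> smooth_map_on D Z.
Proof.
by move=> YZ sY j; apply: smooth_on_ext (sY j) => y Dy; rewrite YZ.
Qed.

Lemma smooth_map_derivable Y x v : smooth_map_on D Y -> D x -> derivable Y x v.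
Proof.
move=> sY Dx; apply/derivable_mxP => i j; rewrite ord1.
exact: smooth_on_derivable (sY j) Dx.
Qed.

Lemma derive_coord Y x v j : smooth_map_on D Y -> D x ->
  ('D_v Y x) 0 j = 'D_v (fun y => Y y 0 j) x.
Proof.
move=> sY Dx; rewrite derive_mx; last exact: smooth_map_derivable.
by rewrite mxE.
Qed.

Lemma smooth_map_cst (c : 'rV[R]_p) : smooth_map_on D (fun=> c).
Proof. by move=> j; exact: smooth_on_cst. Qed.

Lemma smooth_map_add Y Z : smooth_map_on D Y -> smooth_map_on D Z ->
  smooth_map_on D (fun y => Y y + Z y).
Proof.
move=> sY sZ j; apply: smooth_on_ext (smooth_on_add (sY j) (sZ j)) => y _.
by rewrite mxE.
Qed.

Lemma smooth_map_scale f Y : smooth_on D f -> smooth_map_on D Y ->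
  smooth_map_on D (fun y => f y *: Y y).
Proof.
move=> sf sY j; apply: smooth_on_ext (smooth_on_mul sf (sY j)) => y _.
by rewrite mxE.
Qed.

Lemma smooth_map_opp Y : smooth_map_on D Y -> smooth_map_on D (fun y => - Y y).
Proof.
move=> sY; apply: smooth_map_ext (smooth_map_scale (smooth_on_cst (-1)) sY).
by move=> y _; rewrite scaleN1r.
Qed.

Lemma smooth_map_sum (I : Type) (r : seq I) (F : I -> 'rV[R]_m -> 'rV[R]_p) :
  (forall l, smooth_map_on D (F l)) ->
  smooth_map_on D (fun y => \sum_(l <- r) F l y).
Proof.
move=> sF j.
apply: smooth_on_ext (smooth_on_sum (P := xpredT) r (fun l _ => sF l j)) => y _.
by rewrite summxE.
Qed.

Lemma smooth_map_derive Y v : smooth_map_on D Y ->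
  smooth_map_on D (fun y => 'D_v Y y).
Proof.
move=> sY j; apply: smooth_on_ext (smooth_on_derive v oD (sY j)) => y Dy.
by rewrite derive_coord.
Qed.

Lemma derive_add Y Z x v : smooth_map_on D Y -> smooth_map_on D Z -> D x ->
  'D_v (fun y => Y y + Z y) x = 'D_v Y x + 'D_v Z x.
Proof. by move=> sY sZ Dx; apply: deriveD; exact: smooth_map_derivable. Qed.

Lemma derive_opp Y x v : smooth_map_on D Y -> D x ->
  'D_v (fun y => - Y y) x = - 'D_v Y x.
Proof. by move=> sY Dx; apply: deriveN; exact: smooth_map_derivable. Qed.

Lemma derive_scale f Y x v : smooth_on D f -> smooth_map_on D Y -> D x ->
  'D_v (fun y => f y *: Y y) x = 'D_v f x *: Y x + f x *: 'D_v Y x.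
Proof.
move=> sf sY Dx; apply/rowP => j; rewrite derive_coord //; last first.
  exact: smooth_map_scale.
rewrite (@eq_derive_on _ _ (f * (fun y => Y y 0 j))) //; last first.
  by move=> y _; rewrite mxE.
rewrite deriveM; [|exact: smooth_on_derivable|exact: smooth_on_derivable (sY j) Dx].
rewrite !mxE derive_coord // addrC; congr (_ + _); exact: mulrC.
Qed.

Lemma derive_sum_map (I : Type) (r : seq I) (F : I -> 'rV[R]_m -> 'rV[R]_p) x v :
  (forall l, smooth_map_on D (F l)) -> D x ->
  'D_v (fun y => \sum_(l <- r) F l y) x = \sum_(l <- r) 'D_v (F l) x.
Proof.
move=> sF Dx; elim: r => [|l r IH].
  rewrite big_nil (@eq_derive_on _ _ (fun=> 0)) //; first exact: derive_cst.
  by move=> y _; rewrite big_nil.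
rewrite big_cons -IH -derive_add //; last exact: smooth_map_sum.
by apply: eq_derive_on => // y _; rewrite big_cons.
Qed.

Lemma derive_dir_sum Y x v : smooth_map_on D Y -> D x ->
  'D_v Y x = \sum_k v 0 k *: 'D_(delta_mx 0 k) Y x.
Proof.
move=> sY Dx; apply/rowP => j; rewrite derive_coord // summxE.
rewrite derive_sum_partials; last exact: smooth_on_differentiable (sY j) Dx.
by apply: eq_bigr => k _; rewrite mxE derive_coord.
Qed.

Lemma derive_dir_linear Y x : smooth_map_on D Y -> D x ->
  linear (fun v => 'D_v Y x).
Proof.
move=> sY Dx a v w; rewrite 3!(derive_dir_sum _ sY Dx) scaler_sumr -big_split /=.
by apply: eq_bigr => k _; rewrite !mxE scalerDl scalerA.
Qed.

Lemma deriveC_map Y x v w : smooth_map_on D Y -> D x ->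
  'D_v (fun y => 'D_w Y y) x = 'D_w (fun y => 'D_v Y y) x.
Proof.
move=> sY Dx; apply/rowP => j.
have E (a b : 'rV[R]_m) : ('D_a (fun y => 'D_b Y y) x) 0 j =
    'D_a (fun y => 'D_b (fun z => Y z 0 j) y) x.
  rewrite (derive_coord a j (smooth_map_derive b sY) Dx).
  by apply: eq_derive_on => // y Dy; exact: derive_coord.
exact: etrans (E v w) (etrans (deriveC v w oD (sY j) Dx) (esym (E w v))).
Qed.

Lemma derive_mulmx q (A : 'M[R]_(p, q)) Y x v : smooth_map_on D Y -> D x ->
  'D_v (fun y => Y y *m A) x = 'D_v Y x *m A.
Proof.
move=> sY Dx.
apply/rowP => j; rewrite mxE.
rewrite derive_mx; last first.
  apply/derivable_mxP => i k.
  suff s : smooth_on D (fun y => (Y y *m A) i k) by exact: smooth_on_derivable s Dx.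
  apply: (@smooth_on_ext (fun y => \sum_l Y y 0 l * A l k)).
    by move=> y _; rewrite mxE ord1.
  by apply: smooth_on_sum => l _; apply: smooth_on_mul; [|exact: smooth_on_cst].
rewrite mxE (@eq_derive_on _ _ (\sum_l (fun y => A l j * Y y 0 l))) //.
  rewrite derive_sum => [|l].
    apply: eq_bigr => l _; rewrite deriveMl ?derive_coord 1?mulrC //.
    exact: smooth_on_derivable (sY l) Dx.
  apply: derivableM; first exact: derivable_cst.
  exact: smooth_on_derivable (sY l) Dx.
by move=> y _; rewrite mxE fct_sumE; apply: eq_bigr => l _; rewrite mulrC.
Qed.

End OneMap.

Lemma smooth_map_mulmx p q (A : 'M[R]_(p, q)) (Y : 'rV[R]_m -> 'rV[R]_p) :
  smooth_map_on D Y -> smooth_map_on D (fun y => Y y *m A).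
Proof.
move=> sY j; apply: (@smooth_on_ext (fun y => \sum_l Y y 0 l * A l j)).
  by move=> y _; rewrite mxE.
by apply: smooth_on_sum => l _; apply: smooth_on_mul; [|exact: smooth_on_cst].
Qed.

End SmoothMaps.

(** * Traces, bilinear forms and orthonormal frames *)

Section Traces.
Context {R : comPzRingType} {m : nat}.
Implicit Types (v w : 'rV[R]_m) (L A B : 'rV[R]_m -> 'rV[R]_m).

Definition endo_trace L : R := \sum_k L (delta_mx 0 k) 0 k.

Lemma linear_expand (V : lmodType R) (L : 'rV[R]_m -> V) v : linear L ->
  L v = \sum_k v 0 k *: L (delta_mx 0 k).
Proof.
move=> linL; have L0 : L 0 = 0 by have := linL (-1) 0 0; rewrite !scaleN1r oppr0 addr0 addNr.
have LD u w : L (u + w) = L u + L w by have := linL 1 u w; rewrite !scale1r.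
have LZ a u : L (a *: u) = a *: L u by have := linL a u 0; rewrite L0 !addr0.
rewrite {1}(row_sum_delta v); rewrite (big_morph L LD L0).
by apply: eq_bigr => k _; rewrite LZ.
Qed.

Lemma endo_traceC A B : linear A -> linear B ->
  endo_trace (A \o B) = endo_trace (B \o A).
Proof.
move=> lA lB; rewrite /endo_trace /=.
under eq_bigr do rewrite (linear_expand _ lA) summxE.
rewrite exchange_big /=; apply: eq_bigr => l _.
rewrite [in RHS](linear_expand _ lB) summxE; apply: eq_bigr => k _.
by rewrite !mxE mulrC.
Qed.

Lemma endo_traceD A B : endo_trace (fun v => A v + B v) = endo_trace A + endo_trace B.
Proof. by rewrite /endo_trace -big_split; apply: eq_bigr => k _; rewrite mxE. Qed.

Lemma endo_traceN A : endo_trace (fun v => - A v) = - endo_trace A.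
Proof. by rewrite /endo_trace -sumrN; apply: eq_bigr => k _; rewrite mxE. Qed.

Lemma endo_traceB A B : endo_trace (fun v => A v - B v) = endo_trace A - endo_trace B.
Proof. by rewrite endo_traceD endo_traceN. Qed.

Lemma endo_traceZ c A : endo_trace (fun v => c *: A v) = c * endo_trace A.
Proof. by rewrite /endo_trace mulr_sumr; apply: eq_bigr => k _; rewrite mxE. Qed.

Lemma eq_endo_trace A B : A =1 B -> endo_trace A = endo_trace B.
Proof. by move=> AB; apply: eq_bigr => k _; rewrite AB. Qed.

Lemma bilE (G : 'M[R]_m) v w : bil G v w = \sum_i \sum_j v 0 i * G i j * w 0 j.
Proof.
rewrite /bil mxE exchange_big /=; apply: eq_bigr => j _.
by rewrite !mxE mulr_suml.
Qed.

Lemma bilDl (G : 'M[R]_m) u v w : bil G (u + v) w = bil G u w + bil G v w.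
Proof. by rewrite /bil !mulmxDl mxE. Qed.

Lemma bilDr (G : 'M[R]_m) u v w : bil G w (u + v) = bil G w u + bil G w v.
Proof. by rewrite /bil linearD mulmxDr mxE. Qed.

Lemma bilNl (G : 'M[R]_m) v w : bil G (- v) w = - bil G v w.
Proof. by rewrite /bil !mulNmx mxE. Qed.

Lemma bilNr (G : 'M[R]_m) v w : bil G v (- w) = - bil G v w.
Proof. by rewrite /bil linearN mulmxN mxE. Qed.

Lemma bilBl (G : 'M[R]_m) u v w : bil G (u - v) w = bil G u w - bil G v w.
Proof. by rewrite bilDl bilNl. Qed.

Lemma bilBr (G : 'M[R]_m) u v w : bil G w (u - v) = bil G w u - bil G w v.
Proof. by rewrite bilDr bilNr. Qed.

Lemma bilZl (G : 'M[R]_m) a v w : bil G (a *: v) w = a * bil G v w.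
Proof. by rewrite /bil -!scalemxAl mxE. Qed.

Lemma bilZr (G : 'M[R]_m) a v w : bil G v (a *: w) = a * bil G v w.
Proof. by rewrite /bil linearZ -scalemxAr mxE. Qed.

Lemma bil0l (G : 'M[R]_m) w : bil G 0 w = 0.
Proof. by rewrite /bil !mul0mx mxE. Qed.

Lemma bil_suml (G : 'M[R]_m) (I : Type) (r : seq I) (F : I -> 'rV[R]_m) w :
  bil G (\sum_(l <- r) F l) w = \sum_(l <- r) bil G (F l) w.
Proof. by rewrite /bil !mulmx_suml summxE. Qed.

Lemma bil_delta (G : 'M[R]_m) i j : bil G (delta_mx 0 i) (delta_mx 0 j) = G i j.
Proof. by rewrite /bil -rowE trmx_delta -colE !mxE. Qed.

Lemma trmx_bil_sym (G : 'M[R]_m) : (forall v w, bil G v w = bil G w v) -> G^T = G.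
Proof. by move=> sG; apply/matrixP => i j; rewrite mxE -!bil_delta. Qed.

Lemma bil_mulmx n (A B : 'M[R]_(n, m)) (G : 'M[R]_m) i j :
  bil G (row i A) (row j B) = (A *m G *m B^T) i j.
Proof.
rewrite /bil -row_mul tr_row !mxE; apply: eq_bigr => k _.
by rewrite !mxE.
Qed.

(** The frame consists of the rows of [P]. *)
Definition orthonormal_frame (G P : 'M[R]_m) := P *m G *m P^T = 1%:M.

Variables (G P : 'M[R]_m).
Hypothesis orthoP : orthonormal_frame G P.

Lemma frame_gram : G *m (P^T *m P) = 1%:M.
Proof. by rewrite mulmxA; apply: mulmx1C; rewrite mulmxA. Qed.

(** The trace in the coordinate basis is the metric trace over any orthonormal
    frame; this is how the metric enters the traces below. *)
Lemma frame_trace L : linear L ->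
  \sum_a bil G (L (row a P)) (row a P) = endo_trace L.
Proof.
move=> lL; transitivity (\sum_k \sum_l L (delta_mx 0 k) 0 l * (G *m (P^T *m P)) l k).
  have bE u a : bil G u (row a P) = \sum_l u 0 l * (G *m P^T) l a.
    rewrite /bil -mulmxA mxE; apply: eq_bigr => l _; congr (_ * _).
    by rewrite !mxE; apply: eq_bigr => c _; rewrite !mxE.
  transitivity (\sum_a \sum_k \sum_l
      L (delta_mx 0 k) 0 l * ((G *m P^T) l a * P a k)).
    apply: eq_bigr => a _; rewrite (linear_expand _ lL) bil_suml.
    apply: eq_bigr => k _; rewrite bilZl bE mulr_sumr; apply: eq_bigr => l _.
    by rewrite mxE mulrCA; congr (_ * _); rewrite mulrC.
  rewrite exchange_big /=; apply: eq_bigr => k _.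
  rewrite exchange_big /=; apply: eq_bigr => l _.
  by rewrite -mulr_sumr mulmxA [in RHS]mxE.
rewrite frame_gram; apply: eq_bigr => k _; rewrite (bigD1 k) //= mxE eqxx mulr1.
rewrite big1 ?addr0 // => l lk; rewrite mxE (negPf lk) mulr0 //.
Qed.

End Traces.

Section BilinearSums.
Context {R : comPzRingType} {m : nat}.
Implicit Types (A B P Q : 'M[R]_m).

Lemma frame_bilinear_expand A B (f : 'rV[R]_m -> 'rV[R]_m -> R) :
  (forall w, linear (f^~ w : 'rV[R]_m -> R^o)) ->
  (forall v, linear (f v : 'rV[R]_m -> R^o)) ->
  \sum_a f (row a A) (row a B) =
    \sum_i \sum_j (A^T *m B) i j * f (delta_mx 0 i) (delta_mx 0 j).
Proof.
move=> fl fr.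
under eq_bigr => a _.
  rewrite (linear_expand (row a A) (fl _)).
  under eq_bigr => i _ do rewrite (linear_expand (row a B) (fr _)) scaler_sumr.
  over.
rewrite exchange_big /=; apply: eq_bigr => i _.
rewrite exchange_big /=; apply: eq_bigr => j _.
rewrite mxE mulr_suml; apply: eq_bigr => a _.
by rewrite !mxE -mulrA.
Qed.

(** For [A = P], [B = P *m J] and [Q = P *m J] with [P] orthonormal, this moves the
    complex structure from one argument to the other at the price of a sign. *)
Lemma frame_bilinear_sum A B P Q (f : 'rV[R]_m -> 'rV[R]_m -> R) :
  (forall w, linear (f^~ w : 'rV[R]_m -> R^o)) ->
  (forall v, linear (f v : 'rV[R]_m -> R^o)) -> A^T *m B = - (Q^T *m P) ->
  \sum_a f (row a A) (row a B) = - \sum_a f (row a Q) (row a P).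
Proof.
move=> fl fr E; rewrite !frame_bilinear_expand // E -sumrN.
apply: eq_bigr => i _; rewrite -sumrN.
by apply: eq_bigr => j _; rewrite mxE mulNr.
Qed.

End BilinearSums.

Section Frames.
Context {R : rcfType}.

(** Completing the square in the first coordinate, by induction on the size. *)
Lemma orthonormal_frame_exists m (G : 'M[R]_m) : G^T = G ->
  (forall v, v != 0 -> 0 < bil G v v) -> exists P, orthonormal_frame G P.
Proof.
elim: m G => [|m IH] G sG pG.
  by exists 1%:M; apply/matrixP => -[].
pose G' : 'M[R]_(1 + m) := G.
pose a := G' 0 0; pose r := ursubmx G'; pose S := drsubmx G' - a^-1 *: (r^T *m r).
have GE : G' = block_mx a%:M r r^T (drsubmx G').
  rewrite -[LHS]submxK; congr block_mx.
    by apply/matrixP => i j; rewrite !ord1 !mxE eqxx mulr1n /a; congr (G' _ _); apply: val_inj.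
  by rewrite /r trmx_ursub /G' sG.
have a0 : 0 < a.
  have := pG (delta_mx 0 0); rewrite bil_delta; apply.
  by apply/eqP => /rowP/(_ 0); rewrite !mxE eqxx => /eqP; rewrite oner_eq0.
pose L : 'M[R]_(1 + m) := block_mx 1%:M 0 (- a^-1 *: r^T) 1%:M.
have LG : L *m G' *m L^T = block_mx a%:M 0 0 S.
  rewrite GE /L tr_block_mx !mulmx_block !trmx1 !trmx0 !linearZ /= trmxK.
  rewrite !mul1mx !mul0mx !mulmx1 !mulmx0 !addr0 ?add0r.
  have E1 : - a^-1 *: (a%:M *m r) + r = 0.
    by rewrite mul_scalar_mx scalerA mulNr mulVf ?gt_eqF// scaleN1r addNr.
  have E2 : - a^-1 *: r^T *m a%:M + r^T = 0.
    by rewrite mul_mx_scalar scalerA mulrN divff ?gt_eqF// scaleN1r addNr.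
  rewrite E1 E2 mul0mx scaler0 add0r /S; congr block_mx.
  by rewrite -scalemxAl scaleNr addrC.
have dG' : (drsubmx G')^T = drsubmx G' by rewrite trmx_drsub /G' sG.
have sS : S^T = S.
  by rewrite /S linearB linearZ /= trmx_mul trmxK dG'.
have pS v : v != 0 -> 0 < bil S v v.
  move=> v0; pose w : 'rV[R]_(1 + m) := row_mx 0 v *m L.
  have wE : bil G w w = bil S v v.
    have : w *m G' *m w^T = v *m S *m v^T.
      rewrite /w trmx_mul !mulmxA -[row_mx 0 v *m L *m G']mulmxA.
      rewrite -[_ *m (L *m G') *m L^T]mulmxA LG mul_row_block tr_row_mx mul_row_col.
      rewrite ?trmx0 ?mul0mx ?mulmx0 ?add0r ?addr0 ?mulmx0 ?add0r.
      by [].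
    by rewrite /bil => <-.
  rewrite -wE; apply: pG; apply/eqP => w0; move/eqP: v0; apply.
  have : row_mx 0 v *m L = 0 :> 'rV[R]_(1 + m) by exact: w0.
  rewrite /L mul_row_block !mul0mx mulmx1 add0r => /eqP.
  by rewrite row_mx_eq0 add0r => /andP[_ /eqP].
have [P PE] := IH S sS pS.
pose B : 'M[R]_(1 + m) := block_mx ((Num.sqrt a)^-1)%:M 0 0 P.
(* [L] clears the first row and column, then [B] normalizes both blocks *)
have BE : B *m (L *m G' *m L^T) *m B^T = 1%:M.
  rewrite LG tr_block_mx !mulmx_block ?trmx0 ?mul0mx ?mulmx0 ?mul0mx ?addr0 ?add0r.
  rewrite tr_scalar_mx -!scalar_mxM PE mulrAC -invfM -expr2 sqr_sqrtr ?ltW //.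
  by rewrite mulVf ?gt_eqF // !mul0mx -scalar_mx_block.
by exists (B *m L); rewrite /orthonormal_frame trmx_mul -BE !mulmxA.
Qed.

(** The Cauchy-Schwarz inequality on the diagonal, whose excess is the sum of
    the squares of the deviations from the mean. *)
Lemma sqr_trace_le m (H : 'M[R]_m) :
  (\tr H) ^+ 2 <= m%:R * \sum_i \sum_j H i j ^+ 2.
Proof.
have diag : \sum_i H i i ^+ 2 <= \sum_i \sum_j H i j ^+ 2.
  apply: ler_sum => i _; rewrite (bigD1 i) //= lerDl sumr_ge0 // => j _.
  exact: sqr_ge0.
apply: (@le_trans _ _ (m%:R * \sum_i H i i ^+ 2)); last by rewrite ler_wpM2l.
pose t := \tr H; case: m => [|m] in H diag t *.
  by rewrite /mxtrace big_ord0 mul0r expr2 mulr0.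
have : 0 <= \sum_i (m.+1%:R * H i i - t) ^+ 2 by apply: sumr_ge0 => i _; exact: sqr_ge0.
have -> : \sum_i (m.+1%:R * H i i - t) ^+ 2 =
    m.+1%:R * (m.+1%:R * (\sum_i H i i ^+ 2) - t ^+ 2).
  transitivity (\sum_i (m.+1%:R ^+ 2 * H i i ^+ 2 - (m.+1%:R * t *+ 2) * H i i + t ^+ 2)).
    by apply: eq_bigr => i _; ring.
  rewrite big_split sumrB /= -!mulr_sumr sumr_const card_ord -/(mxtrace H) -/t.
  by rewrite -mulr_natl; ring.
by rewrite pmulr_rge0 ?ltr0n // subr_ge0.
Qed.

End Frames.

(** * Curvature, torsion and the Bochner identity of an affine connection *)

Section Connection.
Context {R : realType} {m : nat}.
Variables (D : set 'rV[R]_m) (oD : open D) (Gamma : @christoffel R m).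
Hypothesis sGamma : forall i j, smooth_map_on D (fun x => Gamma x i j).
Implicit Types (x a b c v w z : 'rV[R]_m) (X Y : 'rV[R]_m -> 'rV[R]_m).

(** [nabla_v w] at [x] for the constant fields [v] and [w]. *)
Definition chris x v w : 'rV[R]_m :=
  \sum_i \sum_j (v 0 i * w 0 j) *: Gamma x i j.

Lemma chris_linearl x w : linear (chris x ^~ w).
Proof.
move=> k u v; rewrite /chris scaler_sumr -big_split /=; apply: eq_bigr => i _.
rewrite scaler_sumr -big_split /=; apply: eq_bigr => j _.
by rewrite !mxE scalerA -scalerDl mulrDl mulrA.
Qed.

Lemma chris_linearr x v : linear (chris x v).
Proof.
move=> k u w; rewrite /chris scaler_sumr -big_split /=; apply: eq_bigr => i _.
rewrite scaler_sumr -big_split /=; apply: eq_bigr => j _.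
by rewrite !mxE scalerA -scalerDl mulrDr mulrCA.
Qed.

Lemma chrisDl x u v w : chris x (u + v) w = chris x u w + chris x v w.
Proof. by have := chris_linearl x w 1 u v; rewrite !scale1r. Qed.

Lemma chrisDr x u v w : chris x w (u + v) = chris x w u + chris x w v.
Proof. by have := chris_linearr x w 1 u v; rewrite !scale1r. Qed.

Lemma chrisZl x k v w : chris x (k *: v) w = k *: chris x v w.
Proof.
rewrite /chris scaler_sumr; apply: eq_bigr => i _.
by rewrite scaler_sumr; apply: eq_bigr => j _; rewrite mxE scalerA mulrA.
Qed.

Lemma chrisZr x k v w : chris x v (k *: w) = k *: chris x v w.
Proof.
rewrite /chris scaler_sumr; apply: eq_bigr => i _.
by rewrite scaler_sumr; apply: eq_bigr => j _; rewrite mxE scalerA mulrCA.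
Qed.

Lemma chrisNr x v w : chris x v (- w) = - chris x v w.
Proof. by rewrite -scaleN1r chrisZr scaleN1r. Qed.

Lemma chris0l x w : chris x 0 w = 0.
Proof. by have := chrisZl x 0 0 w; rewrite !scale0r. Qed.

Lemma chris0r x v : chris x v 0 = 0.
Proof. by have := chrisZr x 0 v 0; rewrite !scale0r. Qed.

Lemma chris_sumr x v (I : Type) (r : seq I) (F : I -> 'rV[R]_m) :
  chris x v (\sum_(l <- r) F l) = \sum_(l <- r) chris x v (F l).
Proof.
by apply: (big_morph (chris x v)) => [u w|]; [exact: chrisDr|exact: chris0r].
Qed.

Lemma smooth_chris X Y : smooth_map_on D X -> smooth_map_on D Y ->
  smooth_map_on D (fun y => chris y (X y) (Y y)).
Proof.
move=> sX sY; apply: (smooth_map_sum oD) => i; apply: (smooth_map_sum oD) => j.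
by apply: smooth_map_scale => //; apply: smooth_on_mul.
Qed.

Lemma smooth_chris_cst v w : smooth_map_on D (fun y => chris y v w).
Proof.
have := @smooth_chris (fun=> v) (fun=> w); apply; exact: smooth_map_cst.
Qed.

Definition dchris z x v w := 'D_z (fun y => chris y v w) x.

Lemma dchris_linearl z x w : D x -> linear (dchris z x ^~ w).
Proof.
move=> Dx k u v; rewrite /dchris.
rewrite (@eq_derive_on _ _ _ oD _ _ (fun y => k *: chris y u w + chris y v w)) //.
  rewrite (derive_add oD) //; last 2 first.
  - by apply: smooth_map_scale (smooth_chris_cst _ _) => //; exact: smooth_on_cst.
  - exact: smooth_chris_cst.
  rewrite (derive_scale oD) //; last 2 first.
  - exact: smooth_on_cst.
  - exact: smooth_chris_cst.
  by rewrite derive_cst scale0r add0r.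
by move=> y _; rewrite chrisDl chrisZl.
Qed.

Lemma dchris_linearr z x v : D x -> linear (dchris z x v).
Proof.
move=> Dx k u w; rewrite /dchris.
rewrite (@eq_derive_on _ _ _ oD _ _ (fun y => k *: chris y v u + chris y v w)) //.
  rewrite (derive_add oD) //; last 2 first.
  - by apply: smooth_map_scale (smooth_chris_cst _ _) => //; exact: smooth_on_cst.
  - exact: smooth_chris_cst.
  rewrite (derive_scale oD) //; last 2 first.
  - exact: smooth_on_cst.
  - exact: smooth_chris_cst.
  by rewrite derive_cst scale0r add0r.
by move=> y _; rewrite chrisDr chrisZr.
Qed.

Lemma dchris_lineard x v w : D x -> linear (fun z => dchris z x v w).
Proof. by move=> Dx; exact: derive_dir_linear (smooth_chris_cst v w) Dx. Qed.

Lemma derive_chris z x v Y : smooth_map_on D Y -> D x ->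
  'D_z (fun y => chris y v (Y y)) x = dchris z x v (Y x) + chris x v ('D_z Y x).
Proof.
move=> sY Dx.
rewrite (@eq_derive_on _ _ _ oD _ _
    (fun y => \sum_j Y y 0 j *: chris y v (delta_mx 0 j))) //; last first.
  by move=> y _; rewrite (linear_expand (Y y) (chris_linearr y v)).
rewrite (derive_sum_map oD) //; last first.
  by move=> j; apply: smooth_map_scale (smooth_chris_cst _ _).
rewrite (linear_expand (Y x) (dchris_linearr z v Dx)).
rewrite (linear_expand ('D_z Y x) (chris_linearr x v)) -big_split /=.
apply: eq_bigr => j _.
rewrite (derive_scale oD _ (sY j) (smooth_chris_cst _ _) Dx) addrC.
by rewrite (derive_coord oD _ _ sY Dx).
Qed.

Lemma covariant_cst X w x : covariant Gamma X (cst w) x = chris x (X x) w.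
Proof. by rewrite /covariant derive_cst add0r. Qed.

Lemma covariant_linear Y x : smooth_map_on D Y -> D x ->
  linear (fun v => covariant Gamma (cst v) Y x).
Proof.
move=> sY Dx k u v; rewrite /covariant (derive_dir_linear oD sY Dx) -!/(chris _ _ _).
by rewrite (chris_linearl x (Y x) k u v) scalerDr addrACA.
Qed.

Lemma smooth_covariant v Y : smooth_map_on D Y ->
  smooth_map_on D (covariant Gamma (cst v) Y).
Proof.
move=> sY; apply: smooth_map_add => //; first exact: smooth_map_derive.
by apply: smooth_chris => //; exact: smooth_map_cst.
Qed.

Lemma covariant_dir_sum X Y x : smooth_map_on D Y -> D x ->
  covariant Gamma X Y x =
  \sum_k X x 0 k *: covariant Gamma (cst (delta_mx 0 k)) Y x.
Proof.
by move=> sY Dx; rewrite -(linear_expand (X x) (covariant_linear sY Dx)).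
Qed.

Lemma smooth_covariant_field X Y : smooth_map_on D X -> smooth_map_on D Y ->
  smooth_map_on D (covariant Gamma X Y).
Proof.
move=> sX sY; apply: (@smooth_map_ext _ _ _ oD _
    (fun y => \sum_k X y 0 k *: covariant Gamma (cst (delta_mx 0 k)) Y y)).
  by move=> y Dy; rewrite -covariant_dir_sum.
apply: smooth_map_sum => // k; apply: smooth_map_scale => //.
exact: smooth_covariant.
Qed.

Lemma covariant_add v Y Z x : smooth_map_on D Y -> smooth_map_on D Z -> D x ->
  covariant Gamma (cst v) (fun y => Y y + Z y) x =
  covariant Gamma (cst v) Y x + covariant Gamma (cst v) Z x.
Proof.
move=> sY sZ Dx; rewrite /covariant (derive_add oD) // -!/(chris _ _ _).
by rewrite chrisDr addrACA.
Qed.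

Lemma covariant_scale v f Y x : smooth_on D f -> smooth_map_on D Y -> D x ->
  covariant Gamma (cst v) (fun y => f y *: Y y) x =
  'D_v f x *: Y x + f x *: covariant Gamma (cst v) Y x.
Proof.
move=> sf sY Dx; rewrite /covariant (derive_scale oD) // -!/(chris _ _ _).
by rewrite chrisZr scalerDr addrA.
Qed.

Lemma eq_covariant_on v Y Z x : D x -> (forall y, D y -> Y y = Z y) ->
  covariant Gamma (cst v) Y x = covariant Gamma (cst v) Z x.
Proof. by move=> Dx YZ; rewrite /covariant (eq_derive_on oD v Dx YZ) YZ. Qed.

Definition curv x a b c := curvature Gamma (cst a) (cst b) (cst c) x.

Lemma covariant_cstE v w : covariant Gamma (cst v) (cst w) = fun y => chris y v w.
Proof. by apply/funext => y; rewrite covariant_cst. Qed.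

Lemma curvE x a b c : curv x a b c =
  dchris a x b c + chris x a (chris x b c) -
  (dchris b x a c + chris x b (chris x a c)).
Proof.
rewrite /curv /curvature !covariant_cstE /covariant -!/(chris _ _ _).
have -> : lie_bracket (cst a) (cst b) x = 0 by rewrite /lie_bracket !derive_cst subrr.
by rewrite derive0 chris0l addr0 subr0.
Qed.

(** The terms that are symmetric in [a] and [b] cancel in the commutator; what is
    left depends on [Y] through its value at [x] only. *)
Lemma covariant2E x a b Y : smooth_map_on D Y -> D x ->
  covariant Gamma (cst a) (covariant Gamma (cst b) Y) x =
  'D_a (fun y => 'D_b Y y) x + (dchris a x b (Y x) + chris x b ('D_a Y x)) +
  (chris x a ('D_b Y x) + chris x a (chris x b (Y x))).
Proof.
move=> sY Dx; rewrite {1}/covariant -!/(chris _ _ _).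
rewrite [covariant Gamma (cst b) Y x]/covariant -!/(chris _ _ _) chrisDr.
congr (_ + _).
rewrite -(derive_chris a b sY Dx) -(derive_add oD _ _ _ Dx) //.
  exact: smooth_map_derive.
by apply: smooth_chris => //; exact: smooth_map_cst.
Qed.

(** The Ricci identity: the curvature of constant fields measures the failure of
    covariant derivatives of any field to commute. *)
Lemma curv_commutator x a b Y : smooth_map_on D Y -> D x ->
  covariant Gamma (cst a) (covariant Gamma (cst b) Y) x -
  covariant Gamma (cst b) (covariant Gamma (cst a) Y) x = curv x a b (Y x).
Proof.
move=> sY Dx; rewrite !covariant2E // (deriveC_map oD a b sY Dx) curvE.
move: ('D_b _ x) (dchris a _ _ _) (dchris b _ _ _) (chris x b ('D_a Y x)) => p q r s.
move: (chris x a ('D_b Y x)) (chris x a _) (chris x b _) => t u v.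
by apply/rowP => j; rewrite !mxE; ring.
Qed.

Lemma curv_antisym x a b c : curv x a b c = - curv x b a c.
Proof. by rewrite !curvE opprB. Qed.

Lemma curv_linear1 x b c : D x -> linear (fun a => curv x a b c).
Proof.
move=> Dx k u v; rewrite !curvE (dchris_lineard b c Dx k u v).
rewrite (dchris_linearl b c Dx k u v) !chrisDl !chrisZl !chrisDr !chrisZr.
move: (dchris _ _ _ _) (dchris _ _ _ _) (dchris _ _ _ _) (dchris _ _ _ _) => p q r s.
move: (chris _ _ _) (chris _ _ _) (chris _ _ _) (chris _ _ _) => p' q' r' s'.
by apply/rowP => j; rewrite !mxE; ring.
Qed.

Lemma curv_linear2 x a c : D x -> linear (fun b => curv x a b c).
Proof.
move=> Dx k u v; rewrite 3!(curv_antisym x a) (curv_linear1 a c Dx k u v).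
by rewrite opprD scalerN.
Qed.

Lemma curv_linear3 x a b : D x -> linear (curv x a b).
Proof.
move=> Dx k u v; rewrite !curvE (dchris_linearr a b Dx k u v).
rewrite (dchris_linearr b a Dx k u v) !chrisDr !chrisZr.
move: (dchris _ _ _ _) (dchris _ _ _ _) (dchris _ _ _ _) (dchris _ _ _ _) => p q r s.
move: (chris _ _ _) (chris _ _ _) (chris _ _ _) (chris _ _ _) => p' q' r' s'.
by apply/rowP => j; rewrite !mxE; ring.
Qed.

Definition torsion x v w := chris x v w - chris x w v.

Lemma torsionE x v w : torsion x v w = chris x v w - chris x w v.
Proof. by []. Qed.

Lemma torsion_antisym x v w : torsion x v w = - torsion x w v.
Proof. by rewrite /torsion opprB. Qed.

Lemma torsion_linearl x w : linear (torsion x ^~ w).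
Proof.
move=> k u v; rewrite /torsion chrisDl chrisZl chrisDr chrisZr.
by rewrite opprD scalerBr addrACA.
Qed.

Lemma torsion_linearr x v : linear (torsion x v).
Proof.
move=> k u w; rewrite 3!(torsion_antisym x v) (torsion_linearl x v k u w).
by rewrite opprD scalerN.
Qed.

Lemma smooth_torsion v w : smooth_map_on D (fun y => torsion y v w).
Proof.
apply: smooth_map_add => //; first exact: smooth_chris_cst.
by apply: smooth_map_opp => //; exact: smooth_chris_cst.
Qed.

Lemma covariant_torsion x a b c : D x ->
  covariant Gamma (cst a) (fun y => torsion y b c) x =
  dchris a x b c - dchris a x c b + (chris x a (chris x b c) - chris x a (chris x c b)).
Proof.
move=> Dx; rewrite /covariant -!/(chris _ _ _) /torsion chrisDr chrisNr.
rewrite (derive_add oD) ?(derive_opp oD) //.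
- exact: smooth_chris_cst.
- exact: smooth_chris_cst.
- by apply: smooth_map_opp => //; exact: smooth_chris_cst.
Qed.

(** Both sides are the same cyclic sum of derivatives and products of Christoffel
    symbols, the torsion being differentiated as a field with constant
    arguments. *)
Lemma bianchi x a b c : D x ->
  curv x a b c + curv x b c a + curv x c a b =
  covariant Gamma (cst a) (fun y => torsion y b c) x +
  covariant Gamma (cst b) (fun y => torsion y c a) x +
  covariant Gamma (cst c) (fun y => torsion y a b) x.
Proof.
move=> Dx; rewrite !covariant_torsion // !curvE.
move: (dchris _ _ _ _) (dchris _ _ _ _) (dchris _ _ _ _) => p q r.
move: (dchris _ _ _ _) (dchris _ _ _ _) (dchris _ _ _ _) => p' q' r'.
move: (chris _ _ _) (chris _ _ _) (chris _ _ _) => s t u.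
move: (chris _ _ _) (chris _ _ _) (chris _ _ _) => s' t' u'.
by apply/rowP => j; rewrite !mxE; ring.
Qed.

Definition divergence Y x := endo_trace (fun v => covariant Gamma (cst v) Y x).

Definition ricci x v w := endo_trace (fun z => curv x z v w).

(** The Bochner identity for a connection with torsion: commuting the two
    derivatives of [X] produces the Ricci term, and what is left is a trace of
    products of first derivatives. *)
Lemma divergence_covariant_self X x : smooth_map_on D X -> D x ->
  divergence (covariant Gamma X X) x =
  'D_(X x) (divergence X) x + ricci x (X x) (X x) +
  endo_trace (fun v => covariant Gamma
    (cst (covariant Gamma (cst v) X x - torsion x v (X x))) X x).
Proof.
move=> sX Dx.
pose N (v : 'rV[R]_m) := covariant Gamma (cst v) X x.
have lN : linear N by exact: covariant_linear.
have sN v : smooth_map_on D (covariant Gamma (cst v) X) by exact: smooth_covariant.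
have E v : covariant Gamma (cst v) (covariant Gamma X X) x =
    N ('D_v X x) + covariant Gamma X (covariant Gamma (cst v) X) x + curv x v (X x) (X x).
  rewrite (@eq_covariant_on _ _
    (fun y => \sum_k X y 0 k *: covariant Gamma (cst (delta_mx 0 k)) X y)) //; last first.
    by move=> y Dy; rewrite covariant_dir_sum.
  have -> : covariant Gamma (cst v)
      (fun y => \sum_k X y 0 k *: covariant Gamma (cst (delta_mx 0 k)) X y) x =
      \sum_k ('D_v X x 0 k *: N (delta_mx 0 k) +
        X x 0 k *: covariant Gamma (cst v) (covariant Gamma (cst (delta_mx 0 k)) X) x).
    transitivity (\sum_k covariant Gamma (cst v)
        (fun y => X y 0 k *: covariant Gamma (cst (delta_mx 0 k)) X y) x).
      rewrite /covariant (derive_sum_map oD) //; last first.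
        by move=> k; apply: smooth_map_scale; [exact: oD|exact: (sX k)|exact: sN].
      rewrite -/(chris _ _ _) big_split /=; congr (_ + _).
      exact: chris_sumr.
    apply: eq_bigr => k _; rewrite (covariant_scale v (sX k) (sN _) Dx).
    by rewrite (derive_coord oD _ _ sX Dx).
  rewrite big_split /= -(linear_expand _ lN) -[RHS]addrA.
  move: (N ('D_v X x)) => q; congr (q + _).
  rewrite (linear_expand (X x) (curv_linear2 v (X x) Dx)).
  rewrite (covariant_dir_sum X (sN v) Dx) -big_split /=; apply: eq_bigr => k _.
  by rewrite -scalerDr; congr (_ *: _); rewrite -curv_commutator // addrC subrK.
have lN' u w : N (u - w) = N u - N w.
  by rewrite addrC -scaleN1r lN scaleN1r addrC.
(* ordinary derivatives are corrected into covariant ones *)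
have NE v : 'D_v X x = N v - chris x v (X x) by rewrite /N /covariant addrK.
have dN (v w : 'rV[R]_m) : 'D_w (covariant Gamma (cst v) X) x =
    covariant Gamma (cst w) (covariant Gamma (cst v) X) x - chris x w (N v).
  by rewrite [in RHS]/covariant addrK.
have -> : 'D_(X x) (divergence X) x =
    endo_trace (fun v => covariant Gamma X (covariant Gamma (cst v) X) x -
      chris x (X x) (N v)).
  rewrite /divergence /endo_trace.
  rewrite (_ : (fun y => _) =
    \sum_k (fun y => covariant Gamma (cst (delta_mx 0 k)) X y 0 k)); last first.
    by apply/funext => y; rewrite fct_sumE.
  rewrite derive_sum => [|k]; last exact: (smooth_on_derivable oD (sN (delta_mx 0 k) k) Dx).
  apply: eq_bigr => k _.
  by rewrite -(derive_coord oD _ _ (sN _) Dx) dN.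
have -> : divergence (covariant Gamma X X) x =
    endo_trace (fun v => N ('D_v X x)) +
    endo_trace (fun v => covariant Gamma X (covariant Gamma (cst v) X) x) +
    ricci x (X x) (X x).
  rewrite /divergence (eq_endo_trace E) /ricci.
  rewrite (endo_traceD (fun v => N ('D_v X x) + _) (fun v => curv x v (X x) (X x))).
  by rewrite (endo_traceD (fun v => N ('D_v X x))).
rewrite (endo_traceB (fun v => covariant Gamma X (covariant Gamma (cst v) X) x)).
have -> : endo_trace (fun v => covariant Gamma
    (cst (covariant Gamma (cst v) X x - torsion x v (X x))) X x) =
    endo_trace (fun v => N ('D_v X x)) + endo_trace (fun v => chris x (X x) (N v)).
  rewrite (@endo_traceC _ _ (chris x (X x)) N (chris_linearr x (X x)) lN).
  rewrite -(endo_traceD (fun v => N ('D_v X x))); apply: eq_endo_trace => v /=.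
  rewrite -/(N _) NE /torsion !lN'.
  by move: (N (N v)) (N _) (N _) => p q r; rewrite opprB addrA addrAC.
move: (endo_trace _) (endo_trace _) (endo_trace _) (ricci _ _ _) => p q r t.
ring.
Qed.

End Connection.

(** * Pair exchange for metric connections with skew torsion *)

Section CovariantTorsion.
Context {R : realType} {m : nat}.
Variables (D : set 'rV[R]_m) (oD : open D) (Gamma : @christoffel R m).
Hypothesis sGamma : forall i j, smooth_map_on D (fun x => Gamma x i j).
Implicit Types (x a b c v w z : 'rV[R]_m) (X Y : 'rV[R]_m -> 'rV[R]_m).

Local Notation chris := (chris Gamma).
Local Notation torsion := (torsion Gamma).
Local Notation curv := (curv Gamma).

Definition dtorsion x z b c :=
  covariant Gamma (cst z) (fun y => torsion y b c) x
  - torsion x (chris x z b) c - torsion x b (chris x z c).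

Lemma dtorsionE x z b c : dtorsion x z b c =
  covariant Gamma (cst z) (fun y => torsion y b c) x
  - torsion x (chris x z b) c - torsion x b (chris x z c).
Proof. by []. Qed.

Lemma dtorsion_antisym x z b c : D x -> dtorsion x z b c = - dtorsion x z c b.
Proof.
move=> Dx; rewrite /dtorsion (torsion_antisym Gamma x (chris x z b) c).
rewrite (torsion_antisym Gamma x b (chris x z c)).
rewrite !(covariant_torsion oD sGamma) //.
move: (dchris _ _ _ _ _) (dchris _ _ _ _ _) (chris _ _ _) (chris _ _ _) => p q r s.
move: (torsion _ _ _) (torsion _ _ _) => t u.
by apply/rowP => j; rewrite !mxE; ring.
Qed.

Lemma dtorsion_lineard x b c : D x -> linear (fun z => dtorsion x z b c).
Proof.
move=> Dx k u v; rewrite /dtorsion.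
rewrite (covariant_linear oD Gamma (smooth_torsion oD sGamma b c) Dx k u v).
rewrite (chris_linearl Gamma x b k u v) (chris_linearl Gamma x c k u v).
rewrite (torsion_linearl Gamma x c k) (torsion_linearr Gamma x b k).
move: (covariant _ _ _ _) (covariant _ _ _ _) (torsion _ _ _) (torsion _ _ _) => p q r s.
move: (torsion _ _ _) (torsion _ _ _) => t t'.
by apply/rowP => j; rewrite !mxE; ring.
Qed.

Lemma dtorsion_linearr x z b : D x -> linear (dtorsion x z b).
Proof.
move=> Dx k u v; rewrite /dtorsion.
rewrite !(covariant_torsion oD sGamma) //.
rewrite (chris_linearr Gamma x z k u v) (torsion_linearr Gamma x _ k u v).
rewrite (torsion_linearr Gamma x b k).
rewrite (dchris_linearr oD sGamma z b Dx k u v) (dchris_linearl oD sGamma z b Dx k u v).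
rewrite (chris_linearr Gamma x b k u v) (chris_linearl Gamma x b k u v).
rewrite !(chris_linearr Gamma x z k).
move: (dchris _ _ _ _ _) (dchris _ _ _ _ _) (dchris _ _ _ _ _) (dchris _ _ _ _ _) => p q r s.
move: (chris _ _ _) (chris _ _ _) (chris _ _ _) (chris _ _ _) => p' q' r' s'.
move: (torsion _ _ _) (torsion _ _ _) (torsion _ _ _) (torsion _ _ _) => t t' t'' u'.
by apply/rowP => j; rewrite !mxE; ring.
Qed.

(** Passing to the covariant derivative of the torsion tensor produces the
    quadratic terms: the corrections combine into torsions of torsions. *)
Lemma bianchi_dtorsion x a b c : D x ->
  curv x a b c + curv x b c a + curv x c a b =
  dtorsion x a b c + dtorsion x b c a + dtorsion x c a b +
  (torsion x (torsion x a b) c + torsion x (torsion x b c) a +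
   torsion x (torsion x c a) b).
Proof.
move=> Dx; rewrite (bianchi oD sGamma) // /dtorsion.
move: (covariant _ _ _ _) (covariant _ _ _ _) (covariant _ _ _ _) => p q r.
have TE u v w : torsion x (torsion x u v) w =
    torsion x (chris x u v) w - torsion x (chris x v u) w.
  rewrite [torsion x u v]addrC -scaleN1r (torsion_linearl Gamma x w).
  by rewrite scaleN1r addrC.
rewrite !TE.
rewrite (torsion_antisym Gamma x b (chris x a c)).
rewrite (torsion_antisym Gamma x c (chris x b a)).
rewrite (torsion_antisym Gamma x a (chris x c b)).
move: (torsion _ _ _) (torsion _ _ _) (torsion _ _ _) => s t u.
move: (torsion _ _ _) (torsion _ _ _) (torsion _ _ _) => s' t' u'.
by apply/rowP => j; rewrite !mxE; ring.
Qed.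

End CovariantTorsion.

(** The arithmetic of the pair exchange: [r] has the symmetries of a curvature
    tensor, [e] those of a derivative of a 3-form, [k] those of an inner product
    of bivectors. *)
Lemma pair_exchange_arith (F : realFieldType) (V : Type) (r e k : V -> V -> V -> V -> F) :
  (forall p q s t, r p q s t + r q s p t + r s p q t =
    e p q s t + e q s p t + e s p q t + (k p q s t + k q s p t + k s p q t)) ->
  (forall p q s t, r p q s t = - r q p s t) ->
  (forall p q s t, r p q s t = - r p q t s) ->
  (forall p q s t, e p q s t = - e p s q t) ->
  (forall p q s t, e p q s t = - e p q t s) ->
  (forall p q s t, k p q s t = - k q p s t) ->
  (forall p q s t, k p q s t = k s t p q) ->
  forall a b c d, 2 * (r a b c d - r c d a b) =
    e a b c d + e d b c a - e b a c d - e c a b d.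
Proof.
move=> B r1 r2 e1 e2 k1 k2 a b c d.
(* the octahedron argument: the four Bianchi identities on (a, b, c, d) are
   brought to common representatives, after which the claim is linear *)
have := B a b c d; have := B b c d a; have := B c d a b; have := B d a b c.
rewrite (r2 b c d a) (r2 c d b a) (r1 a c d b) (r2 c a d b) (r2 d a b c).
rewrite (r2 a b d c) (r1 b d a c) (r2 d b a c).
rewrite (e2 a c d b) (e1 a c b d) (e2 a b d c).
rewrite (e2 b c d a) (e1 b c a d) (e1 b d a c) (e2 b a d c).
rewrite (e1 c d b a) (e2 c b d a) (e1 c b a d) (e1 c d a b) (e2 c a d b).
rewrite (e1 d a c b) (e2 d c a b) (e1 d c b a) (e1 d a b c) (e2 d b a c).
rewrite (k2 d a b c) (k2 b c d a) (k1 d a b c) (k2 a d b c).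
have k3 p q s t : k p q s t = - k p q t s by rewrite k2 k1 k2.
rewrite (k2 c d a b) (k2 c d b a) (k1 b a c d) (k3 a b d c).
rewrite (k1 d b c a) (k2 b d c a) (k1 a c d b) (k2 c a d b) (k1 d b c a) (k2 b d c a).
rewrite (k2 b d a c) (k1 a c b d) (k2 d a c b) (k1 c b d a) (k3 b c d a).
lra.
Qed.

Section Metric.
Context {R : realType} {m : nat}.
Variables (D : set 'rV[R]_m) (oD : open D) (Gamma : @christoffel R m).
Hypothesis sGamma : forall i j, smooth_map_on D (fun x => Gamma x i j).
Variable G : 'rV[R]_m -> 'M[R]_m.
Hypothesis sG : forall i j, smooth_on D (fun x => G x i j).
Hypothesis G_sym : forall x, D x -> forall v w, bil (G x) v w = bil (G x) w v.
Hypothesis G_compat : forall X Y Z, smooth_map_on D X -> smooth_map_on D Y ->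
  smooth_map_on D Z -> forall x, D x ->
  'D_(X x) (fun y => bil (G y) (Y y) (Z y)) x =
  bil (G x) (covariant Gamma X Y x) (Z x) + bil (G x) (Y x) (covariant Gamma X Z x).
Hypothesis T_skew : forall x, D x -> forall v w z,
  bil (G x) (torsion Gamma x v w) z = - bil (G x) (torsion Gamma x v z) w.
Implicit Types (x a b c d v w z : 'rV[R]_m) (X Y Z : 'rV[R]_m -> 'rV[R]_m).

Local Notation chris := (chris Gamma).
Local Notation torsion := (torsion Gamma).
Local Notation curv := (curv Gamma).
Local Notation dtorsion := (dtorsion Gamma).

Lemma derive_bil v Y Z x : smooth_map_on D Y -> smooth_map_on D Z -> D x ->
  'D_v (fun y => bil (G y) (Y y) (Z y)) x =
  bil (G x) (covariant Gamma (cst v) Y x) (Z x) +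
  bil (G x) (Y x) (covariant Gamma (cst v) Z x).
Proof.
by move=> sY sZ Dx; apply: (@G_compat (cst v)) => //; exact: smooth_map_cst.
Qed.

Lemma smooth_bil Y Z : smooth_map_on D Y -> smooth_map_on D Z ->
  smooth_on D (fun y => bil (G y) (Y y) (Z y)).
Proof.
move=> sY sZ.
apply: (@smooth_on_ext _ _ _ oD
   (fun y => \sum_i \sum_j Y y 0 i * G y i j * Z y 0 j)).
  by move=> y _; rewrite bilE.
apply: (smooth_on_sum oD) => i _; apply: (smooth_on_sum oD) => j _.
by apply: (smooth_on_mul oD) => //; apply: (smooth_on_mul oD).
Qed.

Lemma derive2_bil a b v w x : D x ->
  'D_a (fun y => 'D_b (fun z => bil (G z) v w) y) x =
  bil (G x) (covariant Gamma (cst a) (covariant Gamma (cst b) (cst v)) x) w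
  + bil (G x) (chris x b v) (chris x a w) + bil (G x) (chris x a v) (chris x b w)
  + bil (G x) v (covariant Gamma (cst a) (covariant Gamma (cst b) (cst w)) x).
Proof.
move=> Dx.
have sc u : smooth_map_on D (cst u : 'rV[R]_m -> 'rV[R]_m) by exact: smooth_map_cst.
have sb u := smooth_covariant oD sGamma b (sc u).
rewrite (@eq_derive_on _ _ _ oD _ _ ((fun y => bil (G y)
     (covariant Gamma (cst b) (cst v) y) (cst w y)) +
    (fun y => bil (G y) (cst v y) (covariant Gamma (cst b) (cst w) y)))) //; last first.
  by move=> y Dy; exact: (derive_bil b (sc v) (sc w) Dy).
rewrite deriveD; last 2 first.
- exact: (smooth_on_derivable oD (smooth_bil (sb v) (sc w)) Dx).
- exact: (smooth_on_derivable oD (smooth_bil (sc v) (sb w)) Dx).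
rewrite (derive_bil a (sb v) (sc w) Dx) (derive_bil a (sc v) (sb w) Dx).
by rewrite !(covariant_cst _ _ _ x) !addrA.
Qed.

(** Metric compatibility makes the curvature operators skew, because the second
    derivatives of the metric coefficients commute. *)
Lemma curv_skew x a b c d : D x ->
  bil (G x) (curv x a b c) d = - bil (G x) (curv x a b d) c.
Proof.
move=> Dx.
have sc u : smooth_map_on D (cst u : 'rV[R]_m -> 'rV[R]_m) by exact: smooth_map_cst.
have scd : smooth_on D (fun y => bil (G y) c d) by exact: (smooth_bil (sc c) (sc d)).
have := deriveC a b oD scd Dx; rewrite !derive2_bil //.
rewrite -!(curv_commutator oD sGamma a b (sc _) Dx) !bilBl.
rewrite !(G_sym Dx c); move: (bil _ _ d) (bil _ _ d) (bil _ _ c) (bil _ _ c).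
by move=> p q r s; rewrite !(G_sym Dx (chris x b c)) => h; lra.
Qed.

(** Parallel metric: the covariant derivative of a skew tensor is skew. *)
Lemma dtorsion_skew x z b c d : D x ->
  bil (G x) (dtorsion x z b c) d = - bil (G x) (dtorsion x z b d) c.
Proof.
move=> Dx.
have sc u : smooth_map_on D (cst u : 'rV[R]_m -> 'rV[R]_m) by exact: smooth_map_cst.
have sT := smooth_torsion oD sGamma.
have E u w : bil (G x) (covariant Gamma (cst z) (fun y => torsion y b u) x) w =
    'D_z (fun y => bil (G y) (torsion y b u) w) x - bil (G x) (torsion x b u) (chris x z w).
  by rewrite (derive_bil z (sT b u) (sc w) Dx) covariant_cst addrK.
have N : 'D_z (fun y => bil (G y) (torsion y b c) d) x =
    - 'D_z (fun y => bil (G y) (torsion y b d) c) x.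
  rewrite -deriveN.
    by apply: (@eq_derive_on _ _ _ oD) => // y Dy; rewrite (T_skew Dy).
  exact: (smooth_on_derivable oD (smooth_bil (sT b d) (sc c)) Dx).
have DE u w : bil (G x) (dtorsion x z b u) w =
    bil (G x) (covariant Gamma (cst z) (fun y => torsion y b u) x) w
    - bil (G x) (torsion x (chris x z b) u) w - bil (G x) (torsion x b (chris x z u)) w.
  by rewrite dtorsionE 2!bilBl.
rewrite !DE !E N (T_skew Dx _ c d).
rewrite (T_skew Dx b c (chris x z d)) (T_skew Dx b d (chris x z c)).
lra.
Qed.

(** The pair symmetry of the Riemann tensor fails by derivatives of the torsion
    only: the quadratic torsion terms of the four instances of the Bianchi
    identity form a 4-form and cancel. *)
Lemma curv_pair_exchange x a b c d : D x ->
  2 * (bil (G x) (curv x a b c) d - bil (G x) (curv x c d a) b) =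
  bil (G x) (dtorsion x a b c) d + bil (G x) (dtorsion x d b c) a
  - bil (G x) (dtorsion x b a c) d - bil (G x) (dtorsion x c a b) d.
Proof.
move=> Dx.
pose r p q s t := bil (G x) (curv x p q s) t.
pose e p q s t := bil (G x) (dtorsion x p q s) t.
pose k p q s t := bil (G x) (torsion x p q) (torsion x s t).
have B p q s t : r p q s t + r q s p t + r s p q t =
    e p q s t + e q s p t + e s p q t + (k p q s t + k q s p t + k s p q t).
  have K u v w : bil (G x) (torsion x u v) w = bil (G x) (torsion x v w) u.
    by rewrite (torsion_antisym _ _ u v) bilNl (T_skew Dx v u w) opprK.
  have D3 u v w z : bil (G x) (u + v + w) z =
      bil (G x) u z + bil (G x) v z + bil (G x) w z by rewrite !bilDl.
  have K' u v w z : bil (G x) (torsion x (torsion x u v) w) z = k u v w z.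
    by rewrite (K (torsion x u v)) (G_sym Dx).
  rewrite -[LHS]D3 (bianchi_dtorsion oD sGamma) // bilDl.
  by rewrite (D3 (dtorsion x p q s)) (D3 (torsion x (torsion x p q) s)) 3!K'.
have r1 p q s t : r p q s t = - r q p s t by rewrite /r curv_antisym bilNl.
have r2 p q s t : r p q s t = - r p q t s by exact: curv_skew.
have e1 p q s t : e p q s t = - e p s q t by rewrite /e (dtorsion_antisym oD sGamma) // bilNl.
have e2 p q s t : e p q s t = - e p q t s by exact: dtorsion_skew.
have k1 p q s t : k p q s t = - k q p s t by rewrite /k torsion_antisym bilNl.
have k2 p q s t : k p q s t = k s t p q by exact: G_sym.
exact: (pair_exchange_arith B r1 r2 e1 e2 k1 k2).
Qed.

End Metric.

(** * Invariance of the Ricci form under the complex structure *)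

Section BalancedRicci.
Context {R : realType} {m : nat}.
Variables (D : set 'rV[R]_m) (oD : open D) (Gamma : @christoffel R m).
Hypothesis sGamma : forall i j, smooth_map_on D (fun x => Gamma x i j).
Variable G : 'rV[R]_m -> 'M[R]_m.
Hypothesis sG : forall i j, smooth_on D (fun x => G x i j).
Hypothesis G_sym : forall x, D x -> forall v w, bil (G x) v w = bil (G x) w v.
Hypothesis G_pos : forall x, D x -> forall v, v != 0 -> 0 < bil (G x) v v.
Hypothesis G_compat : forall X Y Z, smooth_map_on D X -> smooth_map_on D Y ->
  smooth_map_on D Z -> forall x, D x ->
  'D_(X x) (fun y => bil (G y) (Y y) (Z y)) x =
  bil (G x) (covariant Gamma X Y x) (Z x) + bil (G x) (Y x) (covariant Gamma X Z x).
Hypothesis T_skew : forall x, D x -> forall v w z,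
  bil (G x) (torsion Gamma x v w) z = - bil (G x) (torsion Gamma x v z) w.
Variable J : 'M[R]_m.
Hypothesis JJ : J *m J = - 1%:M.
Hypothesis G_J : forall x, D x -> forall v w,
  bil (G x) (v *m J) (w *m J) = bil (G x) v w.
Hypothesis J_parallel : forall X Y, smooth_map_on D X -> smooth_map_on D Y ->
  forall x, D x ->
  covariant Gamma X (fun y => Y y *m J) x = covariant Gamma X Y x *m J.
Hypothesis T_balanced : forall x, D x -> forall b,
  endo_trace (fun v => torsion Gamma x v b *m J) = 0.
Implicit Types (x a b c d v w z : 'rV[R]_m) (X Y Z : 'rV[R]_m -> 'rV[R]_m).

Local Notation chris := (chris Gamma).
Local Notation torsion := (torsion Gamma).
Local Notation curv := (curv Gamma).
Local Notation dtorsion := (dtorsion Gamma).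

Lemma mulJJ v : v *m J *m J = - v.
Proof. by rewrite -mulmxA JJ mulmxN mulmx1. Qed.

Lemma bil_J x v w : D x -> bil (G x) v (w *m J) = - bil (G x) (v *m J) w.
Proof. by move=> Dx; rewrite -(G_J Dx v) mulJJ bilNr. Qed.

Lemma covariant_J v Y x : smooth_map_on D Y -> D x ->
  covariant Gamma (cst v) (fun y => Y y *m J) x = covariant Gamma (cst v) Y x *m J.
Proof.
by move=> sY Dx; apply: J_parallel => //; exact: smooth_map_cst.
Qed.

Lemma chris_J x v w : D x -> chris x v (w *m J) = chris x v w *m J.
Proof.
move=> Dx; have := covariant_J v (smooth_map_cst D w) Dx.
by rewrite !(covariant_cst _ _ _ x).
Qed.

Lemma curv_J x a b c : D x -> curv x a b (c *m J) = curv x a b c *m J.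
Proof.
move=> Dx.
have sc u : smooth_map_on D (cst u : 'rV[R]_m -> 'rV[R]_m) by exact: smooth_map_cst.
have E u v : covariant Gamma (cst u) (covariant Gamma (cst v) (cst (c *m J))) x =
    covariant Gamma (cst u) (covariant Gamma (cst v) (cst c)) x *m J.
  rewrite -(covariant_J u (smooth_covariant oD sGamma v (sc c)) Dx).
  apply: (eq_covariant_on oD) => // y Dy.
  by rewrite -(covariant_J v (sc c) Dy).
rewrite -(curv_commutator oD sGamma a b (sc (c *m J)) Dx).
rewrite (E a b) (E b a) -mulmxBl.
by rewrite (curv_commutator oD sGamma a b (sc c) Dx).
Qed.

(** The complex structure being parallel, the trace with [J] commutes with the
    covariant derivative, and the trace vanishes identically. *)
Lemma dtorsion_trace x z b : D x -> endo_trace (fun v => dtorsion x z v b *m J) = 0.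
Proof.
move=> Dx; pose tau v := torsion x v b *m J.
have ltau : linear tau.
  by move=> k u v; rewrite /tau (torsion_linearl Gamma x b) mulmxDl scalemxAl.
have sT v := smooth_torsion oD sGamma v b.
have E v : dtorsion x z v b *m J =
    'D_z (fun y => torsion y v b *m J) x +
    (chris x z (tau v) - tau (chris x z v) - torsion x v (chris x z b) *m J).
  rewrite (derive_mulmx oD _ _ (sT v) Dx) /tau chris_J // -!mulmxBl -mulmxDl.
  by rewrite dtorsionE /covariant -!addrA.
rewrite (eq_endo_trace E).
rewrite (endo_traceD (fun v => 'D_z (fun y => torsion y v b *m J) x)).
rewrite (endo_traceB (fun v => chris x z (tau v) - _)).
rewrite (endo_traceB (fun v => chris x z (tau v))) T_balanced // subr0.
rewrite (endo_traceC (chris_linearr Gamma x z) ltau) subrr addr0.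
rewrite /endo_trace; under eq_bigr => k _.
  rewrite (derive_coord oD _ _ (smooth_map_mulmx oD J (sT (delta_mx 0 k))) Dx).
  over.
rewrite -derive_sum => [|k]; last first.
  exact: (smooth_on_derivable oD (smooth_map_mulmx oD J (sT (delta_mx 0 k)) k) Dx).
rewrite (@eq_derive_on _ _ _ oD _ _ (fun=> 0)) ?derive_cst // => y Dy.
rewrite fct_sumE; exact: (T_balanced Dy b).
Qed.

(** [J] is an isometry, so it preserves orthonormal frames, and it is skew for
    the metric, which is the second identity: the bivector [\sum_a e_a (x) J e_a]
    is antisymmetric. *)
Lemma frame_J x P : D x -> orthonormal_frame (G x) P ->
  orthonormal_frame (G x) (P *m J) /\
  P^T *m (P *m J) = - ((P *m J)^T *m P).
Proof.
move=> Dx oP.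
have GJ : J *m G x *m J^T = G x.
  by apply/matrixP => i j; rewrite -bil_mulmx !rowE G_J // bil_delta.
split.
  rewrite /orthonormal_frame trmx_mul.
  have -> : P *m J *m G x *m (J^T *m P^T) = P *m (J *m G x *m J^T) *m P^T.
    by rewrite !mulmxA.
  by rewrite GJ.
have hG := frame_gram oP.
have Gh : P^T *m P *m G x = 1%:M by apply: mulmx1C.
have JG : J *m G x = - (G x *m J^T).
  have JJT : J^T *m J^T = - 1%:M by rewrite -trmx_mul JJ raddfN /= trmx1.
  by rewrite -{2}GJ -(mulmxA (J *m G x)) JJT mulmxN mulmx1 opprK.
rewrite trmx_mul mulmxA -[LHS]mulmx1 -hG.
rewrite -[P^T *m P *m J *m _]mulmxA [J *m (G x *m _)]mulmxA JG.
by rewrite mulNmx mulmxN -!mulmxA [P^T *m (P *m _)]mulmxA [P^T *m P *m (G x *m _)]mulmxA Gh mul1mx.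
Qed.

(** Balancedness makes the Ricci form of the connection invariant under [J]: by
    the pair exchange, the defect is a sum of covariant derivatives of the trace
    of the torsion and of terms that cancel in pairs. *)
Lemma ricci_J x v : D x -> ricci Gamma x (v *m J) (v *m J) = ricci Gamma x v v.
Proof.
move=> Dx; have [P oP] := orthonormal_frame_exists (trmx_bil_sym (G_sym Dx)) (G_pos Dx).
have [oPJ PJ] := frame_J Dx oP.
pose e (l : 'I_m) := row l P; pose y := v *m J.
have eJ (a : 'I_m) : row a (P *m J) = e a *m J by rewrite row_mul.
have ex (a : 'I_m) := curv_pair_exchange oD sGamma sG G_sym G_compat T_skew (e a) y v (e a *m J) Dx.
have {}ex : \sum_a (2 * (bil (G x) (curv x (e a) y v) (e a *m J)
    - bil (G x) (curv x v (e a *m J) (e a)) y)) =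
    \sum_a (bil (G x) (dtorsion x (e a) y v) (e a *m J)
    + bil (G x) (dtorsion x (e a *m J) y v) (e a)
    - bil (G x) (dtorsion x y (e a) v) (e a *m J)
    - bil (G x) (dtorsion x v (e a) y) (e a *m J)).
  by apply: eq_bigr => a _.
have l1 w : linear (fun u => curv x u w w) by exact: (curv_linear1 oD sGamma w w Dx).
(* the curvature terms of the pair exchange at [(e_a, J v, v, J e_a)] are the two
   Ricci traces, over the frames [e_a] and [J e_a] *)
have s1 : \sum_a bil (G x) (curv x (e a) y v) (e a *m J) = - ricci Gamma x y y.
  rewrite /ricci -(frame_trace oP (l1 y)) -sumrN; apply: eq_bigr => a _.
  by rewrite bil_J // -curv_J.
have s2 : \sum_a bil (G x) (curv x v (e a *m J) (e a)) y = - ricci Gamma x v v.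
  rewrite /ricci -(frame_trace oPJ (l1 v)) -sumrN; apply: eq_bigr => a _.
  rewrite (curv_skew oD sGamma sG G_sym G_compat) // curv_J // eJ.
  by rewrite -bil_J // curv_antisym bilNl.
have tr z b : \sum_a bil (G x) (dtorsion x z (e a) b) (e a *m J) = 0.
  transitivity (- endo_trace (fun u => dtorsion x z u b *m J)); last first.
    by rewrite dtorsion_trace ?oppr0.
  have lt : linear (fun u => dtorsion x z u b *m J).
    move=> k u w; rewrite 3!(dtorsion_antisym oD sGamma z _ b Dx) !mulNmx.
    rewrite (dtorsion_linearr oD sGamma z b Dx k u w) mulmxDl -scalemxAl.
    by rewrite opprD scalerN.
  by rewrite -(frame_trace oP lt) -sumrN; apply: eq_bigr => a _; rewrite bil_J.
(* the remaining two torsion terms cancel by antisymmetry of the frame bivector *)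
have s3 : \sum_a bil (G x) (dtorsion x (e a) y v) (e a *m J) =
    - \sum_a bil (G x) (dtorsion x (e a *m J) y v) (e a).
  have fl w : linear (fun u => bil (G x) (dtorsion x u y v) w : R^o).
    move=> k u u'; rewrite (dtorsion_lineard oD sGamma y v Dx k u u').
    by rewrite bilDl bilZl.
  have fr u : linear (fun w => bil (G x) (dtorsion x u y v) w : R^o).
    by move=> k w w'; rewrite bilDr bilZr.
  have := frame_bilinear_sum fl fr PJ.
  have E1 (a : 'I_m) : bil (G x) (dtorsion x (row a P) y v) (row a (P *m J)) =
    bil (G x) (dtorsion x (e a) y v) (e a *m J) by rewrite eJ.
  have E2 (a : 'I_m) : bil (G x) (dtorsion x (row a (P *m J)) y v) (row a P) =
    bil (G x) (dtorsion x (e a *m J) y v) (e a) by rewrite eJ.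
  by rewrite (eq_bigr _ (fun (a : 'I_m) _ => E1 a)) (eq_bigr _ (fun (a : 'I_m) _ => E2 a)).
have split2 (f1 f2 : 'I_m -> R) :
    \sum_l 2 * (f1 l - f2 l) = 2 * (\sum_l f1 l - \sum_l f2 l).
  by rewrite -mulr_sumr sumrB.
have split4 (f1 f2 f3 f4 : 'I_m -> R) : \sum_l (f1 l + f2 l - f3 l - f4 l) =
    \sum_l f1 l + \sum_l f2 l - \sum_l f3 l - \sum_l f4 l.
  by rewrite !sumrB big_split.
have {ex split2 split4} ex := etrans (esym (split2 _ _)) (etrans ex (split4 _ _ _ _)).
have t1 := tr y v; have t2 := tr v y.
rewrite s1 s2 s3 t1 t2 in ex; move: ex.
move: (ricci _ _ _ _) (ricci _ _ _ _) (\sum_a _) => r1 r2 t h.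
by lra.
Qed.

End BalancedRicci.

(** * The algebra of forms at a point *)

Section ShuffleAlgebra.
Context {R : realFieldType} {I : finType}.
Implicit Types (A B C : seq I -> R) (i j a b c : I) (s p q : seq I).

(** The value at a point of the wedge product of two forms. *)
Definition shuffle A B s : R :=
  \sum_(t : (size s).-tuple bool)
    (-1) ^+ (\sum_(i < size s) \sum_(j < size s | (i < j)%N)
                (~~ tnth t i && tnth t j))%N *
    A (mask t s) * B (mask (map negb t) s).

Definition interior_prod i A : seq I -> R := fun s => A (i :: s).

Definition sign_twist A : seq I -> R := fun s => (-1) ^+ size s * A s.

Definition unit_form : seq I -> R := fun s => if s is [::] then 1 else 0.

Definition basic_form j : seq I -> R := fun s => (s == [:: j])%:R.

Lemma big_tuple_cons n (T : finType) (F : n.+1.-tuple T -> R) :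
  \sum_t F t = \sum_x \sum_(t : n.-tuple T) F [tuple of x :: t].
Proof.
rewrite pair_bigA /= (reindex (fun u : T * n.-tuple T => [tuple of u.1 :: u.2])) //=.
exists (fun t => (thead t, [tuple of behead t])) => [[x t] _|t _] /=.
  by rewrite theadE; congr (_, _); apply: val_inj.
by case/tupleP: t => x t; apply: val_inj.
Qed.

Lemma shuffle_nil A B : shuffle A B [::] = A [::] * B [::].
Proof.
rewrite /shuffle /= (big_pred1 [tuple]) => [|t]; last by rewrite (tuple0 t) /= eqxx.
by rewrite big_ord0 expr0 mul1r.
Qed.

(** The interior product is a graded derivation; together with the value on the
    empty word this determines the shuffle product, and the algebraic properties
    below follow by induction on the word. *)
Lemma shuffle_cons A B i s : shuffle A B (i :: s) =
  shuffle (interior_prod i A) B s + shuffle (sign_twist A) (interior_prod i B) s.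
Proof.
rewrite {1}/shuffle /= big_tuple_cons big_bool; congr (_ + _).
  apply: eq_bigr => t _ /=; congr (_ * _ * _); congr (_ ^+ _).
  rewrite big_ord_recl big1 ?add0n => [|k _]; last by rewrite tnth0.
  apply: eq_bigr => k _; rewrite big_mkcond big_ord_recl /= add0n -big_mkcond /=.
  by apply: eq_bigr => l _; rewrite !tnthS.
apply: eq_bigr => t _ /=; rewrite /sign_twist /interior_prod.
rewrite big_ord_recl exprD [X in X * _ * _]mulrC !mulrA; congr (_ * _ * _ * _).
  congr (_ ^+ _); apply: eq_bigr => k _.
  rewrite big_mkcond big_ord_recl /= add0n -big_mkcond /=.
  by apply: eq_bigr => l _; rewrite !tnthS.
congr (_ ^+ _); rewrite big_mkcond big_ord_recl /= add0n size_mask ?size_tuple //.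
rewrite -sum1_count big_tuple /= [RHS]big_mkcond; apply: eq_bigr => k _.
by rewrite tnthS; case: (tnth t k).
Qed.

Lemma shuffleDl A A' B s :
  shuffle (fun q => A q + A' q) B s = shuffle A B s + shuffle A' B s.
Proof. by rewrite /shuffle -big_split; apply: eq_bigr => t _; rewrite mulrDr mulrDl. Qed.

Lemma shuffleDr A B B' s :
  shuffle A (fun q => B q + B' q) s = shuffle A B s + shuffle A B' s.
Proof. by rewrite /shuffle -big_split; apply: eq_bigr => t _; rewrite mulrDr. Qed.

Lemma shuffleZl k A B s : shuffle (fun q => k * A q) B s = k * shuffle A B s.
Proof.
rewrite /shuffle mulr_sumr; apply: eq_bigr => t _.
by rewrite mulrCA -!mulrA.
Qed.

Lemma shuffleZr k A B s : shuffle A (fun q => k * B q) s = k * shuffle A B s.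
Proof. by rewrite /shuffle mulr_sumr; apply: eq_bigr => t _; rewrite mulrCA. Qed.

Lemma shuffleNl A B s : shuffle (fun q => - A q) B s = - shuffle A B s.
Proof. by rewrite -mulN1r -shuffleZl; congr shuffle; apply/funext => q; rewrite mulN1r. Qed.

Lemma shuffleNr A B s : shuffle A (fun q => - B q) s = - shuffle A B s.
Proof. by rewrite -mulN1r -shuffleZr; congr shuffle; apply/funext => q; rewrite mulN1r. Qed.

Lemma shuffle_suml (K : finType) (F : K -> seq I -> R) B s :
  shuffle (fun q => \sum_k F k q) B s = \sum_k shuffle (F k) B s.
Proof.
rewrite /shuffle exchange_big /=; apply: eq_bigr => t _.
by rewrite mulr_sumr mulr_suml.
Qed.

Lemma shuffle_sumr (K : finType) A (F : K -> seq I -> R) s :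
  shuffle A (fun q => \sum_k F k q) s = \sum_k shuffle A (F k) s.
Proof.
by rewrite /shuffle exchange_big /=; apply: eq_bigr => t _; rewrite mulr_sumr.
Qed.

Lemma sign_twistK A : sign_twist (sign_twist A) = A.
Proof. by apply/funext => s; rewrite /sign_twist mulrA -expr2 sqrr_sign mul1r. Qed.

Lemma interior_sign_twist i A : interior_prod i (sign_twist A) =
  (fun s => - sign_twist (interior_prod i A) s).
Proof. by apply/funext => s; rewrite /interior_prod /sign_twist /= exprS mulN1r mulNr. Qed.

Lemma sign_twist_interior i A : sign_twist (interior_prod i A) =
  (fun s => - interior_prod i (sign_twist A) s).
Proof. by apply/funext => s; rewrite interior_sign_twist opprK. Qed.

Lemma interior_shuffle i A B : interior_prod i (shuffle A B) =
  (fun s => shuffle (interior_prod i A) B s + shuffle (sign_twist A) (interior_prod i B) s).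
Proof. by apply/funext => s; rewrite -shuffle_cons. Qed.

Lemma sign_twist_shuffle A B : sign_twist (shuffle A B) = shuffle (sign_twist A) (sign_twist B).
Proof.
apply/funext => s; elim: s A B => [|i s IH] A B.
  by rewrite /sign_twist /= shuffle_nil !expr0 !mul1r shuffle_nil !mul1r.
rewrite shuffle_cons !interior_sign_twist shuffleNl shuffleNr -!IH -opprD.
by rewrite /sign_twist shuffle_cons /= exprS mulN1r mulNr mulrDr.
Qed.

Lemma shuffleA A B C : shuffle (shuffle A B) C = shuffle A (shuffle B C).
Proof.
apply/funext => s; elim: s A B C => [|i s IH] A B C.
  by rewrite !shuffle_nil mulrA.
rewrite !shuffle_cons !interior_shuffle shuffleDl shuffleDr sign_twist_shuffle.
by rewrite !IH addrA.
Qed.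

(** Graded commutativity. Contracting exchanges the parities, hence the joint
    induction. *)
Lemma shuffle_even_odd_comm s :
  (forall A B, sign_twist A = A -> shuffle A B s = shuffle B A s) /\
  (forall A B, sign_twist A = (fun q => - A q) ->
    shuffle A B s = shuffle (sign_twist B) A s).
Proof.
elim: s => [|i s [IHe IHo]]; split=> A B hA; rewrite ?shuffle_nil.
- by rewrite mulrC.
- by rewrite /sign_twist /= mul1r mulrC.
- rewrite !shuffle_cons hA (IHe _ _ hA) addrC; congr (_ + _).
  by rewrite (IHo (interior_prod i A)) // sign_twist_interior hA.
- rewrite !shuffle_cons hA shuffleNl sign_twistK interior_sign_twist shuffleNl.
  rewrite (IHo A) // addrC; congr (_ + _).
  rewrite IHe // sign_twist_interior hA; apply/funext => q.
  by rewrite /interior_prod opprK.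
Qed.

Lemma shuffle_even_comm A B : sign_twist A = A -> shuffle A B = shuffle B A.
Proof. by move=> eA; apply/funext => s; case: (shuffle_even_odd_comm s) => h _; exact: h. Qed.

Lemma interior_unit i : interior_prod i unit_form = (fun=> 0).
Proof. by []. Qed.

Lemma shuffle0l B s : shuffle (fun=> 0) B s = 0.
Proof. by rewrite /shuffle big1 // => t _; rewrite mulr0 mul0r. Qed.

Lemma shuffle0r A s : shuffle A (fun=> 0) s = 0.
Proof. by rewrite /shuffle big1 // => t _; rewrite mulr0. Qed.

Lemma shuffle1l B : shuffle unit_form B = B.
Proof.
apply/funext => s; elim: s B => [|i s IH] B; first by rewrite shuffle_nil mul1r.
rewrite shuffle_cons interior_unit shuffle0l add0r.
have -> : sign_twist unit_form = unit_form.
  by apply/funext => -[|j q]; rewrite /sign_twist /= ?mul1r ?mulr0.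
exact: IH.
Qed.

Lemma interior_basic i j :
  interior_prod i (basic_form j) = (fun s => (i == j)%:R * unit_form s).
Proof.
apply/funext => -[|k s]; rewrite /interior_prod /basic_form /=.
  by rewrite eqseq_cons andbT mulr1.
by rewrite eqseq_cons andbF mulr0.
Qed.

Lemma sign_twist_basic j : sign_twist (basic_form j) = (fun s => - basic_form j s).
Proof.
apply/funext => s; rewrite /sign_twist /basic_form.
by case: eqP => [->|_]; rewrite ?expr1 ?mulN1r // !mulr0 oppr0.
Qed.

(** The sum that defines the exterior derivative is the wedge product with the
    operator [\sum_j dx^j (x) d_j]; this turns identities for [ext_d] into
    identities in the shuffle algebra. *)
Lemma sum_shuffle_basic (B : I -> seq I -> R) s :
  \sum_j shuffle (basic_form j) (B j) s =
  \sum_(k < size s) (-1) ^+ k *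
    (if onth s k is Some i then B i (take k s ++ drop k.+1 s) else 0).
Proof.
elim: s B => [|i s IH] B.
  rewrite big_ord0 big1 // => j _; rewrite shuffle_nil /basic_form mul0r //.
rewrite big_ord_recl /= expr0 mul1r drop0.
under eq_bigr => j _ do rewrite shuffle_cons interior_basic shuffleZl shuffle1l
  sign_twist_basic shuffleNl.
rewrite big_split /= (bigD1 i) //= eqxx mul1r big1 => [|j ji]; last first.
  by rewrite eq_sym (negPf ji) mul0r.
rewrite addr0; congr (_ + _); rewrite sumrN IH -sumrN; apply: eq_bigr => k _.
by rewrite /= exprS mulN1r mulNr.
Qed.

Definition homogeneous (d : nat) A := forall s, size s != d -> A s = 0.

(** Adjacent transpositions generate all permutations, so this is full
    alternation, in a form that suits inductions on the word. *)
Definition alternating_form A :=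
  forall p a b q, A (p ++ a :: b :: q) = - A (p ++ b :: a :: q).

Lemma alternating_interior i A : alternating_form A -> alternating_form (interior_prod i A).
Proof. by move=> aA p a b q; rewrite /interior_prod -!cat_cons aA. Qed.

Lemma alternating_sign_twist A : alternating_form A -> alternating_form (sign_twist A).
Proof. by move=> aA p a b q; rewrite /sign_twist !size_cat /= aA mulrN. Qed.

Lemma alternating_shuffle A B : alternating_form A -> alternating_form B ->
  alternating_form (shuffle A B).
Proof.
move=> aA aB p a b q; elim: p A B aA aB => [|i p IH] A B aA aB /=; last first.
  rewrite !shuffle_cons opprD; congr (_ + _); apply: IH => //.
  - exact: alternating_interior.
  - exact: alternating_sign_twist.
  - exact: alternating_interior.
have ab C : alternating_form C ->
    interior_prod b (interior_prod a C) = (fun s => - interior_prod a (interior_prod b C) s).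
  by move=> aC; apply/funext => s; exact: (aC [::]).
rewrite !shuffle_cons !interior_sign_twist (ab A) // (ab B) // !shuffleNl shuffleNr.
ring.
Qed.

Lemma sign_twist_homogeneous d A : homogeneous d A ->
  sign_twist A = (fun s => (-1) ^+ d * A s).
Proof.
move=> hA; apply/funext => s; rewrite /sign_twist.
by have [<-//|/hA ->] := eqVneq (size s) d; rewrite !mulr0.
Qed.

Lemma homogeneous_shuffle d e A B : homogeneous d A -> homogeneous e B ->
  homogeneous (d + e) (shuffle A B).
Proof.
move=> hA hB s hs; rewrite /shuffle big1 // => t _.
have [Ad|/hA ->] := eqVneq (size (mask t s)) d; last by rewrite mulr0 mul0r.
rewrite hB ?mulr0 //; apply: contraNneq hs => Be.
rewrite -Ad -Be !size_mask ?size_map ?size_tuple //.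
have := count_predC id t; rewrite size_tuple count_map => E.
by apply/eqP; exact: esym E.
Qed.

(** Euler's identity: contracting and multiplying back counts the degree. *)
Lemma shuffle_basic_interior A s : alternating_form A ->
  \sum_b shuffle (basic_form b) (interior_prod b A) s = (size s)%:R * A s.
Proof.
elim: s A => [|c s IH] A aA.
  by rewrite mul0r big1 // => b _; rewrite shuffle_nil /basic_form mul0r.
have swap b : interior_prod c (interior_prod b A) =
    (fun q => - interior_prod b (interior_prod c A) q).
  by apply/funext => q; exact: (aA [::]).
under eq_bigr => b _ do rewrite shuffle_cons interior_basic shuffleZl shuffle1l
  sign_twist_basic shuffleNl swap shuffleNr opprK.
rewrite big_split /= IH; last exact: alternating_interior.
rewrite (bigD1 c) //= eqxx mul1r big1 => [|b bc]; last first.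
  by rewrite eq_sym (negPf bc) mul0r.
by rewrite addr0 /interior_prod -[_.+1%:R]natr1 mulrDl mul1r addrC.
Qed.

End ShuffleAlgebra.

(** * The Lefschetz operator and its adjoint *)

Section Lefschetz.
Context {R : realFieldType} {I : finType}.
Implicit Types (A B C : seq I -> R) (i j a b c : I) (s p q : seq I).
Variables (W : seq I -> R) (pi : I -> I -> R).
Hypothesis W2 : homogeneous 2 W.
Hypothesis altW : alternating_form W.
Hypothesis pi_antisym : forall a b, pi a b = - pi b a.
Hypothesis pi_inv : forall b c, \sum_a pi a b * W [:: a; c] = (b == c)%:R.

Definition contraction A : seq I -> R :=
  fun s => \sum_a \sum_b pi a b * A (a :: b :: s).

Let sign_twistW : sign_twist W = W.
Proof. by rewrite (sign_twist_homogeneous W2); apply/funext => s; rewrite sqrrN expr1n mul1r. Qed.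

Let interior2W a b : interior_prod b (interior_prod a W) = (fun s => W [:: a; b] * unit_form s).
Proof.
apply/funext => -[|c s]; rewrite /interior_prod /=; first by rewrite mulr1.
by rewrite W2 ?mulr0.
Qed.

Let sum_interiorW b s : \sum_a pi a b * interior_prod a W s = basic_form b s.
Proof.
rewrite /basic_form; case: s => [|c [|d s]].
- by rewrite big1 // => a _; rewrite /interior_prod W2 ?mulr0.
- by rewrite eqseq_cons andbT eq_sym -pi_inv.
- by rewrite eqseq_cons andbF big1 // => a _; rewrite /interior_prod W2 ?mulr0.
Qed.

(** The commutation relation of the Lefschetz operator with its adjoint. *)
Lemma contraction_shuffle d A s : homogeneous d A -> alternating_form A ->
  contraction (shuffle W A) s =
  shuffle W (contraction A) s + (#|I|%:R - 2 * d%:R) * A s.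
Proof.
move=> hA aA.
have E a b : shuffle W A (a :: b :: s) = W [:: a; b] * A s
    - shuffle (interior_prod a W) (interior_prod b A) s
    + shuffle (interior_prod b W) (interior_prod a A) s
    + shuffle W (interior_prod b (interior_prod a A)) s.
  rewrite shuffle_cons sign_twistW !shuffle_cons interior2W shuffleZl shuffle1l.
  by rewrite sign_twist_interior sign_twistW shuffleNl addrA.
have T : \sum_a \sum_b pi a b * shuffle (interior_prod a W) (interior_prod b A) s = d%:R * A s.
  rewrite exchange_big /=.
  transitivity (\sum_b shuffle (basic_form b) (interior_prod b A) s).
    apply: eq_bigr => b _; under eq_bigr => a _ do rewrite -shuffleZl.
    rewrite -shuffle_suml; congr (shuffle _ _ s); apply/funext => q.
    exact: sum_interiorW.
  rewrite shuffle_basic_interior //.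
  by have [->//|/hA ->] := eqVneq (size s) d; rewrite !mulr0.
have T' : \sum_a \sum_b pi a b * shuffle (interior_prod b W) (interior_prod a A) s = - (d%:R * A s).
  rewrite -T exchange_big -sumrN; apply: eq_bigr => b _; rewrite -sumrN.
  by apply: eq_bigr => a _; rewrite pi_antisym mulNr.
have T0 : \sum_a \sum_b pi a b * (W [:: a; b] * A s) = #|I|%:R * A s.
  rewrite exchange_big /=.
  transitivity (\sum_(b : I) A s); last by rewrite sumr_const mulr_natl.
  apply: eq_bigr => b _.
  transitivity ((\sum_a pi a b * W [:: a; b]) * A s).
    by rewrite mulr_suml; apply: eq_bigr => a _; rewrite mulrA.
  by rewrite pi_inv eqxx mul1r.
have T1 : \sum_a \sum_b pi a b * shuffle W (interior_prod b (interior_prod a A)) s =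
    shuffle W (contraction A) s.
  rewrite /contraction shuffle_sumr; apply: eq_bigr => a _.
  rewrite shuffle_sumr; apply: eq_bigr => b _.
  by rewrite shuffleZr.
rewrite {1}/contraction.
transitivity (#|I|%:R * A s - d%:R * A s - d%:R * A s + shuffle W (contraction A) s).
  rewrite -T0 -[X in _ - X - _]T -T' -T1 -sumrN -!big_split /=; apply: eq_bigr => a _.
  rewrite -sumrN -!big_split /=; apply: eq_bigr => b _; rewrite E; ring.
ring.
Qed.

Lemma iter_shuffle_homogeneous d A r : homogeneous d A ->
  homogeneous (d + r.*2) (iter r (shuffle W) A).
Proof.
move=> hA; elim: r => [|r IH] /=; first by rewrite addn0.
have -> : (d + r.+1.*2 = 2 + (d + r.*2))%N by rewrite doubleS !addnS.
exact: homogeneous_shuffle.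
Qed.

Lemma iter_shuffle_alternating A r : alternating_form A ->
  alternating_form (iter r (shuffle W) A).
Proof. by move=> aA; elim: r => //= r IH; apply: alternating_shuffle. Qed.

(** The commutation relation summed along the iteration: the degree grows by two
    at each step, which gives an arithmetic progression. *)
Lemma contraction_iter_shuffle d A r s : homogeneous d A -> alternating_form A ->
  contraction (iter r.+1 (shuffle W) A) s =
  iter r.+1 (shuffle W) (contraction A) s
  + r.+1%:R * (#|I|%:R - 2 * d%:R - 2 * r%:R) * iter r (shuffle W) A s.
Proof.
move=> hA aA; elim: r s => [|r IH] s.
  by rewrite /= (contraction_shuffle s hA aA) mul1r mulr0 subr0.
rewrite iterS (contraction_shuffle s (@iter_shuffle_homogeneous d A r.+1 hA)
  (@iter_shuffle_alternating A r.+1 aA)).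
have -> : contraction (iter r.+1 (shuffle W) A) = (fun q =>
    iter r.+1 (shuffle W) (contraction A) q +
    r.+1%:R * (#|I|%:R - 2 * d%:R - 2 * r%:R) * iter r (shuffle W) A q).
  by apply/funext => q; exact: IH.
rewrite shuffleDr shuffleZr -addrA -[shuffle W (iter r _ A) s]/(iter r.+1 (shuffle W) A s).
rewrite [in RHS]iterS; congr (_ + _); rewrite -mulrDl; congr (_ * _).
rewrite natrD -muln2 natrM -[r.+2%:R]natr1 -[r.+1%:R]natr1; ring.
Qed.

Lemma contraction_homogeneous d A : homogeneous d.+2 A -> homogeneous d (contraction A).
Proof.
move=> hA s hs; rewrite /contraction big1 // => a _; rewrite big1 // => b _.
by rewrite hA ?mulr0 //= !eqSS.
Qed.

Lemma contraction_alternating A : alternating_form A -> alternating_form (contraction A).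
Proof.
move=> aA p a b q; rewrite /contraction -sumrN; apply: eq_bigr => c _.
rewrite -sumrN; apply: eq_bigr => e _; rewrite -!cat_cons aA mulrN //.
Qed.

(** A 3-form killed by the (n - 2)-th power of the symplectic form in dimension
    2n is primitive. *)
Lemma contraction_eq0 A n : #|I| = n.+2.*2 -> homogeneous 3 A -> alternating_form A ->
  iter n (shuffle W) A = (fun=> 0) -> contraction A = (fun=> 0).
Proof.
move=> cI hA aA; pose t := contraction A => An0.
have ht : homogeneous 1 t by exact: contraction_homogeneous.
have at_ : alternating_form t by exact: contraction_alternating.
have ct : contraction t = (fun=> 0).
  apply/funext => s; rewrite {1}/contraction big1 // => a _; rewrite big1 // => b _.
  by rewrite ht ?mulr0.
have iter0 r : iter r (shuffle W) (fun=> 0) = (fun=> 0).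
  elim: r => //= r ->; apply/funext => s; exact: shuffle0r.
have c0 : contraction (fun=> 0) = (fun=> 0 : R).
  apply/funext => s; rewrite /contraction big1 // => a _; rewrite big1 // => b _.
  by rewrite mulr0.
(* the commutation constant of [contraction_iter_shuffle] vanishes on 3-forms *)
have tn : iter n (shuffle W) t = (fun=> 0).
  case: n cI An0 => [|n] cI An0; first by rewrite /= /t /= [A]An0 c0.
  apply/funext => s; have := contraction_iter_shuffle n s hA aA.
  rewrite An0 c0 cI -muln2 natrM.
  have -> : n.+3%:R * 2%:R - 2 * 3%:R - 2 * n%:R = 0 :> R.
    by rewrite -addn3 natrD; ring.
  by rewrite mulr0 mul0r addr0.
(* on 1-forms the constants are nonzero, so the powers can be removed one by one *)
have desc r : (r <= n)%N -> iter (n - r) (shuffle W) t = (fun=> 0).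
  elim: r => [|r IH] rn; first by rewrite subn0.
  apply/funext => s; have := IH (ltnW rn); rewrite -(subnSK rn) => h.
  have := contraction_iter_shuffle (n - r.+1) s ht at_.
  rewrite h c0 ct iter0 add0r => /esym/eqP.
  rewrite !mulf_eq0 => /orP[/orP[|]|/eqP //]; first by rewrite pnatr_eq0.
  rewrite cI -muln2 natrM natrB // -[n.+2%:R]natr1 -[n.+1%:R]natr1 -[r.+1%:R]natr1.
  have -> : (n%:R + 1 + 1) * 2%:R - 2 * 1%:R - 2 * (n%:R - (r%:R + 1)) = (r.+2%:R) * 2 :> R.
    by rewrite -[r.+2%:R]natr1 -[r.+1%:R]natr1; ring.
  by rewrite mulf_eq0 !pnatr_eq0.
by have := desc n (leqnn n); rewrite subnn.
Qed.

End Lefschetz.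

(** * Exterior derivatives of wedge powers *)

Section FormCalculus.
Context {R : realType} {m : nat}.
Variables (D : set 'rV[R]_m) (oD : open D).
Implicit Types (al be : @Defs.form R m) (x : 'rV[R]_m) (j : 'I_m) (s : seq 'I_m).

Lemma derive_sum_on (I : Type) (r : seq I) (F : I -> 'rV[R]_m -> R) x v :
  (forall l, smooth_on D (F l)) -> D x ->
  'D_v (fun y => \sum_(l <- r) F l y) x = \sum_(l <- r) 'D_v (F l) x.
Proof.
move=> sF Dx; elim: r => [|l r IH].
  rewrite big_nil (@eq_derive_on _ _ _ oD _ _ (fun=> 0)) //; first exact: derive_cst.
  by move=> y _; rewrite big_nil.
rewrite big_cons -IH -deriveD //.
- by apply: (@eq_derive_on _ _ _ oD) => // y _; rewrite big_cons.
- exact: (smooth_on_derivable oD (sF l) Dx).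
- apply: (smooth_on_derivable oD _ Dx).
  by apply: (@smooth_on_sum _ _ _ oD _ r xpredT) => k _; exact: sF.
Qed.

Lemma derive_mul_on f g x v : smooth_on D f -> smooth_on D g -> D x ->
  'D_v (fun y => f y * g y) x = 'D_v f x * g x + f x * 'D_v g x.
Proof.
move=> sf sg Dx; rewrite (@deriveM _ _ f g).
- by rewrite addrC; congr (_ + _); exact: mulrC.
- exact: (smooth_on_derivable oD sf Dx).
- exact: (smooth_on_derivable oD sg Dx).
Qed.

Definition smooth_form al := forall s, smooth_on D (fun y => al y s).

Definition form_partial j al x : seq 'I_m -> R := fun s => partial j (fun y => al y s) x.

Lemma smooth_wedge al be : smooth_form al -> smooth_form be -> smooth_form (wedge al be).
Proof.
move=> sa sb s; apply: (smooth_on_sum oD) => t _.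
apply: (smooth_on_mul oD) => //; apply: (smooth_on_mul oD) => //.
exact: smooth_on_cst.
Qed.

Lemma form_partial_wedge j al be x : smooth_form al -> smooth_form be -> D x ->
  form_partial j (wedge al be) x = (fun s =>
    shuffle (form_partial j al x) (be x) s + shuffle (al x) (form_partial j be x) s).
Proof.
move=> sa sb Dx; apply/funext => s; rewrite /form_partial /partial /wedge.
have sc (c : R) : smooth_on D (fun=> c) by exact: smooth_on_cst.
rewrite derive_sum_on // => [|t]; last first.
  by apply: (smooth_on_mul oD) => //; apply: (smooth_on_mul oD).
rewrite /shuffle -big_split /=; apply: eq_bigr => t _.
rewrite (derive_mul_on _ (smooth_on_mul oD (sc _) (sa _)) (sb _) Dx).
rewrite (derive_mul_on _ (sc _) (sa _) Dx).
by rewrite derive_cst mul0r add0r.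
Qed.

Lemma smooth_wedge_pow al k : smooth_form al -> smooth_form (wedge_pow al k).
Proof.
move=> sa; elim: k => [|k IH]; last exact: smooth_wedge.
by move=> [|i s]; exact: smooth_on_cst.
Qed.

Lemma ext_dE al x s :
  ext_d al x s = \sum_j shuffle (basic_form j) (form_partial j al x) s.
Proof. by rewrite sum_shuffle_basic. Qed.

(** The form is even, so that its derivative can be moved to the front. *)
Lemma form_partial_wedge_pow j al x k : smooth_form al -> D x ->
  homogeneous 2 (al x) ->
  form_partial j (wedge_pow al k.+1) x =
  (fun s => k.+1%:R * shuffle (form_partial j al x) (wedge_pow al k x) s).
Proof.
move=> sa Dx a2.
have ev : sign_twist (al x) = al x.
  by rewrite (sign_twist_homogeneous a2); apply/funext => s; rewrite sqrrN expr1n mul1r.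
have step k' : form_partial j (wedge_pow al k'.+1) x = (fun s =>
    shuffle (form_partial j al x) (wedge_pow al k' x) s +
    shuffle (al x) (form_partial j (wedge_pow al k') x) s).
  exact: form_partial_wedge sa (@smooth_wedge_pow al k' sa) Dx.
elim: k => [|k IH]; rewrite step.
  apply/funext => s; rewrite mul1r.
  rewrite (_ : form_partial j (wedge_pow al 0) x = (fun=> 0)).
    by rewrite shuffle0r addr0.
  by apply/funext => -[|i q]; rewrite /form_partial /partial /= derive_cst.
rewrite IH; apply/funext => s; rewrite shuffleZr -shuffleA.
rewrite (shuffle_even_comm (form_partial j al x) ev) shuffleA.
by rewrite -[X in X + _]mul1r -mulrDl [_.+2%:R]mulrS.
Qed.

Lemma ext_d_wedge_pow al x k s : smooth_form al -> D x -> homogeneous 2 (al x) ->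
  ext_d (wedge_pow al k.+1) x s =
  k.+1%:R * iter k (shuffle (al x)) (ext_d al x) s.
Proof.
move=> sa Dx a2.
have ev : sign_twist (al x) = al x.
  by rewrite (sign_twist_homogeneous a2); apply/funext => q; rewrite sqrrN expr1n mul1r.
transitivity (k.+1%:R * shuffle (ext_d al x) (wedge_pow al k x) s).
  rewrite ext_dE (_ : ext_d al x =
    (fun q => \sum_j shuffle (basic_form j) (form_partial j al x) q)); last first.
    by apply/funext => q; rewrite ext_dE.
  rewrite shuffle_suml mulr_sumr; apply: eq_bigr => j _.
  by rewrite (form_partial_wedge_pow j k) // shuffleZr shuffleA.
congr (_ * _); elim: k s => [|k IH] s.
  rewrite /= -[form0 _ x]/unit_form; congr (_ s).
  rewrite -(shuffle_even_comm (ext_d al x) (A := unit_form)) ?shuffle1l //.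
  by apply/funext => -[|i q]; rewrite /sign_twist /= ?mul1r ?mulr0.
rewrite [in RHS]iterS [wedge_pow _ _]iterS -[wedge al _ x]/(shuffle (al x) _).
rewrite -shuffleA -(shuffle_even_comm (ext_d al x) ev) shuffleA.
by congr (shuffle _ _ s); apply/funext => q; exact: IH.
Qed.

Lemma ext_d_homogeneous d al x : D x ->
  (forall y, D y -> homogeneous d (al y)) -> homogeneous d.+1 (ext_d al x).
Proof.
move=> Dx ha s hs; rewrite ext_dE big1 // => j _.
apply: (@homogeneous_shuffle _ _ 1 d _ _ _ _ s hs) => q hq.
  rewrite /basic_form; have [E|//] := eqVneq q [:: j].
  by rewrite E in hq.
rewrite /form_partial /partial (@eq_derive_on _ _ _ oD _ _ (fun=> 0)) ?derive_cst //.
by move=> y /ha; apply.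
Qed.

Lemma ext_d_alternating al x : D x -> smooth_form al ->
  (forall y, D y -> alternating_form (al y)) -> alternating_form (ext_d al x).
Proof.
move=> Dx sa aa p a b q; rewrite !ext_dE -sumrN; apply: eq_bigr => j _.
apply: alternating_shuffle => {p a b q} p a b q.
  have two (c e : 'I_m) : (p ++ c :: e :: q == [:: j]) = false.
    by apply/eqP => /(congr1 size); rewrite size_cat /= !addnS.
  by rewrite /basic_form !two oppr0.
rewrite /form_partial /partial -deriveN.
  by apply: (@eq_derive_on _ _ _ oD) => // y Dy; exact: aa.
exact: (smooth_on_derivable oD (sa _) Dx).
Qed.

Lemma ext_d3 al x a b c : ext_d al x [:: a; b; c] =
  form_partial a al x [:: b; c] - form_partial b al x [:: a; c]
  + form_partial c al x [:: a; b].
Proof.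
rewrite /ext_d /= !big_ord_recl big_ord0 /= /bump /= !addn0 addr0.
by rewrite expr0 expr1 mul1r mulN1r expr2 mulN1r opprK mul1r addrA.
Qed.

End FormCalculus.

(** * The torsion of a balanced metric *)

(** In complex dimension one there is no 3-form; this case is not covered by the
    Lefschetz argument, since the balanced condition is then empty. *)
Lemma alternating3_dim2 (R : realFieldType) m (A : seq 'I_m -> R) a b c : m = 2%N ->
  alternating_form A -> A [:: a; b; c] = 0.
Proof.
move=> m2 aA.
have eq0 (y : R) : y = - y -> y = 0 by move=> h; lra.
have e12 i j : A [:: i; i; j] = 0 by apply: eq0; exact: (aA [::] i i [:: j]).
have e23 i j : A [:: i; j; j] = 0 by apply: eq0; exact: (aA [:: i] j j [::]).
have [->|ab] := eqVneq a b; first exact: e12.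
have [->|bc] := eqVneq b c; first exact: e23.
have -> : a = c.
  apply/val_inj/eqP; move: ab bc; rewrite -!val_eqE /=.
  by have := ltn_ord a; have := ltn_ord b; have := ltn_ord c; lia.
by rewrite (aA [::] c b [:: c]) /= e23 oppr0.
Qed.

Section BalancedTorsion.
Context {R : realType} {m : nat}.
Variables (D : set 'rV[R]_m) (oD : open D) (Gamma : @christoffel R m).
Variable G : 'rV[R]_m -> 'M[R]_m.
Hypothesis sG : forall i j, smooth_on D (fun x => G x i j).
Hypothesis G_sym : forall x, D x -> forall v w, bil (G x) v w = bil (G x) w v.
Hypothesis G_pos : forall x, D x -> forall v, v != 0 -> 0 < bil (G x) v v.
Hypothesis G_compat : forall X Y Z, smooth_map_on D X -> smooth_map_on D Y ->
  smooth_map_on D Z -> forall x, D x ->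
  'D_(X x) (fun y => bil (G y) (Y y) (Z y)) x =
  bil (G x) (covariant Gamma X Y x) (Z x) + bil (G x) (Y x) (covariant Gamma X Z x).
Hypothesis T_skew : forall x, D x -> forall v w z,
  bil (G x) (torsion Gamma x v w) z = - bil (G x) (torsion Gamma x v z) w.
Variable J : 'M[R]_m.
Hypothesis JJ : J *m J = - 1%:M.
Hypothesis G_J : forall x, D x -> forall v w,
  bil (G x) (v *m J) (w *m J) = bil (G x) v w.
Hypothesis J_parallel : forall X Y, smooth_map_on D X -> smooth_map_on D Y ->
  forall x, D x ->
  covariant Gamma X (fun y => Y y *m J) x = covariant Gamma X Y x *m J.

Definition kahler_form : @Defs.form R m := fun x s =>
  match s with
  | [:: i; j] => bil (G x) (delta_mx 0 i *m J) (delta_mx 0 j)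
  | _ => 0
  end.

Variable n : nat.
Hypothesis mn : m = n.*2.
Hypothesis balanced_form : forall x s, D x -> ext_d (wedge_pow kahler_form n.-1) x s = 0.

Local Notation chris := (chris Gamma).
Local Notation torsion := (torsion Gamma).
Implicit Types (x v w z : 'rV[R]_m) (a b c : 'I_m).

Lemma kahler_form_homogeneous x : homogeneous 2 (kahler_form x).
Proof. by move=> [|i [|j [|k s]]]. Qed.

Lemma kahler_form_antisym x v w : D x ->
  bil (G x) (v *m J) w = - bil (G x) (w *m J) v.
Proof. by move=> Dx; rewrite G_sym // (bil_J JJ G_J) // opprK. Qed.

Lemma kahler_form_alternating x : D x -> alternating_form (kahler_form x).
Proof.
move=> Dx [|i [|j p]] a b [|k q] //=; rewrite ?oppr0 //.
- exact: kahler_form_antisym.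
- by case: p => [|? ?] /=; rewrite oppr0.
- by case: p => [|? ?] /=; rewrite oppr0.
Qed.

Lemma smooth_kahler_form : smooth_form D kahler_form.
Proof.
move=> [|i [|j [|k s]]]; try exact: smooth_on_cst.
exact: (smooth_bil oD sG (smooth_map_cst D _) (smooth_map_cst D _)).
Qed.

(** Balancedness says that [d omega] is killed by the [n - 2]-nd power of [omega],
    hence it is primitive. *)
Lemma ext_d_kahler_contraction x P c : D x -> orthonormal_frame (G x) P ->
  contraction (fun a b => (P^T *m (P *m J)) a b) (ext_d kahler_form x) [:: c] = 0.
Proof.
move=> Dx oP; have [oPJ PJ] := frame_J JJ G_J Dx oP.
have alt3 : alternating_form (ext_d kahler_form x).
  apply: (ext_d_alternating oD Dx smooth_kahler_form) => y.
  exact: kahler_form_alternating.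
have hom3 : homogeneous 3 (ext_d kahler_form x).
  by apply: (ext_d_homogeneous oD Dx) => y _; exact: kahler_form_homogeneous.
case: (n) mn (balanced_form) => [|[|k]] mk bal.
- by have := ltn_ord c; rewrite [X in (_ < X)%N]mk.
- rewrite /contraction big1 // => a _; rewrite big1 // => b _.
  by rewrite (alternating3_dim2 _ _ _ mk alt3) mulr0.
set pi := fun a b => (P^T *m (P *m J)) a b.
have anti a b : pi a b = - pi b a.
  rewrite /pi {1}PJ [LHS]mxE; congr (- _).
  have -> : (P *m J)^T *m P = (P^T *m (P *m J))^T by rewrite [RHS]trmx_mul trmxK.
  by rewrite mxE.
(* [pi] is the inverse bivector of the fundamental form *)
have inv b e : \sum_a pi a b * kahler_form x [:: a; e] = (b == e)%:R.
  transitivity (((P^T *m (P *m J))^T *m (J *m G x)) b e).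
    rewrite [RHS]mxE; apply: eq_bigr => a _; rewrite [(_^T) b a]mxE; congr (_ * _).
    by rewrite /kahler_form /bil -rowE -row_mul trmx_delta -colE !mxE.
  have -> : (P^T *m (P *m J))^T = - (P^T *m P *m J).
    by rewrite trmx_mul trmxK -[LHS]opprK -PJ mulmxA.
  rewrite mulNmx -!mulmxA (mulmxA J J) JJ mulNmx mul1mx !mulmxN opprK mulmxA.
  have -> : P^T *m P *m G x = 1%:M by apply: mulmx1C; exact: frame_gram.
  by rewrite mxE.
have cI : #|'I_m| = k.+2.*2 by rewrite card_ord.
have := contraction_eq0 (@kahler_form_homogeneous x) (kahler_form_alternating Dx)
  anti inv cI hom3 alt3.
move=> -> //; apply/funext => s; have := bal x s Dx.
rewrite /= (ext_d_wedge_pow oD k s smooth_kahler_form Dx (@kahler_form_homogeneous x)).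
by move/eqP; rewrite mulf_eq0 pnatr_eq0 => /eqP.
Qed.

(** The metric and [J] are parallel, so the derivative of the fundamental form
    only sees the Christoffel symbols, and antisymmetrizing leaves the torsion. *)
Lemma ext_d_kahler_torsion x a b c : D x ->
  let e i : 'rV[R]_m := delta_mx 0 i in
  ext_d kahler_form x [:: a; b; c] =
  bil (G x) (torsion x (e a) (e b) *m J) (e c)
  + bil (G x) (torsion x (e b) (e c) *m J) (e a)
  + bil (G x) (torsion x (e c) (e a) *m J) (e b).
Proof.
move=> Dx e.
have dK i j k : form_partial i kahler_form x [:: j; k] =
    bil (G x) (chris x (e i) (e j) *m J) (e k) - bil (G x) (chris x (e i) (e k) *m J) (e j).
  rewrite /form_partial /partial /=.
  have sc u : smooth_map_on D (cst u : 'rV[R]_m -> 'rV[R]_m) by exact: smooth_map_cst.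
  rewrite (derive_bil G_compat (e i) (sc (e j *m J)) (sc (e k)) Dx) !covariant_cst /=.
  by rewrite (chris_J J_parallel) // (kahler_form_antisym (e j)) //.
rewrite ext_d3 !dK !torsionE !mulmxBl !bilBl; ring.
Qed.

(** The Lee form vanishes: tracing [d omega] over [e_l, J e_l] leaves a single
    torsion term, the two others being zero by skewness, and total skewness moves
    the free index to the second place. *)
Lemma torsion_balanced x w : D x ->
  endo_trace (fun v => torsion x v w *m J) = 0.
Proof.
move=> Dx; have [P oP] := orthonormal_frame_exists (trmx_bil_sym (G_sym Dx)) (G_pos Dx).
have [oPJ PJ] := frame_J JJ G_J Dx oP.
pose e (l : 'I_m) := row l P.
have eJ (l : 'I_m) : row l (P *m J) = e l *m J by rewrite row_mul.
have lT : linear (fun v => torsion x v w *m J).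
  by move=> k u v; rewrite (torsion_linearl Gamma x w) mulmxDl scalemxAl.
rewrite -(frame_trace oP lT).
have T23 u v : bil (G x) (torsion x u v) v = 0.
  by have := T_skew Dx u v v => h; lra.
(* the components of [d omega] on arbitrary vectors *)
pose th u v z := bil (G x) (torsion x u v *m J) z + bil (G x) (torsion x v z *m J) u
  + bil (G x) (torsion x z u *m J) v.
have [th_lin1 th_lin2] : (forall v z, linear (fun u => th u v z : R^o)) /\
    (forall u z, linear (fun v => th u v z : R^o)).
  rewrite /th; have := torsion_linearl Gamma x; have := torsion_linearr Gamma x.
  move: (torsion x) (G x) => T g TR TL; split=> [v z k u u'|u z k v v'].
    rewrite (TL v) (TR z) !mulmxDl -!scalemxAl !bilDl !bilDr !bilZl !bilZr.
    by rewrite -[RHS]/(k * _ + _); ring.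
  rewrite (TL z) (TR u) !mulmxDl -!scalemxAl !bilDl !bilDr !bilZl !bilZr.
  by rewrite -[RHS]/(k * _ + _); ring.
(* the contraction of [d omega] with the inverse bivector, over the frame *)
have th0 (c : 'I_m) : \sum_l th (e l) (e l *m J) (delta_mx 0 c) = 0.
  rewrite -[RHS](ext_d_kahler_contraction c Dx oP) /contraction.
  transitivity (\sum_l th (row l P) (row l (P *m J)) (delta_mx 0 c)).
    by apply: eq_bigr => l _; rewrite eJ.
  rewrite [LHS](@frame_bilinear_expand _ _ P (P *m J)
    (fun u v => th u v (delta_mx 0 c))) //.
  by apply: eq_bigr => a _; apply: eq_bigr => b _; rewrite ext_d_kahler_torsion.
have thE (l c : 'I_m) : th (e l) (e l *m J) (delta_mx 0 c) =
    bil (G x) (torsion x (e l) (e l *m J) *m J) (delta_mx 0 c).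
  rewrite /th (G_J Dx) T23 addr0 -[bil _ (_ *m J) (e l)]opprK.
  rewrite -(bil_J JJ G_J _ _ Dx) (torsion_antisym _ _ (e l *m J)) bilNl T23.
  by rewrite !oppr0 addr0.
have S0 z : \sum_l bil (G x) (torsion x (e l) (e l *m J) *m J) z = 0.
  under eq_bigr => l _ do rewrite (G_sym Dx) {1}(row_sum_delta z) bil_suml.
  rewrite exchange_big big1 // => c _.
  transitivity (z 0 c * \sum_l th (e l) (e l *m J) (delta_mx 0 c)).
    rewrite mulr_sumr; apply: eq_bigr => l _.
    by rewrite thE bilZl (G_sym Dx).
  by rewrite th0 mulr0.
rewrite -[RHS](S0 (w *m J)); apply: eq_bigr => l _.
rewrite (G_J Dx) -/(e l) -[LHS]opprK -(bil_J JJ G_J _ _ Dx).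
by rewrite (T_skew Dx) opprK.
Qed.

End BalancedTorsion.

(** * The Laplace-de Rham operator on functions *)

Section LeviCivita.
Context {R : realType}.

Definition letter_mx m p (s : seq 'I_m) : 'M[R]_(p, m) :=
  \matrix_(i, j) (onth s i == Some j)%:R.

Lemma levi_civitaE m (s : seq 'I_m) : levi_civita s = \det (letter_mx m s) :> R.
Proof. by []. Qed.

Lemma onth_delete (T : Type) (s : seq T) k i :
  onth (take k s ++ drop k.+1 s) i = onth s (bump k i).
Proof.
elim: s k i => [|x s IH] k i; first by rewrite !onth0n.
case: k => [|k] /=; first by rewrite drop0.
by case: i => [|i] //=; rewrite IH /bump ltnS addnS.
Qed.

(** Moving [t] to the front of a word and deleting its [k]-th letter computes a
    cofactor of the matrix of the word. *)
Lemma levi_civita_cofactor m (s : seq 'I_m.+1) (k t : 'I_m.+1) :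
  (-1) ^+ k * levi_civita (t :: (take k s ++ drop k.+1 s)) =
  cofactor (letter_mx m.+1 s) k t :> R.
Proof.
rewrite levi_civitaE (expand_det_row _ ord0) (bigD1 t) //= big1 ?addr0 => [|j jt].
  rewrite mxE /= eqxx mul1r /cofactor add0n mulrA -exprD; congr (_ * _).
  congr (\det _); apply/matrixP => i j; rewrite !mxE /= onth_delete.
  by rewrite /bump.
rewrite mxE /=; have -> : (Some t == Some j) = (j == t) by rewrite eq_sym.
by rewrite (negPf jt) mul0r.
Qed.

(** An entry of [\adj A *m A], where [A] is the matrix of the word. *)
Lemma sum_levi_civita_delete m (s : seq 'I_m.+1) (t j : 'I_m.+1) :
  \sum_(k < m.+1) (-1) ^+ k * (onth s k == Some j)%:R *
    levi_civita (t :: (take k s ++ drop k.+1 s)) =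
  levi_civita s * (t == j)%:R :> R.
Proof.
rewrite levi_civitaE; have := mul_adj_mx (letter_mx m.+1 s : 'M[R]_m.+1).
move=> /matrixP/(_ t j); rewrite !mxE => E.
rewrite mulr_natr -[RHS]E; apply: eq_bigr => k _.
rewrite mulrAC levi_civita_cofactor [X in _ = X * _]mxE.
by rewrite [X in _ = _ * X]mxE.
Qed.

(** Words with a repeated letter have zero Levi-Civita symbol; the others are
    permutations. *)
Lemma sum_levi_civita m (F : m.-tuple 'I_m -> R) :
  \sum_(t : m.-tuple 'I_m) levi_civita t * F t =
  \sum_(s : {perm 'I_m}) (-1) ^+ s * F [tuple s i | i < m].
Proof.
have E (t : m.-tuple 'I_m) : levi_civita t =
    \sum_(s : {perm 'I_m}) (-1) ^+ s * (t == [tuple s i | i < m])%:R :> R.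
  rewrite levi_civitaE; apply: eq_bigr => s _; congr (_ * _).
  have [->|ne] := eqVneq t [tuple s i | i < m].
    rewrite big1 // => i _; rewrite mxE onthE (nth_map (s i)) ?size_tuple //.
    by rewrite -tnth_nth tnth_mktuple eqxx.
  have : [exists i, tnth t i != s i].
    rewrite -negb_forall; apply: contra ne => /forallP h; apply/eqP/eq_from_tnth => i.
    by rewrite tnth_mktuple; apply/eqP.
  move=> /existsP[i ti]; rewrite (bigD1 i) //= mxE onthE (nth_map (s i)) ?size_tuple //.
  have -> : (Some (nth (s i) t i) == Some (s i)) = false.
    by rewrite -tnth_nth; exact: negPf.
  by rewrite mul0r.
under eq_bigr => t _ do rewrite E mulr_suml.
rewrite exchange_big /=; apply: eq_bigr => s _.
rewrite (bigD1 [tuple s i | i < m]) //= eqxx mulr1 big1 ?addr0 // => t /negPf ->.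
by rewrite mulr0 mul0r.
Qed.

Lemma sum_levi_civita2 m (h : 'M[R]_m) :
  \sum_(t : m.-tuple 'I_m) levi_civita t *
    \sum_(r : m.-tuple 'I_m) (\prod_(k < m) h (tnth t k) (tnth r k)) * levi_civita r
  = (m`!)%:R * \det h.
Proof.
rewrite sum_levi_civita.
transitivity (\sum_(s : {perm 'I_m}) \det h); last first.
  by rewrite sumr_const card_Sn mulr_natl.
apply: eq_bigr => s _.
under eq_bigr => r _ do rewrite mulrC.
rewrite sum_levi_civita.
transitivity ((-1) ^+ s * \det (row_perm s h)).
  congr (_ * _); apply: eq_bigr => t _; congr (_ * _); apply: eq_bigr => k _.
  by rewrite !tnth_mktuple mxE.
by rewrite row_permE det_mulmx det_perm mulrA -expr2 sqrr_sign mul1r.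
Qed.

End LeviCivita.

Section HodgeLaplacian.
Context {R : realType}.

(** The Hodge star with the number of summed indices as a separate parameter, so
    that it can be rewritten. *)
Definition star_sum m (d : nat) (g : 'M[R]_m) (A : seq 'I_m -> R) s : R :=
  Num.sqrt (\det g) / d`!%:R *
    \sum_(t : d.-tuple 'I_m) levi_civita (t ++ s) *
      \sum_(r : d.-tuple 'I_m) (\prod_(k < d) invmx g (tnth t k) (tnth r k)) * A r.

Lemma hodge_starE m (g : 'rV[R]_m -> 'M[R]_m) (al : @Defs.form R m) x d s :
  (d + size s)%N = m -> hodge_star g al x s = star_sum d (g x) (al x) s.
Proof.
move=> ds; rewrite /hodge_star.
have sm : (size s <= m)%N by move: ds; lia.
have -> : (m - size s = d)%N by move: ds; lia.
by rewrite sm.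
Qed.

Lemma sum_tuple1 (T : finType) (F : 1.-tuple T -> R) :
  \sum_t F t = \sum_i F [tuple i].
Proof.
rewrite big_tuple_cons; apply: eq_bigr => i _.
rewrite (big_pred1 [tuple]) => [|t]; last by rewrite (tuple0 t) /= eqxx.
by congr F; apply: val_inj.
Qed.

Lemma star_sum1 m (g : 'M[R]_m) (A : seq 'I_m -> R) s :
  star_sum 1 g A s = Num.sqrt (\det g) *
    \sum_t levi_civita (t :: s) * \sum_j invmx g t j * A [:: j].
Proof.
rewrite /star_sum divr1; congr (_ * _); rewrite sum_tuple1; apply: eq_bigr => t _.
congr (_ * _); rewrite sum_tuple1; apply: eq_bigr => j _.
by rewrite big_ord1.
Qed.

(** A top form is a multiple of the symbol, and its star is the contraction of
    the symbol with itself in the inverse metric. *)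
Lemma star_sum_top m (g : 'M[R]_m) (A : seq 'I_m -> R) (c : R) :
  (forall r : m.-tuple 'I_m, A r = levi_civita r * c) ->
  star_sum m g A [::] = Num.sqrt (\det g) * \det (invmx g) * c.
Proof.
move=> Ac; rewrite /star_sum.
transitivity (Num.sqrt (\det g) / m`!%:R * ((m`!)%:R * \det (invmx g) * c)).
  congr (_ * _); rewrite -sum_levi_civita2 mulr_suml; apply: eq_bigr => t _.
  rewrite cats0 -[RHS]mulrA; congr (levi_civita t * _).
  rewrite mulr_suml; apply: eq_bigr => r _.
  by rewrite Ac mulrA.
by rewrite -!mulrA mulKf // pnatr_eq0 -lt0n fact_gt0.
Qed.

Lemma ext_d_form0 m (f : 'rV[R]_m -> R) x s : ext_d (form0 f) x s =
  match s with [:: i] => partial i f x | _ => 0 end.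
Proof.
case: s => [|i [|j s]]; first by rewrite /ext_d big_ord0.
  by rewrite /ext_d big_ord1 /= expr0 mul1r.
rewrite /ext_d big1 // => k _; case: (onth _ _) => [l|]; last by rewrite mulr0.
have -> : (fun y => form0 f y (take k [:: i, j & s] ++ drop k.+1 [:: i, j & s])) =
    (fun=> 0).
  apply/funext => y; case E : (_ ++ _) => //.
  move/(congr1 size): E; rewrite size_cat size_take size_drop.
  by move: (ltn_ord k) => /=; case: ifP => /= h1 h2; lia.
by rewrite /partial derive_cst mulr0.
Qed.

Let pick_letter m (c : R) (L : 'I_m -> R) (Q : 'I_m -> 'I_m -> R) a :
  c * (\sum_t L t * Q a t) = \sum_j \sum_t c * (Some a == Some j)%:R * L t * Q j t.
Proof.
rewrite [RHS](bigD1 a) //= [X in _ = _ + X]big1 ?addr0 => [|j ja]; last first.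
  rewrite big1 // => t _; have -> : (Some a == Some j) = false.
    by rewrite eq_sym; exact: negPf.
  by rewrite mulr0 !mul0r.
by rewrite eqxx mulr1 mulr_sumr; apply: eq_bigr => t _; rewrite mulrA.
Qed.

(** The Laplace-de Rham operator on functions is minus the divergence, with
    respect to the density [sqrt (det g)], of the gradient. *)
Lemma laplace_de_rham_form0 m (D : set 'rV[R]_m) (g : 'rV[R]_m -> 'M[R]_m)
    (f : 'rV[R]_m -> R) x : open D -> D x ->
  let V t y := Num.sqrt (\det (g y)) * \sum_j invmx (g y) t j * partial j f y in
  (forall t v y, D y -> derivable (V t) y v) ->
  laplace_de_rham g (form0 f) x [::] =
  - (Num.sqrt (\det (g x)) * \det (invmx (g x)) * \sum_t partial t (V t) x).
Proof.
move=> oD Dx V dV; rewrite /laplace_de_rham {2}/ext_d big_ord0 addr0.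
rewrite /codiff; congr (- _).
rewrite (@hodge_starE _ _ _ _ m) ?addn0 //; apply: star_sum_top => r.
case: m => [|m] in D g f x oD Dx V dV r *.
  by rewrite (tuple0 r) /ext_d !big_ord0 mulr0.
have starV y s : size s = m ->
    hodge_star g (ext_d (form0 f)) y s = \sum_t levi_civita (t :: s) * V t y.
  move=> sm; rewrite (@hodge_starE _ _ _ _ 1) ?sm ?add1n // star_sum1 mulr_sumr.
  apply: eq_bigr => t _; rewrite mulrCA; congr (_ * (_ * _)); apply: eq_bigr => j _.
  by rewrite ext_d_form0.
rewrite /ext_d size_tuple.
transitivity (\sum_(k < m.+1) \sum_j \sum_t (-1) ^+ k * (onth r k == Some j)%:R *
    levi_civita (t :: (take k r ++ drop k.+1 r)) * partial j (V t) x).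
  apply: eq_bigr => k _.
  have szk : size (take k r ++ drop k.+1 r) = m.
    rewrite size_cat size_take size_drop size_tuple ltn_ord.
    by have := ltn_ord k; lia.
  have -> : onth r k = Some (tnth r k).
    by rewrite onthE (nth_map (tnth r k)) ?size_tuple // -tnth_nth.
  rewrite -(pick_letter _ (fun t => levi_civita (t :: (take k r ++ drop k.+1 r)))
    (fun j t => partial j (V t) x)); congr (_ * _).
  rewrite {1}/partial.
  rewrite (@eq_derive_on _ _ _ oD _ _ (\sum_t (fun y =>
      levi_civita (t :: (take k r ++ drop k.+1 r)) * V t y))) //; last first.
    by move=> y _; rewrite starV // fct_sumE.
  rewrite derive_sum => [|t]; last first.
    by apply: derivableM; [exact: derivable_cst|exact: dV].
  by apply: eq_bigr => t _; rewrite deriveMl //; exact: dV.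
rewrite exchange_big /=; under eq_bigr => j _ do rewrite exchange_big /=.
rewrite mulr_sumr exchange_big /=; apply: eq_bigr => t _.
under eq_bigr => j _ do rewrite -mulr_suml sum_levi_civita_delete.
rewrite (bigD1 t) //= eqxx mulr1 big1 ?addr0 // => j jt.
by rewrite eq_sym (negPf jt) mulr0 mul0r.
Qed.

End HodgeLaplacian.

(** * Gradient and divergence *)

Lemma is_derive_prod (R : realType) m (I : eqType) (r : seq I)
    (F : I -> 'rV[R]_m -> R) (x v : 'rV[R]_m) : uniq r ->
  (forall i, derivable (F i) x v) ->
  is_derive x v (fun y => \prod_(i <- r) F i y)
    (\sum_(i <- r) 'D_v (F i) x * \prod_(j <- r | j != i) F j x).
Proof.
move=> ur dF; elim: r ur => [|k r IH] /=.
  move=> _; rewrite big_nil.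
  have -> : (fun y => \prod_(i <- [::]) F i y) = cst 1.
    by apply/funext => y; rewrite big_nil.
  exact: is_derive_cst.
move=> /andP[kr /IH{}IH].
have -> : (fun y => \prod_(i <- k :: r) F i y) = F k * (fun y => \prod_(i <- r) F i y).
  by apply/funext => y; rewrite big_cons.
have dk := derivableP (dF k).
apply: is_derive_eq; rewrite !big_cons eqxx /= addrC; congr (_ + _).
  rewrite -[LHS]/(_ * _) mulrC; congr (_ * _); rewrite big_seq_cond [RHS]big_seq_cond.
  by apply: eq_bigl => j; rewrite andbT; case: eqVneq => [->|]; rewrite ?(negPf kr) ?andbT.
rewrite -[LHS]/(_ * _) mulr_sumr [LHS]big_seq [RHS]big_seq; apply: eq_bigr => i ir.
rewrite big_cons mulrCA; case: eqVneq => // E; by rewrite E ir in kr.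
Qed.

(** Jacobi's formula. *)
Lemma derive_det (R : realType) m p (A : 'rV[R]_m -> 'M[R]_p) (x v : 'rV[R]_m) :
  (forall i j, derivable (fun y => A y i j) x v) ->
  is_derive x v (fun y => \det (A y))
    (\tr (\adj (A x) *m \matrix_(i, j) 'D_v (fun y => A y i j) x)).
Proof.
move=> dA; pose A' : 'M[R]_p := \matrix_(i, j) 'D_v (fun y => A y i j) x.
have dp (s : {perm 'I_p}) : is_derive x v (fun y => \prod_i A y i (s i))
    (\sum_i A' i (s i) * \prod_(j | j != i) A x j (s j)).
  apply: is_derive_eq.
    by apply: (@is_derive_prod _ _ _ _ (fun i y => A y i (s i))) => //;
       exact: index_enum_uniq.
  by apply: eq_bigr => i _; rewrite mxE.
have dsum : is_derive x v (fun y => \det (A y))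
    (\sum_(s : {perm 'I_p}) (-1) ^+ s *
      \sum_i A' i (s i) * \prod_(j | j != i) A x j (s j)).
  have gen (S : eqType) (r : seq S) (f : S -> 'rV[R]_m -> R) (f' c : S -> R) :
      (forall s, is_derive x v (f s) (f' s)) ->
      is_derive x v (fun y => \sum_(s <- r) c s * f s y) (\sum_(s <- r) c s * f' s).
    move=> df; elim: r => [|s r IH].
      rewrite big_nil; have -> : (fun y => \sum_(s <- [::]) c s * f s y) = cst 0.
        by apply/funext => y; rewrite big_nil.
      exact: is_derive_cst.
    have -> : (fun y => \sum_(s <- s :: r) c s * f s y) =
        (c s *: f s) + (fun y => \sum_(s <- r) c s * f s y).
      by apply/funext => y; rewrite big_cons.
    by rewrite big_cons; apply: is_deriveD; exact: is_deriveZ.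
  exact: gen.
apply: is_derive_eq dsum _.
under eq_bigr => s _ do rewrite mulr_sumr.
rewrite exchange_big /mxtrace /=.
(* a determinant is differentiated one row at a time *)
pose B i : 'M[R]_p := \matrix_(k, j) (if k == i then A' k j else A x k j).
transitivity (\sum_i \det (B i)).
  apply: eq_bigr => i _; apply: eq_bigr => s _; congr (_ * _).
  rewrite [RHS](bigD1 i) //= [X in _ = X * _]mxE eqxx; congr (_ * _); apply: eq_bigr => j ji.
  by rewrite mxE (negPf ji).
transitivity (\sum_i \sum_j A' i j * cofactor (A x) i j).
  apply: eq_bigr => i _; rewrite (expand_det_row _ i); apply: eq_bigr => j _.
  rewrite mxE eqxx; congr (_ * _); rewrite /cofactor; congr (_ * \det _).
  by apply/matrixP => k l; rewrite !mxE eq_sym (negPf (neq_lift _ _)).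
rewrite exchange_big; apply: eq_bigr => j _; rewrite mxE; apply: eq_bigr => i _.
by rewrite [in RHS]mxE mulrC.
Qed.

Section Gradient.
Context {R : realType} {m : nat}.
Variables (D : set 'rV[R]_m) (oD : open D) (Gamma : @christoffel R m).
Variable G : 'rV[R]_m -> 'M[R]_m.
Hypothesis sG : forall i j, smooth_on D (fun x => G x i j).
Hypothesis G_sym : forall x, D x -> forall v w, bil (G x) v w = bil (G x) w v.
Hypothesis G_pos : forall x, D x -> forall v, v != 0 -> 0 < bil (G x) v v.
Hypothesis G_compat : forall X Y Z, smooth_map_on D X -> smooth_map_on D Y ->
  smooth_map_on D Z -> forall x, D x ->
  'D_(X x) (fun y => bil (G y) (Y y) (Z y)) x =
  bil (G x) (covariant Gamma X Y x) (Z x) + bil (G x) (Y x) (covariant Gamma X Z x).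
Hypothesis T_skew : forall x, D x -> forall v w z,
  bil (G x) (torsion Gamma x v w) z = - bil (G x) (torsion Gamma x v z) w.
Implicit Types (x v w z : 'rV[R]_m) (X Y Z : 'rV[R]_m -> 'rV[R]_m).

Local Notation chris := (chris Gamma).
Local Notation torsion := (torsion Gamma).

Lemma metric_det_gt0 x : D x -> 0 < \det (G x).
Proof.
move=> Dx; have [P oP] := orthonormal_frame_exists (trmx_bil_sym (G_sym Dx)) (G_pos Dx).
have /(congr1 determinant) := oP; rewrite !det_mulmx det_tr det1 => E.
have dP : \det P != 0.
  by apply/eqP => d0; move: E; rewrite d0 mul0r mul0r => /esym/eqP; rewrite oner_eq0.
have : 0 < (\det P ^+ 2) * \det (G x).
  by rewrite expr2 mulrAC E.
by rewrite pmulr_rgt0 // lt_def sqrf_eq0 dP sqr_ge0.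
Qed.

Lemma metric_unit x : D x -> G x \in unitmx.
Proof. by move=> Dx; rewrite unitmxE unitfE gt_eqF // metric_det_gt0. Qed.

Lemma invmx_metric_sym x : D x -> (invmx (G x))^T = invmx (G x).
Proof. by move=> Dx; rewrite trmx_inv trmx_bil_sym //; exact: G_sym. Qed.

(** Parseval's identity for the orthonormal frame. *)
Lemma parseval x P w : orthonormal_frame (G x) P -> D x ->
  bil (G x) w w = \sum_b bil (G x) w (row b P) ^+ 2.
Proof.
move=> oP Dx; have hG := frame_gram oP.
have -> : bil (G x) w w = ((w *m G x *m P^T) *m (w *m G x *m P^T)^T) 0 0.
  rewrite !trmx_mul trmxK (trmx_bil_sym (G_sym Dx)) /bil.
  rewrite -!mulmxA (mulmxA P^T) (mulmxA (G x) (P^T *m P)) hG mul1mx.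
  by rewrite !mulmxA.
rewrite mxE; apply: eq_bigr => b _; rewrite [X in _ * X]mxE -expr2; congr (_ ^+ 2).
by rewrite /bil !mxE; apply: eq_bigr => k _; rewrite !mxE.
Qed.

(** By Jacobi's formula the logarithmic derivative of the determinant is
    [tr (G^-1 dG)], and metric compatibility writes [dG] as [C G + G C^T] with [C]
    the connection matrix. *)
Lemma derive_sqrt_det x v : D x ->
  is_derive x v (fun y => Num.sqrt (\det (G y)))
    (Num.sqrt (\det (G x)) * endo_trace (chris x v)).
Proof.
move=> Dx.
have d0 := metric_det_gt0 Dx.
have dG i j : derivable (fun y => G y i j) x v by exact: (smooth_on_derivable oD (sG i j) Dx).
pose C : 'M[R]_m := \matrix_(i, j) chris x v (delta_mx 0 i) 0 j.
have EC : \matrix_(i, j) 'D_v (fun y => G y i j) x = C *m G x + G x *m C^T.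
  apply/matrixP => i j; rewrite !mxE.
  rewrite (@eq_derive_on _ _ _ oD _ _ (fun y =>
    bil (G y) (cst (delta_mx 0 i) y) (cst (delta_mx 0 j) y))) //; last first.
    by move=> y _; rewrite bil_delta.
  rewrite (derive_bil G_compat v (smooth_map_cst D _) (smooth_map_cst D _) Dx).
  rewrite !covariant_cst /=; congr (_ + _).
    by rewrite /bil trmx_delta -colE !mxE; apply: eq_bigr => k _; rewrite !mxE.
  by rewrite /bil -rowE mxE; apply: eq_bigr => k _; rewrite !mxE.
have trC : \tr C = endo_trace (chris x v) by apply: eq_bigr => i _; rewrite mxE.
have Ddet : 'D_v (fun y => \det (G y)) x = 2 * \det (G x) * endo_trace (chris x v).
  have [_ ->] := derive_det dG; rewrite EC mulmxDr mxtraceD mulmxA mxtrace_mulC.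
  rewrite mulmxA mul_mx_adj mulmxA mul_adj_mx !mul_scalar_mx !mxtraceZ mxtrace_tr trC.
  by rewrite -mulr2n mulr_natl mulrnAl.
have sdet : smooth_on D (fun y => \det (G y)) by exact: (smooth_on_det oD).
have difdet := smooth_on_differentiable oD sdet Dx.
have [dsq dsqE] := is_derive1_sqrt d0.
have difsq : differentiable (Num.sqrt : R -> R) (\det (G x)) by apply/derivable1_diffP.
have E : (fun y => Num.sqrt (\det (G y))) = Num.sqrt \o (fun y => \det (G y)) by [].
rewrite E; apply: DeriveDef.
  by apply: diff_derivable; exact: differentiable_comp.
rewrite deriveE; last exact: differentiable_comp.
rewrite diff_comp // (deriv1E dsq) /= derive1E dsqE.
rewrite -(deriveE v difdet) Ddet.
set s := Num.sqrt _; have s0 : s != 0 by rewrite gt_eqF // sqrtr_gt0.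
have sE : \det (G x) = s ^+ 2 by rewrite sqr_sqrtr // ltW.
by rewrite sE -[LHS]/(_ * _); field.
Qed.

(** The divergence of the connection is therefore that of the Levi-Civita
    connection. *)
Lemma torsion_trace x w : D x -> endo_trace (torsion x w) = 0.
Proof.
move=> Dx; have [P oP] := orthonormal_frame_exists (trmx_bil_sym (G_sym Dx)) (G_pos Dx).
rewrite -(frame_trace oP (torsion_linearr Gamma x w)) big1 // => a _.
by have := T_skew Dx w (row a P) (row a P) => h; lra.
Qed.

Variable u : 'rV[R]_m -> R.
Hypothesis su : smooth_on D u.

Definition gradient y : 'rV[R]_m := (\row_j partial j u y) *m invmx (G y).

Lemma smooth_gradient : smooth_map_on D gradient.
Proof.
move=> j; apply: (@smooth_on_ext _ _ _ oD
  (fun y => \sum_k partial k u y * invmx (G y) k j)).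
  by move=> y _; rewrite mxE; apply: eq_bigr => k _; rewrite mxE.
apply: (smooth_on_sum oD) => k _; apply: (smooth_on_mul oD).
  exact: smooth_on_partial.
by apply: (smooth_on_invmx oD) => // y; exact: metric_unit.
Qed.

Lemma bil_gradient x v : D x -> bil (G x) (gradient x) v = 'D_v u x.
Proof.
move=> Dx; rewrite /bil /gradient mulmxKV ?metric_unit // mxE.
rewrite derive_sum_partials; last exact: (smooth_on_differentiable oD su Dx).
by apply: eq_bigr => k _; rewrite !mxE mulrC.
Qed.

(** The derivative of the density produces the trace of [w |-> nabla_X w], whereas
    the divergence involves [w |-> nabla_w X]; they differ by the trace of the
    torsion, which is zero. *)
Lemma laplace_gradient x : D x ->
  laplace_de_rham G (form0 u) x [::] = - divergence Gamma gradient x.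
Proof.
move=> Dx; pose sq y := Num.sqrt (\det (G y)).
have VE t y : D y -> sq y * (\sum_j invmx (G y) t j * partial j u y) = sq y * gradient y 0 t.
  move=> Dy; congr (_ * _); rewrite mxE; apply: eq_bigr => j _.
  by rewrite mxE mulrC -{1}(invmx_metric_sym Dy) mxE.
have dgr t v y : D y -> derivable (fun y => gradient y 0 t) y v.
  by move=> Dy; exact: (smooth_on_derivable oD (smooth_gradient t) Dy).
have dV t v y : D y -> is_derive y v (fun y => sq y * gradient y 0 t)
    (sq y * 'D_v (fun y => gradient y 0 t) y + gradient y 0 t * (sq y * endo_trace (chris y v))).
  move=> Dy; have h1 := derive_sqrt_det v Dy; have h2 := derivableP (dgr t v y Dy).
  exact: (is_deriveM h1 h2).
have nearV t y : D y -> \near y, sq y * gradient y 0 t =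
    sq y * (\sum_j invmx (G y) t j * partial j u y).
  by move=> Dy; apply: (eq_near_open oD Dy) => z Dz; rewrite VE.
rewrite (laplace_de_rham_form0 oD Dx) => [|t v y Dy]; last first.
  by case: (near_eq_is_derive (nearV t y Dy) (dV t v y Dy)).
congr (- _).
have dV' t : partial t (fun y => sq y * (\sum_j invmx (G y) t j * partial j u y)) x =
    sq x * ('D_(delta_mx 0 t) gradient x 0 t +
      gradient x 0 t * endo_trace (chris x (delta_mx 0 t))).
  rewrite /partial (@eq_derive_on _ _ _ oD _ _ (fun y => sq y * gradient y 0 t)) //; last first.
    by move=> y Dy; rewrite VE.
  have [_ ->] := dV t (delta_mx 0 t) x Dx.
  by rewrite (derive_coord oD _ _ smooth_gradient Dx) mulrDr [gradient x 0 t * _]mulrCA.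
rewrite (eq_bigr _ (fun t _ => dV' t)) -mulr_sumr.
have d0 := metric_det_gt0 Dx.
have -> : Num.sqrt (\det (G x)) * \det (invmx (G x)) = (sq x)^-1.
  rewrite det_inv -/(sq x); have : \det (G x) = sq x ^+ 2 by rewrite sqr_sqrtr // ltW.
  have : sq x != 0 by rewrite gt_eqF // sqrtr_gt0.
  by move=> s0 ->; field.
rewrite mulKf; last by rewrite gt_eqF // sqrtr_gt0.
rewrite big_split /=.
have -> : \sum_t gradient x 0 t * endo_trace (chris x (delta_mx 0 t)) =
    endo_trace (chris x (gradient x)).
  rewrite /endo_trace; under eq_bigr => t _ do rewrite mulr_sumr.
  rewrite exchange_big; apply: eq_bigr => k _.
  rewrite (linear_expand (gradient x) (chris_linearl Gamma x _)) summxE.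
  by apply: eq_bigr => t _; rewrite [RHS]mxE.
have := torsion_trace (gradient x) Dx.
rewrite (eq_endo_trace (torsionE Gamma x (gradient x))) endo_traceB => /subr0_eq ->.
rewrite /endo_trace /divergence -big_split; apply: eq_bigr => k _.
by rewrite /covariant mxE.
Qed.

End Gradient.

(** * The estimate at a maximum *)

(** The auxiliary function of the maximum principle: its gradient is
    [2 *: (nabla_X X + c u X)] with [X] the gradient of [u], so that the Bochner
    identity applies to it. *)
Definition energy (R : realType) (m : nat) (G : 'rV[R]_m -> 'M[R]_m)
    (u : 'rV[R]_m -> R) (c : R) (y : 'rV[R]_m) : R :=
  bil (G y) (gradient G u y) (gradient G u y) + c * u y ^+ 2.

Section MaximumEstimate.
Context {R : realType} {m : nat}.
Variables (D : set 'rV[R]_m) (oD : open D) (Gamma : @christoffel R m).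
Hypothesis sGamma : forall i j, smooth_map_on D (fun x => Gamma x i j).
Variable G : 'rV[R]_m -> 'M[R]_m.
Hypothesis sG : forall i j, smooth_on D (fun x => G x i j).
Hypothesis G_sym : forall x, D x -> forall v w, bil (G x) v w = bil (G x) w v.
Hypothesis G_pos : forall x, D x -> forall v, v != 0 -> 0 < bil (G x) v v.
Hypothesis G_compat : forall X Y Z, smooth_map_on D X -> smooth_map_on D Y ->
  smooth_map_on D Z -> forall x, D x ->
  'D_(X x) (fun y => bil (G y) (Y y) (Z y)) x =
  bil (G x) (covariant Gamma X Y x) (Z x) + bil (G x) (Y x) (covariant Gamma X Z x).
Hypothesis T_skew : forall x, D x -> forall v w z,
  bil (G x) (torsion Gamma x v w) z = - bil (G x) (torsion Gamma x v z) w.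
Variable u : 'rV[R]_m -> R.
Hypothesis su : smooth_on D u.
Implicit Types (x v w z : 'rV[R]_m) (X Y Z : 'rV[R]_m -> 'rV[R]_m).

Local Notation chris := (chris Gamma).
Local Notation torsion := (torsion Gamma).
Local Notation X := (gradient G u).

Let sX : smooth_map_on D X.
Proof. exact: smooth_gradient. Qed.

Let bilX x v : D x -> bil (G x) (X x) v = 'D_v u x.
Proof. by move=> Dx; exact: (bil_gradient oD G_sym G_pos su). Qed.

(** The Hessian of a function with respect to a connection with torsion is
    symmetric up to the torsion, because the second derivatives commute. *)
Lemma hessian_sym x v w : D x ->
  bil (G x) (covariant Gamma (cst v) X x) w - bil (G x) (covariant Gamma (cst w) X x) v
  = - bil (G x) (X x) (torsion x v w).
Proof.
move=> Dx.
have H a b : 'D_a (fun y => 'D_b u y) x =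
    bil (G x) (covariant Gamma (cst a) X x) b + bil (G x) (X x) (chris x a b).
  rewrite -(covariant_cst Gamma (cst a) b x).
  rewrite -(derive_bil G_compat a sX (smooth_map_cst D b) Dx).
  by apply: (eq_derive_on oD) => // y Dy; rewrite -bilX.
have := deriveC v w oD su Dx; rewrite !H torsionE bilBr => h; lra.
Qed.

(** The adjoint of the endomorphism [v |-> nabla_v X] is
    [v |-> nabla_v X - T(v, X)]. *)
Lemma hessian_adjoint x v w : D x ->
  bil (G x) (covariant Gamma (cst v) X x - torsion x v (X x)) w =
  bil (G x) (covariant Gamma (cst w) X x) v.
Proof.
move=> Dx; have := hessian_sym v w Dx; rewrite bilBl (T_skew Dx) (G_sym Dx (X x)).
by move=> h; lra.
Qed.

(** Half the gradient of [|X|^2] is [nabla_X X], as for the Levi-Civita connection: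
    the torsion term of the Hessian vanishes when paired with [X]. *)
Lemma derive_gradient_norm x v : D x ->
  'D_v (fun y => bil (G y) (X y) (X y)) x = 2 * bil (G x) (covariant Gamma X X x) v.
Proof.
move=> Dx; rewrite (derive_bil G_compat v sX sX Dx) (G_sym Dx (X x)).
have -> : bil (G x) (covariant Gamma (cst v) X x) (X x) =
    bil (G x) (covariant Gamma X X x) v.
  have := hessian_sym v (X x) Dx; rewrite (G_sym Dx (X x)).
  have := T_skew Dx v (X x) (X x) => h1 h2.
  rewrite -[covariant Gamma X X x]/(covariant Gamma (cst (X x)) X x).
  lra.
by ring.
Qed.

(** By adjointness, the last term of the Bochner identity is the squared norm of
    the Hessian, which bounds the square of its trace. *)
Lemma hessian_trace_ge x : D x ->
  divergence Gamma X x ^+ 2 <= m%:R * endo_trace (fun v => covariant Gamma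
    (cst (covariant Gamma (cst v) X x - torsion x v (X x))) X x).
Proof.
move=> Dx; have [P oP] := orthonormal_frame_exists (trmx_bil_sym (G_sym Dx)) (G_pos Dx).
pose N v := covariant Gamma (cst v) X x.
pose Na v := covariant Gamma (cst v) X x - torsion x v (X x).
have lN : linear N by exact: (covariant_linear oD Gamma sX Dx).
have lNa : linear Na.
  move=> k v w; have E1 : N (k *: v + w) = k *: N v + N w by exact: lN.
  have E2 := torsion_linearl Gamma x (X x) k v w.
  rewrite /Na -!/(N _) E1 E2; move: (N v) (N w) (torsion x v _) (torsion x w _).
  by move=> p q r s; rewrite scalerBr opprD addrACA.
have adj v w : bil (G x) (Na v) w = bil (G x) (N w) v by exact: hessian_adjoint.
pose H : 'M[R]_m := \matrix_(a, b) bil (G x) (Na (row a P)) (row b P).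
have trH : \tr H = divergence Gamma X x.
  rewrite /divergence -(frame_trace oP lN); apply: eq_bigr => a _.
  by rewrite mxE adj.
have lNN : linear (fun v => N (Na v)).
  by move=> k v w; rewrite (lNa k v w); exact: (lN k (Na v) (Na w)).
have -> : endo_trace (fun v => covariant Gamma
    (cst (covariant Gamma (cst v) X x - torsion x v (X x))) X x) =
    \sum_i \sum_j H i j ^+ 2.
  rewrite -(frame_trace oP lNN); apply: eq_bigr => a _.
  rewrite -adj (parseval G_sym _ oP Dx); apply: eq_bigr => b _.
  by rewrite mxE.
by rewrite -trH; exact: sqr_trace_le.
Qed.

Variables (lambda c K : R).
Hypothesis eigen : forall y, D y -> divergence Gamma X y = - (lambda * u y).

Local Notation F := (energy G u c).

Let Z y := covariant Gamma X X y + (c * u y) *: X y.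

Let sZ : smooth_map_on D Z.
Proof.
apply: (smooth_map_add oD); first exact: (smooth_covariant_field oD sGamma sX sX).
by apply: (smooth_map_scale oD _ sX); apply: (smooth_on_mul oD) => //; exact: smooth_on_cst.
Qed.

Let scu : smooth_on D (fun y => c * u y).
Proof. by apply: (smooth_on_mul oD) => //; exact: smooth_on_cst. Qed.

Let derive_F x v : D x -> 'D_v F x = 2 * bil (G x) (Z x) v.
Proof.
move=> Dx; have sXX : smooth_on D (fun y => bil (G y) (X y) (X y)) by exact: smooth_bil.
have suu : smooth_on D (fun y => u y * u y) by exact: (smooth_on_mul oD).
have scuu : smooth_on D (fun y => c * (u y * u y)).
  by apply: (smooth_on_mul oD) suu; exact: smooth_on_cst.
have -> : F = (fun y => bil (G y) (X y) (X y)) + (fun y => c * (u y * u y)).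
  by apply/funext => y; rewrite /energy expr2.
rewrite deriveD; [|exact: (smooth_on_derivable oD sXX Dx)|
  exact: (smooth_on_derivable oD scuu Dx)].
rewrite derive_gradient_norm //.
rewrite (derive_mul_on oD v (smooth_on_cst D c) suu Dx) derive_cst mul0r add0r.
rewrite (derive_mul_on oD v su su Dx) /Z (bilDl _ (covariant Gamma X X x)) bilZl bilX //.
by ring.
Qed.

Lemma smooth_energy : smooth_on D F.
Proof.
apply: (smooth_on_add oD); first exact: smooth_bil.
apply: (smooth_on_mul oD) (smooth_on_cst D c) _.
by apply: (@smooth_on_ext _ _ _ oD (fun y => u y * u y)) => [y _|];
   [rewrite expr2|exact: (smooth_on_mul oD)].
Qed.

(** At a maximum of [F], its half gradient [Z] vanishes and has nonpositive
    divergence, while the Bochner identity bounds this divergence from below. *)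
Lemma maximum_estimate x : D x -> (forall y, D y -> F y <= F x) -> (0 < m)%N ->
  (m%:R - 1) * K * bil (G x) (X x) (X x) <= ricci Gamma x (X x) (X x) ->
  (lambda / m%:R - c) * lambda * u x ^+ 2 +
    ((m%:R - 1) * K - lambda + c) * bil (G x) (X x) (X x) <= 0.
Proof.
move=> Dx Fmax m0 ric.
(* the gradient [2 *: Z x] of the energy vanishes at a maximum *)
have Z0 : Z x = 0.
  apply/eqP; apply/negP => /negP/(G_pos Dx).
  have := derive_at_max (Z x) oD smooth_energy Dx Fmax; rewrite derive_F // => /eqP.
  by rewrite mulf_eq0 pnatr_eq0 /= => /eqP ->; rewrite ltxx.
have nonpos v : bil (G x) (covariant Gamma (cst v) Z x) v <= 0.
  have := derive2_at_max v oD smooth_energy Dx Fmax.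
  rewrite (@eq_derive_on _ _ _ oD _ _ (fun y => 2 * bil (G y) (Z y) (cst v y))) //; last first.
    by move=> y Dy; rewrite derive_F.
  have sb := smooth_bil oD sG sZ (smooth_map_cst D v).
  rewrite (derive_mul_on oD v (smooth_on_cst D 2) sb Dx) derive_cst mul0r add0r.
  by rewrite (derive_bil G_compat v sZ (smooth_map_cst D v) Dx) Z0 bil0l addr0 pmulr_rle0.
have divZ : divergence Gamma Z x <= 0.
  have [P oP] := orthonormal_frame_exists (trmx_bil_sym (G_sym Dx)) (G_pos Dx).
  rewrite /divergence -(frame_trace oP (covariant_linear oD Gamma sZ Dx)).
  by rewrite sumr_le0.
have sXX := smooth_covariant_field oD sGamma sX sX.
have : divergence Gamma Z x = divergence Gamma (covariant Gamma X X) x +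
    (c * 'D_(X x) u x + c * u x * divergence Gamma X x).
  rewrite /divergence -endo_traceZ.
  have -> : c * 'D_(X x) u x = endo_trace (fun v => 'D_v (fun y => c * u y) x *: X x).
    rewrite derive_sum_partials; last exact: (smooth_on_differentiable oD su Dx).
    rewrite mulr_sumr; apply: eq_bigr => k _; rewrite [RHS]mxE.
    rewrite (derive_mul_on oD _ (smooth_on_cst D c) su Dx) derive_cst mul0r add0r /partial.
    by rewrite mulrCA mulrC.
  rewrite -!endo_traceD; apply: eq_endo_trace => v.
  rewrite (covariant_add oD Gamma v sXX (smooth_map_scale oD scu sX) Dx).
  by rewrite (covariant_scale oD Gamma v scu sX Dx).
have := divergence_covariant_self oD sGamma sX Dx.
have -> : 'D_(X x) (divergence Gamma X) x = - lambda * bil (G x) (X x) (X x).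
  rewrite (@eq_derive_on _ _ _ oD _ _ (fun y => - lambda * u y)) //; last first.
    by move=> y Dy; rewrite eigen // mulNr.
  rewrite (derive_mul_on oD _ (smooth_on_cst D _) su Dx) derive_cst mul0r add0r.
  by rewrite -bilX.
have := hessian_trace_ge Dx; rewrite -bilX // eigen //.
move: divZ ric; move: (endo_trace _) (ricci _ _ _ _) (divergence _ Z x) => E r dZ.
move: (divergence _ _ x) (bil _ _ _) (u x) => dX q w dZ0 hr hE -> dZE.
have m0' : (0 : R) < m%:R by rewrite ltr0n.
have hE' : lambda ^+ 2 * w ^+ 2 / m%:R <= E.
  by rewrite ler_pdivrMr // -exprMn [E * _]mulrC; move: hE; rewrite sqrrN.
have -> : (lambda / m%:R - c) * lambda * w ^+ 2 =
    lambda ^+ 2 * w ^+ 2 / m%:R - c * lambda * w ^+ 2 by field; rewrite gt_eqF.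
have e1 : c * w * - (lambda * w) = - (c * lambda * w ^+ 2) by ring.
have e2 : ((m%:R - 1) * K - lambda + c) * q = (m%:R - 1) * K * q - lambda * q + c * q by ring.
rewrite e1 in dZE; rewrite e2; rewrite mulNr in dZE.
move: dZE hE' hr dZ0.
move: (lambda ^+ 2 * _ / _) (c * lambda * _) (_ * K * q) (lambda * q) (c * q).
by move=> a1 a2 a3 a4 a5; lra.
Qed.

End MaximumEstimate.

(** * The (1, 0)-part of the inverse metric *)

Section ComplexLinearAlgebra.
Context {R : realType} {n : nat}.
Local Notation C := R[i].
Local Notation rc := (real_complex R).
Local Notation cmx := (map_mx rc).
Local Notation conj_mx := (map_mx (@conjc R)).
Local Notation i_ := ('i%C : C).

Lemma sqr_imaginary : i_ * i_ = -1.
Proof. by rewrite -expr2 sqr_i. Qed.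

Lemma conj_imaginary : conjc i_ = - i_.
Proof. by apply/eqP; rewrite eq_complex /= oppr0 !eqxx. Qed.

Lemma conjcN_imaginary : conjc (- i_) = i_.
Proof. by apply/eqP; rewrite eq_complex /= oppr0 opprK !eqxx. Qed.

Lemma map_mx_bil p (G : 'M[R]_p) v w : bil (cmx G) (cmx v) (cmx w) = rc (bil G v w).
Proof. by rewrite /bil map_trmx -!map_mxM mxE. Qed.

Lemma conj_cmx p q (A : 'M[R]_(p, q)) : conj_mx (cmx A) = cmx A.
Proof. by apply/matrixP => i j; rewrite !mxE; exact: conjc_real. Qed.

Lemma conj_mxZ p q a (A : 'M[C]_(p, q)) : conj_mx (a *: A) = conjc a *: conj_mx A.
Proof. by apply/matrixP => i j; rewrite !mxE; exact: rmorphM. Qed.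

Lemma complex_row_split p (w : 'rV[C]_p) :
  w = cmx (map_mx (@complex.Re R) w) + i_ *: cmx (map_mx (@complex.Im R) w).
Proof. by apply/rowP => j; rewrite !mxE -complexE. Qed.

(** A real symmetric form is real and hermitian on complex vectors. *)
Lemma bil_conj p (G : 'M[R]_p) (a b : 'rV[R]_p) : G^T = G ->
  bil (cmx G) (cmx a + i_ *: cmx b) (conj_mx (cmx a + i_ *: cmx b)) =
  rc (bil G a a + bil G b b).
Proof.
move=> sG; rewrite map_mxD conj_mxZ !conj_cmx conj_imaginary.
rewrite !bilDl !bilDr !bilZl !bilZr !map_mx_bil.
have -> : bil G b a = bil G a b.
  have E : b *m G *m a^T = (a *m G *m b^T)^T by rewrite !trmx_mul trmxK sG mulmxA.
  by rewrite /bil E mxE.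
rewrite rmorphD /=.
move: (rc (bil G a a)) (rc (bil G a b)) (rc (bil G b b)) => p1 p2 p3.
by transitivity (p1 - (i_ * i_) * p3); [ring|rewrite sqr_imaginary; ring].
Qed.

Definition dz_mx : 'M[C]_(n, n + n) := \matrix_i dz i.

Lemma row_dz_mx i : row i dz_mx = dz i.
Proof. exact: rowK. Qed.

Lemma dz_mxE : dz_mx = 2^-1 *: row_mx 1%:M (- i_ *: 1%:M).
Proof.
apply/row_matrixP => i; rewrite row_dz_mx /dz linearZ /= row_row_mx linearZ /=.
by rewrite row1.
Qed.

Lemma conj_dz_mxE : conj_mx dz_mx = 2^-1 *: row_mx 1%:M (i_ *: 1%:M).
Proof.
by rewrite dz_mxE conj_mxZ map_row_mx conj_mxZ !map_mx1 conjcN_imaginary conjc_inv conjc_nat.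
Qed.

Lemma vec10E (W : 'rV[C]_n) : vec10 W = W *m dz_mx.
Proof.
by rewrite mulmx_sum_row; apply: eq_bigr => i _; rewrite row_dz_mx.
Qed.

Lemma cmx_J : cmx (Jstd : 'M[R]_(n + n)) = block_mx 0 1%:M (- 1%:M) 0.
Proof. by rewrite /Jstd map_block_mx map_mxN !map_mx1 !map_mx0. Qed.

(** Vectors of type (1, 0) are the eigenvectors of J with eigenvalue i. *)
Lemma dz_mx_J : dz_mx *m cmx Jstd = i_ *: dz_mx.
Proof.
rewrite cmx_J dz_mxE -scalemxAl scalerA mulrC -scalerA; congr (_ *: _).
rewrite mul_row_block !mulmx0 !mul1mx add0r addr0 mulmxN mulmx1 -scaleNr opprK.
by rewrite scale_row_mx scalerA mulrN sqr_imaginary opprK scale1r.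
Qed.

Lemma conj_dz_mx_J : conj_mx dz_mx *m cmx Jstd = - i_ *: conj_mx dz_mx.
Proof.
have := congr1 (fun A => conj_mx A) dz_mx_J.
by rewrite /= map_mxM conj_cmx conj_mxZ conj_imaginary.
Qed.

Lemma dz_mx_span (A : 'M[C]_(n + n)) :
  dz_mx *m A = dz_mx -> conj_mx dz_mx *m A = conj_mx dz_mx -> A = 1%:M.
Proof.
move=> h1 h2.
have two : (2 : C) != 0 by rewrite pnatr_eq0.
have i0 : i_ != 0.
  apply/eqP => h; have := sqr_imaginary; rewrite h mul0r => /esym/eqP.
  by rewrite oppr_eq0 oner_eq0.
have e1 : row_mx 1%:M 0 *m A = row_mx 1%:M 0 :> 'M[C]_(n, n + n).
  have -> : row_mx 1%:M 0 = dz_mx + conj_mx dz_mx.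
    rewrite conj_dz_mxE dz_mxE -scalerDr add_row_mx scaleNr addNr.
    have -> : 1%:M + 1%:M = 2 *: 1%:M :> 'M[C]_n by rewrite scalerDl scale1r.
    by rewrite scale_row_mx scaler0 scalerA mulVf // scale1r.
  by rewrite mulmxDl h1 h2.
have e2 : row_mx 0 1%:M *m A = row_mx 0 1%:M :> 'M[C]_(n, n + n).
  have -> : row_mx 0 1%:M = i_ *: (dz_mx - conj_mx dz_mx).
    rewrite conj_dz_mxE dz_mxE -scalerBr opp_row_mx add_row_mx subrr -scaleNr -scalerDl.
    rewrite scalerA scale_row_mx scaler0 scalerA; congr (row_mx _ _).
    rewrite -[LHS]scale1r; congr (_ *: _).
    have -> : i_ / 2 * (- i_ - i_) = - (i_ * i_) by field.
    by rewrite sqr_imaginary opprK.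
  by rewrite -scalemxAl mulmxBl h1 h2.
have I1 : (1%:M : 'M[C]_(n + n)) = col_mx (row_mx 1%:M 0) (row_mx 0 1%:M).
  by rewrite -block_mxEv -scalar_mx_block.
by rewrite -[LHS]mul1mx {1}I1 mul_col_mx e1 e2 -I1.
Qed.

Variable G : 'M[R]_(n + n).
Hypothesis sG : G^T = G.
Hypothesis pG : forall v, v != 0 -> 0 < bil G v v.
Hypothesis JG : forall v w, bil G (v *m Jstd) (w *m Jstd) = bil G v w.

Definition herm_mx : 'M[C]_n := dz_mx *m cmx G *m (conj_mx dz_mx)^T.

(** A hermitian form that is definite has no kernel. *)
Lemma herm_mx_unit : herm_mx \in unitmx.
Proof.
rewrite -row_free_unit -kermx_eq0; apply/rowV0P => W /sub_kermxP W0.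
pose w := W *m dz_mx.
have w0 : bil (cmx G) w (conj_mx w) = 0.
  rewrite /bil /w map_mxM trmx_mul !mulmxA -[W *m _ *m _ *m _]mulmxA.
  rewrite -!mulmxA [dz_mx *m _]mulmxA [dz_mx *m _ *m _]mulmxA -/herm_mx mulmxA.
  by rewrite W0 mul0mx mxE.
have {w0} w0 : w = 0.
  move: w0; rewrite (complex_row_split w); set a := map_mx _ w; set b := map_mx _ w.
  rewrite bil_conj // => /(congr1 (@complex.Re R)) /= h.
  have ge0 v : 0 <= bil G v v.
    by have [->|/pG/ltW//] := eqVneq v 0; rewrite bil0l.
  have z v : bil G v v = 0 -> v = 0.
    by move=> v0; apply/eqP; apply/negP => /negP/pG; rewrite v0 ltxx.
  have a0 : a = 0 by apply: z; apply/eqP; rewrite eq_le ge0 andbT; have := ge0 b; lra.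
  have b0 : b = 0 by apply: z; apply/eqP; rewrite eq_le ge0 andbT; have := ge0 a; lra.
  by rewrite a0 b0 !map_mx0 scaler0 addr0.
move: w0; rewrite /w dz_mxE -scalemxAr mul_mx_row mulmx1 => /eqP.
rewrite scaler_eq0 invr_eq0 pnatr_eq0 /= row_mx_eq0 => /andP[/eqP //].
Qed.

Lemma JG_mx : Jstd *m G *m Jstd^T = G.
Proof.
by apply/matrixP => i j; rewrite -bil_mulmx !rowE JG bil_delta.
Qed.

(** [J] acts on both arguments by the eigenvalue i, and it is an isometry, so the
    pairing equals its opposite. *)
Lemma dz_isotropic : dz_mx *m cmx G *m dz_mx^T = 0.
Proof.
have E : dz_mx *m cmx G *m dz_mx^T = - (dz_mx *m cmx G *m dz_mx^T).
  rewrite -{1}JG_mx !map_mxM -map_trmx !mulmxA dz_mx_J -!mulmxA -trmx_mul dz_mx_J.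
  rewrite linearZ /= -!scalemxAr -!scalemxAl scalerA sqr_imaginary scaleN1r.
  by rewrite !mulmxA.
move/eqP: E; rewrite -addr_eq0; move: (dz_mx *m _ *m _) => Q.
have -> : Q + Q = 2 *: Q by rewrite scalerDl scale1r.
by rewrite scaler_eq0 pnatr_eq0 /= => /eqP.
Qed.

Lemma conj_dz_isotropic : conj_mx dz_mx *m cmx G *m (conj_mx dz_mx)^T = 0.
Proof.
have := congr1 (fun A => conj_mx A) dz_isotropic.
by rewrite /= !map_mxM conj_cmx map_trmx map_mx0.
Qed.

(** The component of the inverse metric in T^{1,0} (x) T^{0,1}. *)
Definition inv10 : 'M[C]_(n + n) := dz_mx^T *m (invmx herm_mx)^T *m conj_mx dz_mx.

(** The two sides agree after multiplication by the metric on vectors of type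
    (1, 0) and (0, 1), and these span. *)
Lemma inv10D : inv10 + inv10^T = cmx (invmx G).
Proof.
have uh := herm_mx_unit.
have GE : cmx G *m (inv10 + inv10^T) = 1%:M.
  have inv10T : inv10^T = (conj_mx dz_mx)^T *m invmx herm_mx *m dz_mx.
    by rewrite /inv10 !trmx_mul !trmxK mulmxA.
  have hT : conj_mx dz_mx *m cmx G *m dz_mx^T = herm_mx^T.
    by rewrite /herm_mx !trmx_mul trmxK map_trmx sG mulmxA.
  apply: dz_mx_span; rewrite mulmxA mulmxDr inv10T /inv10 !mulmxA.
    rewrite dz_isotropic !mul0mx add0r -/herm_mx mulmxV // mul1mx //.
  rewrite conj_dz_isotropic !mul0mx addr0 hT -trmx_mul mulVmx // trmx1 mul1mx //.
have : G \in unitmx.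
  have : cmx G \in unitmx by case: (mulmx1_unit GE).
  by rewrite map_unitmx.
move=> uG; rewrite -[LHS]mul1mx -(mulVmx (_ : cmx G \in unitmx)) ?map_unitmx //.
by rewrite -mulmxA GE mulmx1 map_invmx.
Qed.

Lemma J_inv10 : (cmx Jstd)^T *m inv10 = i_ *: inv10.
Proof. by rewrite /inv10 !mulmxA -trmx_mul dz_mx_J linearZ /= -!scalemxAl. Qed.

Lemma inv10_J : inv10 *m cmx Jstd = - i_ *: inv10.
Proof. by rewrite /inv10 -!mulmxA conj_dz_mx_J -!scalemxAr. Qed.

(** [inv10] is the image of the inverse metric under the projection to type
    (1, 0) in the first factor. *)
Lemma inv10E : inv10 = 2^-1 *: (cmx (invmx G) - i_ *: cmx (Jstd^T *m invmx G)).
Proof.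
have two : (2 : C) != 0 by rewrite pnatr_eq0.
have T : (cmx Jstd)^T *m inv10^T = - i_ *: inv10^T.
  by rewrite -trmx_mul inv10_J linearZ.
rewrite map_mxM -map_trmx -inv10D mulmxDr J_inv10 T.
rewrite [i_ *: (_ + _)]scalerDr !scalerA mulrN sqr_imaginary.
rewrite opprK scale1r scaleN1r opprD opprK addrACA subrr addr0.
have -> : inv10 + inv10 = 2 *: inv10 by rewrite scalerDl scale1r.
by rewrite scalerA mulVf // scale1r.
Qed.

(** Raising the index of a real covector with the (1, 0)-part of the inverse metric
    gives the (1, 0)-part of the vector obtained with the full one. *)
Lemma inv10_tr_row (p : 'rV[R]_(n + n)) :
  cmx p *m inv10^T =
  2^-1 *: (cmx (p *m invmx G) - i_ *: cmx (p *m invmx G *m Jstd)).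
Proof.
have hT : (invmx G)^T = invmx G by rewrite trmx_inv sG.
rewrite inv10E linearZ /= -scalemxAr; congr (_ *: _).
rewrite linearB linearZ /= !map_trmx trmx_mul trmxK hT mulmxBr -scalemxAr.
by rewrite -!map_mxM mulmxA.
Qed.

End ComplexLinearAlgebra.

(** * Holomorphic Ricci curvature of the gradient *)

Lemma Re_sum (R : realType) (I : Type) (r : seq I) (F : I -> R[i]) :
  complex.Re (\sum_(k <- r) F k) = \sum_(k <- r) complex.Re (F k).
Proof. by apply: (big_morph (@complex.Re R)) => // -[a b] [c d]. Qed.

(** The contribution of one index quadruple to the holomorphic Ricci curvature;
    [h] and [s] are entries of the inverse metric and of its image under [J], and
    [r] is a component of the real curvature tensor. *)
Lemma Re_inv10_term (R : realType) (h s xb yb xc yc r : R) :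
  complex.Re (2^-1 * (h%:C%C - 'i%C * s%:C%C) * (2^-1 * (xb%:C%C + 'i%C * yb%:C%C)) *
    (2^-1 * (xc%:C%C - 'i%C * yc%:C%C)) * r%:C%C) =
  8^-1 * (h * xb * xc * r + h * yb * yc * r + s * yb * xc * r - s * xb * yc * r).
Proof.
have -> : (2^-1 : R[i]) = (2^-1)%:C%C by rewrite fmorphV /= rmorph_nat.
by simpc => /=; field.
Qed.

Section HolomorphicRicci.
Context {R : realType} {n : nat} {M : complexManifold R n}.
Variables (g : hermitianMetric M) (nabla : affineConnection M).
Variables (a : chart M) (x : 'rV[R]_(n + n)).
Hypothesis ax : chart_img a x.
Local Notation C := R[i].
Local Notation rc := (real_complex R).
Local Notation cmx := (map_mx rc).
Local Notation conj_mx := (map_mx (@conjc R)).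
Local Notation i_ := ('i%C : C).
Local Notation G := (g a x).

Let sG : G^T = G.
Proof. by apply: trmx_bil_sym; move=> v w; exact: (Defs.metric_sym g ax). Qed.

Lemma herm_mxE : herm g a x = herm_mx G.
Proof.
apply/matrixP => i j; rewrite mxE -bil_mulmx row_dz_mx; congr (bil _ _ _).
by rewrite -map_row /dzbar /conj_vec -row_dz_mx.
Qed.

Variable u : M -> R.
Let p : 'rV[R]_(n + n) := \row_j partial j (u \o param a) x.
Let X : 'rV[R]_(n + n) := p *m invmx G.
Let Y := X *m Jstd.

Lemma grad10E : grad10 g u a x = cmx p *m (conj_mx dz_mx)^T *m invmx (herm_mx G).
Proof.
apply/rowP => i; rewrite mxE [RHS]mxE; apply: eq_bigr => k _.
rewrite /herm_inv herm_mxE mxE mulrC; congr (_ * _).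
rewrite conj_dz_mxE linearZ /= -scalemxAr [RHS]mxE /partial_zbar; congr (_ * _).
rewrite tr_row_mx linearZ /= trmx1 -[cmx p]hsubmxK mul_row_col mulmx1 -scalemxAr mulmx1.
by rewrite !mxE.
Qed.

(** [U] is the (1, 0)-part of the Riemannian gradient. *)
Lemma vec10_grad10 : vec10 (grad10 g u a x) = 2^-1 *: (cmx X - i_ *: cmx Y).
Proof.
rewrite vec10E grad10E -(inv10_tr_row sG (metric_pos g ax) (metric_J g ax) p) /inv10.
by rewrite !trmx_mul !trmxK !mulmxA.
Qed.

Lemma conj_vec10_grad10 :
  conj_vec (vec10 (grad10 g u a x)) = 2^-1 *: (cmx X + i_ *: cmx Y).
Proof.
rewrite vec10_grad10 -scaleNr; transitivity (conj_mx (2^-1 *: (cmx X + - i_ *: cmx Y))) => //.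
by rewrite conj_mxZ map_mxD conj_mxZ !conj_cmx conjcN_imaginary conjc_inv conjc_nat.
Qed.

Lemma Re_norm2_grad10 : complex.Re (norm2 g a x (grad10 g u a x)) = 2^-1 * bil G X X.
Proof.
set W := grad10 g u a x.
have -> : norm2 g a x W = bil (cmx G) (vec10 W) (conj_mx (vec10 W)).
  rewrite vec10E /bil map_mxM trmx_mul mulmxA.
  have -> : W *m dz_mx *m cmx G *m (conj_mx dz_mx)^T = W *m herm_mx G by rewrite !mulmxA.
  rewrite /norm2 herm_mxE [RHS]mxE exchange_big; apply: eq_bigr => j _.
  rewrite [in RHS]mxE mulr_suml; apply: eq_bigr => i _.
  by rewrite [herm_mx G i j * W 0 i]mulrC; congr (_ * _); rewrite !mxE.
have -> : vec10 W = cmx (2^-1 *: X) + i_ *: cmx (- 2^-1 *: Y).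
  rewrite vec10_grad10 !map_mxZ /= rmorphN /= fmorphV /= rmorph_nat.
  by rewrite scalerBr !scalerA mulrN scaleNr [2^-1 * i_]mulrC.
rewrite bil_conj //= !bilZl !bilZr (metric_J g ax).
by field.
Qed.

Local Notation curv := (curv (nabla a)).
Local Notation Rm := (curv_real g nabla a x).
Local Notation e := (fun i => delta_mx 0 i : 'rV[R]_(n + n)).

Lemma curv_bilinear_expand (i : 'I_(n + n)) (v w : 'rV[R]_(n + n)) :
  curv x (e i) v w = \sum_j \sum_k (v 0 j * w 0 k) *: curv x (e i) (e j) (e k).
Proof.
have oD : open (chart_img a) by exact: chart_img_open.
have sGam := @connection_smooth _ _ _ nabla a.
rewrite (linear_expand v (curv_linear2 oD sGam (e i) w ax)); apply: eq_bigr => j _.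
rewrite (linear_expand w (curv_linear3 oD sGam (e i) (e j) ax)) scaler_sumr.
by apply: eq_bigr => k _; rewrite scalerA.
Qed.

(** The contraction of the curvature with the inverse metric, with one of the two
    contracted slots transformed by [A]; it is needed for the identity and for the
    complex structure. *)
Lemma sum_curv_real (A : 'M[R]_(n + n)) (v w : 'rV[R]_(n + n)) :
  \sum_i \sum_l \sum_j \sum_k (A^T *m invmx G) i l * v 0 j * w 0 k * Rm i j k l =
  endo_trace (fun z => curv x z v w *m A).
Proof.
have uG : G \in unitmx.
  have [P oP] := orthonormal_frame_exists sG (metric_pos g ax).
  by case: (mulmx1_unit (frame_gram oP)).
apply: eq_bigr => i _.
transitivity (\sum_l (A^T *m invmx G) i l * bil G (curv x (e i) v w) (e l)).
  apply: eq_bigr => l _; rewrite curv_bilinear_expand bil_suml mulr_sumr.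
  apply: eq_bigr => j _; rewrite bil_suml mulr_sumr; apply: eq_bigr => k _.
  by rewrite bilZl !mulrA.
have hT : (invmx G)^T = invmx G by rewrite trmx_inv sG.
transitivity ((curv x (e i) v w *m G *m (A^T *m invmx G)^T) 0 i).
  rewrite [RHS]mxE; apply: eq_bigr => l _; rewrite mulrC; congr (_ * _).
    by rewrite /bil trmx_delta -colE mxE.
  by rewrite [RHS]mxE.
by rewrite trmx_mul trmxK hT !mulmxA mulmxK.
Qed.

(** The sum over the complex indices only depends on the bivector
    [h^{i lbar} d/dz^i (x) d/dzbar^l], which is [inv10]. *)
Lemma holomorphic_ricciE W :
  holomorphic_ricci g nabla a x W =
  \sum_i \sum_l inv10 G i l * \sum_j \sum_k
    conj_vec (vec10 W) 0 j * vec10 W 0 k * rc (Rm i j k l).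
Proof.
rewrite /holomorphic_ricci; move: (vec10 W) => w; move: (conj_vec w) => wb.
pose B i l : C := \sum_j \sum_k wb 0 j * w 0 k * rc (Rm i j k l).
have hE i l : herm_inv g a x i l * curv_complex g nabla a x (dz i) wb w (dzbar l) =
    \sum_c \sum_d (dz_mx^T c i * (invmx (herm_mx G))^T i l * conj_mx dz_mx l d) * B c d.
  have dE c : dz i 0 c = dz_mx^T c i by rewrite -row_dz_mx mxE [RHS]mxE.
  have dbE d : dzbar l 0 d = conj_mx dz_mx l d.
    by rewrite mxE -row_dz_mx [RHS]mxE; congr conjc; rewrite mxE.
  have -> : herm_inv g a x i l = (invmx (herm_mx G))^T i l by rewrite /herm_inv herm_mxE.
  rewrite /curv_complex mulr_sumr; apply: eq_bigr => c _.
  transitivity ((invmx (herm_mx G))^T i l * \sum_d \sum_j \sum_k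
      dz i 0 c * wb 0 j * w 0 k * dzbar l 0 d * rc (Rm c j k d)).
    congr (_ * _); rewrite [RHS]exchange_big; apply: eq_bigr => j _.
    exact: exchange_big.
  rewrite mulr_sumr; apply: eq_bigr => d _; rewrite dE dbE /B !mulr_sumr.
  apply: eq_bigr => j _; rewrite !mulr_sumr; apply: eq_bigr => k _.
  have E (h d1 b b' d2 r : C) : h * (d1 * b * b' * d2 * r) = d1 * h * d2 * (b * b' * r).
    by ring.
  exact: E.
transitivity (\sum_c \sum_d \sum_l \sum_i
    (dz_mx^T c i * (invmx (herm_mx G))^T i l * conj_mx dz_mx l d) * B c d).
  transitivity (\sum_i \sum_l \sum_c \sum_d
      (dz_mx^T c i * (invmx (herm_mx G))^T i l * conj_mx dz_mx l d) * B c d).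
    by apply: eq_bigr => i _; apply: eq_bigr => l _; exact: hE.
  under eq_bigr => i _ do rewrite exchange_big.
  rewrite exchange_big; apply: eq_bigr => c _.
  under eq_bigr => i _ do rewrite exchange_big.
  by rewrite exchange_big; apply: eq_bigr => d _; rewrite exchange_big.
apply: eq_bigr => c _; apply: eq_bigr => d _; rewrite -/(B c d) /inv10 mxE mulr_suml.
by apply: eq_bigr => l _; rewrite [(_ *m _) c l]mxE !mulr_suml.
Qed.

(** Expansion of the complex multilinear curvature at
    [U = (X - i J X) / 2], the inverse metric being projected to type (1, 0) as
    well; the imaginary part of the sum is discarded. *)
Lemma Re_holomorphic_ricci_grad10 :
  complex.Re (holomorphic_ricci g nabla a x (grad10 g u a x)) =
  8^-1 * (endo_trace (fun z => curv x z X X) + endo_trace (fun z => curv x z Y Y)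
   + endo_trace (fun z => curv x z Y X *m Jstd)
   - endo_trace (fun z => curv x z X Y *m Jstd)).
Proof.
have E (v w : 'rV[R]_(n + n)) : endo_trace (fun z => curv x z v w) =
    endo_trace (fun z => curv x z v w *m 1%:M).
  by apply: eq_bigr => i _; rewrite mulmx1.
rewrite holomorphic_ricciE conj_vec10_grad10 vec10_grad10 !E -!sum_curv_real.
rewrite trmx1 mul1mx Re_sum -!big_split /= -sumrB mulr_sumr; apply: eq_bigr => i _.
rewrite Re_sum -!big_split /= -sumrB mulr_sumr; apply: eq_bigr => l _.
rewrite mulr_sumr Re_sum -!big_split /= -sumrB mulr_sumr; apply: eq_bigr => j _.
rewrite mulr_sumr Re_sum -!big_split /= -sumrB mulr_sumr; apply: eq_bigr => k _.
rewrite -Re_inv10_term; congr (complex.Re _).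
have -> : inv10 G i l = 2^-1 * (rc (invmx G i l) - i_ * rc ((Jstd^T *m invmx G) i l)).
  by rewrite (inv10E sG (metric_pos g ax) (metric_J g ax)) !mxE.
have -> : (2^-1 *: (cmx X + i_ *: cmx Y)) 0 j = 2^-1 * (rc (X 0 j) + i_ * rc (Y 0 j)).
  by rewrite !mxE.
have -> : (2^-1 *: (cmx X - i_ *: cmx Y)) 0 k = 2^-1 * (rc (X 0 k) - i_ * rc (Y 0 k)).
  by rewrite !mxE.
by rewrite !mulrA.
Qed.

End HolomorphicRicci.

(** * The Strominger-Bismut connection in a chart *)

Lemma Jstd_sqr (R : realType) n : Jstd *m Jstd = - 1%:M :> 'M[R]_(n + n).
Proof.
rewrite /Jstd mulmx_block !mulmx0 !mul0mx !mulmxN !mulNmx !mul1mx !add0r !addr0.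
by rewrite (scalar_mx_block _ _ (1 : R)) opp_block_mx !oppr0.
Qed.

Section StromingerBismut.
Context {R : realType} {n : nat} {M : complexManifold R n}.
Variables (g : hermitianMetric M) (nabla : affineConnection M).
Hypothesis nabla_SB : strominger_bismut g nabla.
Variable a : chart M.
Local Notation D := (chart_img a).
Local Notation Gamma := (nabla a).

Let oD : open D := @chart_img_open _ _ _ a.
Let sGamma := @connection_smooth _ _ _ nabla a.
Let sG := @metric_smooth _ _ _ g a.
Let G_sym := @Defs.metric_sym _ _ _ g a.
Let G_pos := @metric_pos _ _ _ g a.
Let G_J := @metric_J _ _ _ g a.

Lemma strominger_bismut_metric X Y Z : smooth_map_on D X -> smooth_map_on D Y ->
  smooth_map_on D Z -> forall x, D x ->
  'D_(X x) (fun y => bil (g a y) (Y y) (Z y)) x =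
  bil (g a x) (covariant Gamma X Y x) (Z x) + bil (g a x) (Y x) (covariant Gamma X Z x).
Proof. by case: nabla_SB => mc _ _; exact: mc. Qed.

Lemma strominger_bismut_J X Y : smooth_map_on D X -> smooth_map_on D Y ->
  forall x, D x ->
  covariant Gamma X (fun y => Y y *m Jstd) x = covariant Gamma X Y x *m Jstd.
Proof. by case: nabla_SB => _ Jc _; exact: Jc. Qed.

(** For constant fields the bracket vanishes, so the torsion has no derivative
    terms. *)
Lemma strominger_bismut_torsion x : D x -> forall v w z,
  bil (g a x) (torsion Gamma x v w) z = - bil (g a x) (torsion Gamma x v z) w.
Proof.
move=> Dx v w z; case: nabla_SB => _ _ st.
have [_] := st a _ _ _ (smooth_map_cst D v) (smooth_map_cst D w) (smooth_map_cst D z) x Dx.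
by rewrite /torsion3 /lie_bracket !derive_cst subrr !subr0 !(covariant_cst _ _ _ x).
Qed.

Lemma balanced_torsion_trace : balanced g -> forall x, D x -> forall w,
  endo_trace (fun v => torsion Gamma x v w *m Jstd) = 0.
Proof.
move=> bal x Dx w; apply: (torsion_balanced oD sG G_sym G_pos strominger_bismut_metric
  strominger_bismut_torsion (Jstd_sqr R n) G_J strominger_bismut_J (addnn n)) Dx => y s Dy.
exact: bal.
Qed.

Variable u : M -> R.
Hypothesis su : smooth_fun u.
Local Notation X := (gradient (g a) (u \o param a)).

(** The curvature commutes with [J], so the four real terms are Ricci terms of
    [X] and [J X], and balancedness identifies the latter with the former. *)
Lemma holomorphic_ricci_grad10 x : balanced g -> D x ->
  complex.Re (holomorphic_ricci g nabla a x (grad10 g u a x)) =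
  2^-1 * ricci Gamma x (X x) (X x).
Proof.
move=> bal Dx; rewrite (Re_holomorphic_ricci_grad10 g nabla Dx u) -/(X x).
have cJ := curv_J oD sGamma strominger_bismut_J.
have e1 : endo_trace (fun z => curv Gamma x z (X x *m Jstd) (X x) *m Jstd) =
    ricci Gamma x (X x *m Jstd) (X x *m Jstd).
  by apply: eq_endo_trace => v; rewrite -cJ.
have e2 : endo_trace (fun z => curv Gamma x z (X x) (X x *m Jstd) *m Jstd) =
    - ricci Gamma x (X x) (X x).
  by rewrite /ricci -endo_traceN; apply: eq_endo_trace => v; rewrite cJ // (mulJJ (Jstd_sqr R n)).
rewrite e1 e2 -!/(ricci Gamma x _ _).
rewrite (ricci_J oD sGamma sG G_sym G_pos strominger_bismut_metric strominger_bismut_torsion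
  (Jstd_sqr R n) G_J strominger_bismut_J (balanced_torsion_trace bal) _ Dx).
by field.
Qed.

Lemma divergence_gradient lambda x : eigenfunction g lambda u -> D x ->
  divergence Gamma X x = - (lambda * (u \o param a) x).
Proof.
case=> _ _ eig Dx; rewrite -(eig a x Dx).
rewrite (laplace_gradient oD sG G_sym G_pos strominger_bismut_metric strominger_bismut_torsion
  (su a) Dx).
by rewrite opprK.
Qed.

End StromingerBismut.

(** * Independence of the chart *)

Lemma smooth_map_differentiable (R : realType) m p (D : set 'rV[R]_m)
    (F : 'rV[R]_m -> 'rV[R]_p) x : open D -> smooth_map_on D F -> D x ->
  differentiable F x.
Proof.
move=> oD sF Dx.
have -> : F = \sum_(j < p) (fun y => F y 0 j *: (delta_mx 0 j : 'rV[R]_p)).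
  by apply/funext => y; rewrite fct_sumE -row_sum_delta.
apply: differentiable_sum => j; apply: differentiableZl.
exact: (smooth_on_differentiable oD (sF j) Dx).
Qed.

Section ChangeOfChart.
Context {R : realType} {n : nat} {M : complexManifold R n}.
Implicit Types (a b : chart M) (p : M).

Lemma chart_img_coord a p : chart_dom a p -> chart_img a (Defs.coord a p).
Proof. by move=> ap; exists p. Qed.

Lemma overlapS a b x : overlap a b x -> chart_img a x.
Proof. by case=> p [ap _] <-; exists p. Qed.

Lemma overlap_open a b : open (overlap a b).
Proof.
rewrite openE => x /[dup] abx /overlapS ax.
have [p [ap bp] px] := abx.
have nb : \forall y \near x, chart_dom b (param a y).
  apply: (param_continuous ax); apply: open_nbhs_nbhs; split; first exact: chart_dom_open.
  by rewrite -px coordK.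
have na : \forall y \near x, chart_img a y.
  by apply: open_nbhs_nbhs; split => //; exact: chart_img_open.
apply: filterS2 na nb => y [q aq <-]; rewrite coordK // => bq.
by exists q.
Qed.

Variables (g : hermitianMetric M) (u : M -> R).
Hypothesis su : smooth_fun u.
Local Notation X a := (gradient (g a) (u \o param a)).

Let bilX a x v : chart_img a x -> bil (g a x) (X a x) v = 'D_v (u \o param a) x.
Proof.
move=> ax; exact: (bil_gradient (@chart_img_open _ _ _ a) (@Defs.metric_sym _ _ _ g a)
  (@metric_pos _ _ _ g a) (su a)).
Qed.

Lemma derive_transition a b x v : overlap a b x ->
  'D_v (u \o param a) x =
  'D_(v *m 'J (transition a b) x) (u \o param b) (transition a b x).
Proof.
move=> abx; have oab := @overlap_open a b.
have dt : differentiable (transition a b) x.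
  by apply: (smooth_map_differentiable oab) abx; case: (transition_holomorphic a b).
have bx : chart_img b (transition a b x).
  by have [p [ap bp] <-] := abx; exists p => //; rewrite /transition /= coordK.
have du : differentiable (u \o param b) (transition a b x).
  exact: (smooth_on_differentiable (@chart_img_open _ _ _ b) (su b) bx).
have E : 'D_v (u \o param a) x = 'D_v ((u \o param b) \o transition a b) x.
  apply: (eq_derive_on oab) => // y [p [ap bp] <-].
  by rewrite /transition /= (coordK ap) (coordK bp).
rewrite E deriveE; last exact: differentiable_comp.
by rewrite diff_comp //= deriveE // -deriveEjacobian // deriveE.
Qed.

(** The gradients in the two charts correspond under the Jacobian matrix, because
    they represent the same differential in isometric inner products; the Jacobian
    is invertible since both Gram matrices are. *)
Lemma energy_transition c a b x : overlap a b x ->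
  energy (g a) (u \o param a) c x = energy (g b) (u \o param b) c (transition a b x).
Proof.
move=> abx; set y := transition a b x; set A := 'J (transition a b) x.
have ax := overlapS abx.
have by_ : chart_img b y.
  have [p [ap bp] px] := abx; exists p => //; by rewrite /y -px /transition /= coordK.
have GE : g a x = A *m g b y *m A^T.
  apply/matrixP => i j; rewrite -bil_delta (metric_transition g abx) -/y -/A.
  by rewrite -!rowE bil_mulmx.
have uA : A \in unitmx.
  have : g a x \in unitmx := metric_unit (@Defs.metric_sym _ _ _ g a) (@metric_pos _ _ _ g a) ax.
  by rewrite GE !unitmx_mul => /andP[/andP[]].
have XE : X a x *m A = X b y.
  have Gy : g b y \in unitmx :=
    metric_unit (@Defs.metric_sym _ _ _ g b) (@metric_pos _ _ _ g b) by_.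
  apply: (can_inj (mulmxK Gy)); apply/rowP => j.
  have E w : bil (g b y) (X a x *m A) w = bil (g b y) (X b y) w.
    rewrite -(mulmxKV uA w) -(metric_transition g abx) -/y -/A !bilX //.
    exact: derive_transition.
  have := E (delta_mx 0 j); rewrite /bil trmx_delta -!colE !mxE.
  by [].
rewrite /energy -XE (metric_transition g abx) -/y -/A.
have [p [ap bp] px] := abx.
by rewrite /y /transition -px /= (coordK ap) (coordK bp).
Qed.

End ChangeOfChart.

Section GlobalEnergy.
Context {R : realType} {n : nat} {M : complexManifold R n}.
Variables (g : hermitianMetric M) (u : M -> R).
Hypothesis su : smooth_fun u.
Variable c : R.
Implicit Types (a : chart M) (p : M).

Definition chart_at p : chart M := projT1 (cid (chart_cover p)).

Lemma chart_atP p : chart_dom (chart_at p) p.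
Proof. by rewrite /chart_at; case: cid. Qed.

Definition global_energy p : R :=
  energy (g (chart_at p)) (u \o param (chart_at p)) c (Defs.coord (chart_at p) p).

Lemma global_energyE a p : chart_dom a p ->
  global_energy p = energy (g a) (u \o param a) c (Defs.coord a p).
Proof.
move=> ap; rewrite /global_energy (energy_transition g su c (b := a)).
  by rewrite /transition /= (coordK (chart_atP p)).
by exists p => //; split => //; exact: chart_atP.
Qed.

Lemma continuous_global_energy : continuous global_energy.
Proof.
move=> p; have ap := chart_atP p; set a := chart_at p in ap.
have sE := smooth_energy (@chart_img_open _ _ _ a) (@metric_smooth _ _ _ g a)
  (@Defs.metric_sym _ _ _ g a) (@metric_pos _ _ _ g a) (su a) c.
have cE : {for p, continuous (energy (g a) (u \o param a) c \o Defs.coord a)}.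
  apply: continuous_comp; first exact: Defs.coord_continuous.
  by apply: (Ck_on_continuous (sE 0%N)); exact: chart_img_coord.
have E : \forall q \near p, (energy (g a) (u \o param a) c \o Defs.coord a) q = global_energy q.
  apply: filterS (open_nbhs_nbhs (conj (@chart_dom_open _ _ M a) ap)) => q aq.
  by rewrite (global_energyE aq).
apply: cvg_trans (near_eq_cvg E) _; rewrite (global_energyE ap); exact: cE.
Qed.

End GlobalEnergy.

(** * The eigenvalue estimate *)

(** An admissible [c] exists because
    [lambda - (mu - 1) K < lambda / mu] is equivalent to [lambda < mu K]. *)
Lemma coupling_constant (R : realFieldType) (lambda K mu : R) :
  0 < lambda -> 1 < mu -> lambda < mu * K ->
  exists2 c, 0 < c & 0 < lambda / mu - c /\ 0 < (mu - 1) * K - lambda + c.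
Proof.
move=> l0 mu1 lK; have mu0 : 0 < mu by exact: lt_trans mu1.
have q0 : 0 < lambda / mu by rewrite divr_gt0.
have E : lambda = mu * (lambda / mu) by rewrite mulrC divfK ?gt_eqF.
have qK : lambda / mu < K by rewrite ltr_pdivrMr // mulrC.
have gap : lambda - (mu - 1) * K < lambda / mu.
  have : 0 < (mu - 1) * (K - lambda / mu) by apply: mulr_gt0; lra.
  by rewrite {2}E; move: (lambda / mu) => q; nra.
move: q0 gap; move: (lambda / mu) ((mu - 1) * K) => q t q0 gap.
have [h|h] := leP (lambda - t) 0.
  by exists (q / 2); lra.
by exists ((lambda - t + q) / 2); lra.
Qed.

Theorem corollary1p4 (R : realType) (n : nat) (M : complexManifold R n)
  (g : hermitianMetric M) (nabla : affineConnection M)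
  (lambda1 : R) (u : M -> R) (K : R)
  (M_compact : compact [set: M])
  (g_balanced : balanced g)
  (nabla_SB : strominger_bismut g nabla)
  (lambda1_first : first_positive_eigenvalue g lambda1)
  (u_eigen : eigenfunction g lambda1 u)
  (K_pos : 0 < K)
  (ricci_bound : forall (a : chart M) (x : 'rV[R]_(n + n)), chart_img a x ->
     (2 * n%:R - 1) * K * complex.Re (norm2 g a x (grad10 g u a x))
     <= complex.Re (holomorphic_ricci g nabla a x (grad10 g u a x))) :
  2 * n%:R * K <= lambda1.
Proof.
have [l0 _ _] := lambda1_first; have [su [p0 up0] _] := u_eigen.
have [n0|n0] := posnP n; first by rewrite n0 mulr0 mul0r ltW.
rewrite leNgt; apply/negP => lK.
have mE : (n + n)%:R = 2 * n%:R :> R by rewrite natrD mulr_natl mulr2n.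
have mu1 : 1 < 2 * n%:R :> R by rewrite -mE ltr1n; lia.
have [c c0 [A0 B0]] := coupling_constant l0 mu1 lK.
pose E := global_energy g u c.
have [p _ pmax] : exists2 p, p \in [set: M] & forall q, q \in [set: M] -> E q <= E p.
  apply: compact_EVT_max => //; first by exists p0.
  exact/continuous_subspaceT/continuous_global_energy.
have {}pmax q : E q <= E p by apply: pmax; rewrite inE.
set a := chart_at p; have ap : chart_dom a p := chart_atP p.
set x := Defs.coord a p; have ax : chart_img a x := chart_img_coord ap.
have Emax y : chart_img a y ->
    energy (g a) (u \o param a) c y <= energy (g a) (u \o param a) c x.
  by move=> [q aq <-]; rewrite -!global_energyE.
have G_ge0 b y v : chart_img b y -> 0 <= bil (g b y) v v.
  move=> by_; have [->|v0] := eqVneq v 0; first by rewrite bil0l.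
  exact/ltW/metric_pos.
set X := gradient (g a) (u \o param a) x.
have ric : ((n + n)%:R - 1) * K * bil (g a x) X X <= ricci (nabla a) x X X.
  have := ricci_bound a x ax; rewrite (Re_norm2_grad10 g ax) -/(gradient _ _ x) -/X.
  rewrite (holomorphic_ricci_grad10 nabla_SB u g_balanced ax) -/X mE.
  by move: (ricci _ _ _ _) (bil _ _ _) => r q; rewrite mulrCA; lra.
have := maximum_estimate (@chart_img_open _ _ _ a) (@connection_smooth _ _ _ nabla a)
  (@metric_smooth _ _ _ g a) (@Defs.metric_sym _ _ _ g a) (@metric_pos _ _ _ g a)
  (strominger_bismut_metric nabla_SB (a := a)) (strominger_bismut_torsion nabla_SB (a := a))
  (su a) (fun y Dy => divergence_gradient nabla_SB su u_eigen Dy) ax Emax _ ric.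
rewrite addn_gt0 n0 => /(_ isT); rewrite -/X mE.
have := G_ge0 a x X ax; move: (sqr_ge0 ((u \o param a) x)).
have Ep : E p = bil (g a x) X X + c * (u \o param a) x ^+ 2.
  by rewrite /E (global_energyE g su c ap).
move: Ep; move: (bil _ _ _) (_ ^+ 2) => q w Ep w0 q0 est.
have ABw : 0 <= (lambda1 / (2 * n%:R) - c) * lambda1 * w.
  by rewrite !mulr_ge0 // ltW.
have ABq : 0 <= ((2 * n%:R - 1) * K - lambda1 + c) * q by rewrite mulr_ge0 // ltW.
have q00 : q = 0.
  apply/eqP; have : ((2 * n%:R - 1) * K - lambda1 + c) * q == 0 by rewrite eq_le ABq andbT; lra.
  by rewrite mulf_eq0 gt_eqF.
have w00 : w = 0.
  apply/eqP; have : (lambda1 / (2 * n%:R) - c) * lambda1 * w == 0.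
    by rewrite eq_le ABw andbT; lra.
  by rewrite !mulf_eq0 (gt_eqF A0) (gt_eqF l0).
(* the energy vanishes at its maximum but is positive where [u] is nonzero *)
have := pmax p0; rewrite Ep q00 w00 mulr0 addr0 /E leNgt => /negP; apply.
set b := chart_at p0; have bp : chart_dom b p0 := chart_atP p0.
rewrite (global_energyE g su c bp) /energy ltr_wpDl ?G_ge0 //; first exact: chart_img_coord.
by rewrite /= (coordK bp) mulr_gt0 // lt_def sqrf_eq0 up0 sqr_ge0.
Qed.
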